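(* Let $\mathcal P$ be an arity-wise finite dimensional operad, let $\mathcal C=\mathcal P^\vee$ be its linear dual cooperad, and let $\pi:\mathrm B\mathcal P\to\mathcal P$ be the universal operadic twisting morphism. Let $(i,p,h)$ be a contraction of complete chain complexes of $X$ onto $Y$, where $X$ is equipped with a complete $\Omega\mathcal C$-algebra structure, and let $A$ be a complete $\mathcal P$-algebra. Then the following two complete $s\mathcal L_\infty$-algebra structures on $A\,\widehat\otimes\,Y$ are equal: (1) the one obtained by first endowing $Y$ with the $\Omega\mathcal C$-algebra structure transferred from $X$ by the homotopy transfer theorem along $(i,p,h)$, and then forming the $s\mathcal L_\infty$-algebra $A\,\widehat\otimes^\pi\,Y$; (2) the one obtained by first forming the $s\mathcal L_\infty$-algebra $A\,\widehat\otimes^\pi\,X$ and then transferring its structure to $A\,\widehat\otimes\,Y$ by the homotopy transfer theorem along the contraction $(\mathrm{id}\,\widehat\otimes\,i,\ \mathrm{id}\,\widehat\otimes\,p,\ \mathrm{id}\,\widehat\otimes\,h)$.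
   Context: $\mathbb K$ is a field of characteristic $0$; chain complexes are $\mathbb Z$-graded with differentials of degree $-1$. A complete chain complex is a chain complex $V$ with a degreewise descending filtration $V=F_0V\supseteq F_1V\supseteq\cdots$ by subcomplexes with $V_n\cong\lim_kV_n/F_kV_n$; $\widehat\otimes$ is the completed tensor product; complete algebras over an operad are algebras in complete chain complexes. (Co)operads $\mathcal M$ are differential graded, regarded with the discrete filtration, and satisfy $\mathcal M(0)=0$, $\mathcal M(1)=\mathbb K\,\mathrm{id}$. $\mathrm B$ and $\Omega$ are the operadic bar and cobar constructions. $\mathrm{Com}$ is the operad of (non-unital) commutative algebras, $\mathrm{Com}(m)=\mathbb K\mu_m$ ($m\ge1$); $s\mathcal L_\infty=\Omega\mathrm{Com}^\vee$ is the operad of shifted homotopy Lie algebras, the generator $s^{-1}\mu_m^\vee$ acting as a symmetric operation $\ell_m$ of degree $-1$. *The structure $A\,\widehat\otimes^\pi\,B$.* For a complete $\mathcal P$-algebra $A$ and a complete $\Omega\mathcal C$-algebra $B$ (note $\Omega\mathcal C\cong(\mathrm B\mathcal P)^\vee$), $A\,\widehat\otimes\,B$ is a complete $(\mathcal P\otimes\Omega\mathcal C)$-algebra (arity-wise tensor product of operads), and $A\,\widehat\otimes^\pi\,B$ denotes the $s\mathcal L_\infty$-algebra obtained by pulling this structure back along the operad morphism $\mathsf M_\pi:s\mathcal L_\infty\to\mathcal P\otimes\Omega\mathcal C$ associated with $\pi$, given by $\mathsf M_\pi(s^{-1}\mu_m^\vee)=\sum_{i\in I(m)}(-1)^{|c_i|}p_i\otimes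 s^{-1}c_i$, where $\{p_i\}_{i\in I(m)}$ is a basis of $\mathcal P(m)$ and $c_i=p_i^\vee$ is the dual basis of $\mathcal C(m)$. *Contractions and homotopy transfer.* A contraction of $X$ onto $Y$ consists of filtration-preserving chain maps $i:Y\to X$, $p:X\to Y$ and a degree $1$ filtration-preserving map $h:X\to X$ with $pi=\mathrm{id}_Y$, $ip-\mathrm{id}_X=dh+hd$, $h^2=0$, $ph=0$, $hi=0$. An $\Omega\mathcal D$-algebra structure on $X$ (for a cooperad $\mathcal D$) is encoded by an operadic twisting morphism $\varphi_X:\mathcal D\to\mathrm{End}_X$. The structure on $Y$ provided by the homotopy transfer theorem is $\varphi_Y=\mathrm{VdL}_h\circ\mathcal T(s\varphi_X)\circ\Delta^{\mathrm{mon}}_{\mathcal D}$, where $\Delta_{\mathcal D}^{\mathrm{mon}}:\mathcal D\to\mathcal T(\mathcal D)$ is the (comonadic) total decomposition map of $\mathcal D$ into trees, and the Van der Laan map $\mathrm{VdL}_h:\mathcal T(s\mathrm{End}_X)\to\mathrm{End}_Y$ composes operations along a tree with leaves labelled by $i$, internal edges by $h$ and root by $p$. In (1) this is applied with $\mathcal D=\mathcal C$ and in (2) with $\mathcal D=\mathrm{Com}^\vee$. *)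

(* Defs.v *)
From HB Require Import structures.
From mathcomp Require Import all_boot all_order all_fingroup all_algebra.
From mathcomp Require Import generic_quotient zify boolp.
From mathcomp Require classical_sets.

Set Implicit Arguments.
Unset Strict Implicit.
Unset Printing Implicit Defensive.

Import GRing.Theory.
Local Open Scope ring_scope.

Section Graded.
Variable K : fieldType.

(* A Z-grading of V as an internal direct sum: gcomp n is the projection onto
   the degree n part, and every vector is the sum of finitely many of its
   components. *)
Record grading (V : lmodType K) := Grading {
  gcomp : int -> V -> V;
  gcomp_linear : forall n, linear (gcomp n);
  gcomp_proj : forall m n x,
    gcomp m (gcomp n x) = if m == n then gcomp n x else 0;
  gcomp_fin : forall x, exists s : seq int,
    uniq s /\ x = \sum_(n <- s) gcomp n x }.

Section OneGrading.
Variables (V : lmodType K) (G : grading V).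

Definition homog (n : int) (x : V) : Prop := gcomp G n x = x.

Definition gsupp (x : V) : seq int := projT1 (cid (gcomp_fin G x)).

(* even (b = false) or odd (b = true) part *)
Definition gpar (b : bool) (x : V) : V :=
  \sum_(n <- gsupp x | odd `|n|%N == b) gcomp G n x.

(* x |-> (-1)^(b |x|) x, extended linearly to inhomogeneous x *)
Definition gsgn (b : bool) (x : V) : V :=
  if b then gpar false x - gpar true x else x.

Definition subspace (U : V -> Prop) : Prop :=
  U 0 /\ forall a x y, U x -> U y -> U (a *: x + y).

End OneGrading.

(* Complete chain complexes. Completeness says that in each degree the map
   V_n -> lim_k V_n / F_k V_n is bijective: each compatible sequence of classes,
   given by representatives, comes from a unique element. *)
Record cchain := CChain {
  csort :> lmodType K;
  cgr : grading csort;
  cdiff : csort -> csort;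
  cfil : nat -> csort -> Prop;
  cdiff_linear : linear cdiff;
  cdiff_deg : forall n x, homog cgr n x -> homog cgr (n - 1) (cdiff x);
  cdiff_sq : forall x, cdiff (cdiff x) = 0;
  cfil_sub : forall k, subspace (cfil k);
  cfil_gr : forall k n x, cfil k x -> cfil k (gcomp cgr n x);
  cfil_diff : forall k x, cfil k x -> cfil k (cdiff x);
  cfil0 : forall x, cfil 0 x;
  cfilS : forall k x, cfil k.+1 x -> cfil k x;
  cfil_complete : forall (n : int) (x : nat -> csort),
    (forall k, homog cgr n (x k)) ->
    (forall k, cfil k (x k.+1 - x k)) ->
    exists! y, homog cgr n y /\ forall k, cfil k (y - x k) }.

End Graded.

Arguments gcomp {K V} g n x.
Arguments gsgn : simpl never.

Section GradedFacts.
Variable K : fieldType.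

Section Subspace.
Variables (W : lmodType K) (U : W -> Prop).
Hypothesis HU : subspace U.
Lemma sp_0 : U 0. Proof. by case: HU. Qed.
Lemma sp_add x y : U x -> U y -> U (x + y).
Proof. by move=> ux uy; rewrite -[x]scale1r; apply: HU.2. Qed.
Lemma sp_scale a x : U x -> U (a *: x).
Proof. by move=> ux; rewrite -[_ *: _]addr0; apply: HU.2 => //; exact: sp_0. Qed.
Lemma sp_opp x : U x -> U (- x).
Proof. by rewrite -scaleN1r; exact: sp_scale. Qed.
Lemma sp_sub x y : U x -> U y -> U (x - y).
Proof. by move=> ux uy; apply: sp_add => //; exact: sp_opp. Qed.
Lemma sp_sum I (r : seq I) (P : pred I) F :
  (forall i, P i -> U (F i)) -> U (\sum_(i <- r | P i) F i).
Proof. by move=> h; apply: big_ind => //; [exact: sp_0 | exact: sp_add]. Qed.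
End Subspace.

Lemma linear0' (V W : lmodType K) (f : V -> W) : linear f -> f 0 = 0.
Proof.
by move=> lf; have := lf (-1) 0 0; rewrite scaler0 add0r scaleN1r addNr.
Qed.
Lemma linearD' (V W : lmodType K) (f : V -> W) x y : linear f -> f (x + y) = f x + f y.
Proof. by move=> lf; have := lf 1 x y; rewrite !scale1r. Qed.
Lemma linearZ' (V W : lmodType K) (f : V -> W) a x : linear f -> f (a *: x) = a *: f x.
Proof. by move=> lf; have := lf a x 0; rewrite (linear0' lf) !addr0. Qed.
Lemma linearN' (V W : lmodType K) (f : V -> W) x : linear f -> f (- x) = - f x.
Proof. by move=> lf; rewrite -!scaleN1r linearZ'. Qed.
Lemma linearB' (V W : lmodType K) (f : V -> W) x y : linear f -> f (x - y) = f x - f y.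
Proof. by move=> lf; rewrite linearD' // linearN'. Qed.
Lemma linear_sum' (V W : lmodType K) (f : V -> W) I (r : seq I) (P : pred I) F : linear f ->
  f (\sum_(i <- r | P i) F i) = \sum_(i <- r | P i) f (F i).
Proof.
move=> lf; elim/big_rec2: _ => [|i y1 y2 _ <-]; first exact: linear0'.
exact: linearD'.
Qed.

Lemma homog0 (V : lmodType K) (G : grading V) n : homog G n 0.
Proof.
rewrite /homog; have := gcomp_linear G n (-1) 0 0.
by rewrite !scaler0 !add0r scaleN1r addNr.
Qed.

Lemma gcompE (V : cchain K) x (s : seq int) : uniq s ->
  (forall n, n \notin s -> gcomp (cgr V) n x = 0) ->
  forall (p : pred int),
  \sum_(n <- gsupp (cgr V) x | p n) gcomp (cgr V) n x
   = \sum_(n <- s | p n) gcomp (cgr V) n x.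
Proof.
move=> us hs p; rewrite /gsupp; case: cid => t /= [ut xt].
have ht n : n \notin t -> gcomp (cgr V) n x = 0.
  move=> nt; rewrite xt (linear_sum' _ _ _ (gcomp_linear _ _)) big_seq big1 // => m mt.
  by rewrite gcomp_proj; case: eqP => // nm; rewrite nm mt in nt.
transitivity (\sum_(n <- undup (s ++ t) | p n) gcomp (cgr V) n x).
  rewrite [RHS](bigID (mem t)) /= [X in _ = _ + X]big1 ?addr0; last first.
    by move=> n /andP[_]; exact: ht.
  rewrite -[LHS]big_filter -[RHS]big_filter; apply: perm_big; apply: uniq_perm.
  - exact: filter_uniq.
  - by apply: filter_uniq; exact: undup_uniq.
  - by move=> n; rewrite !mem_filter mem_undup mem_cat; case: (n \in t); rewrite ?orbT ?andbT ?andbF.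
rewrite [LHS](bigID (mem s)) /= [X in _ + X = _]big1 ?addr0; last first.
  by move=> n /andP[_]; exact: hs.
rewrite -[LHS]big_filter -[RHS]big_filter; apply: perm_big; apply: uniq_perm.
- by apply: filter_uniq; exact: undup_uniq.
- exact: filter_uniq.
- by move=> n; rewrite !mem_filter mem_undup mem_cat; case: (n \in s); rewrite ?orbT ?andbT ?andbF.
Qed.

Lemma gsupp_uniq (V : cchain K) x : uniq (gsupp (cgr V) x).
Proof. by rewrite /gsupp; case: cid => ? []. Qed.
Lemma gsuppP (V : cchain K) x n : n \notin gsupp (cgr V) x -> gcomp (cgr V) n x = 0.
Proof.
rewrite /gsupp; case: cid => t /= [ut xt] nt.
rewrite xt (linear_sum' _ _ _ (gcomp_linear _ _)) big_seq big1 // => m mt.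
by rewrite gcomp_proj; case: eqP => // nm; rewrite nm mt in nt.
Qed.
Lemma gsuppE (V : cchain K) x : x = \sum_(n <- gsupp (cgr V) x) gcomp (cgr V) n x.
Proof. by rewrite /gsupp; case: cid => t /= []. Qed.

Lemma gpar_linear (V : cchain K) b : linear (gpar (cgr V) b).
Proof.
move=> a x y; pose s := undup (gsupp (cgr V) x ++ gsupp (cgr V) y).
have us : uniq s by exact: undup_uniq.
have hx n : n \notin s -> gcomp (cgr V) n x = 0.
  by rewrite mem_undup mem_cat negb_or => /andP[/gsuppP].
have hy n : n \notin s -> gcomp (cgr V) n y = 0.
  by rewrite mem_undup mem_cat negb_or => /andP[_ /gsuppP].
rewrite /gpar (gcompE us hx) (gcompE us hy) (@gcompE _ _ s) //; last first.
  by move=> n ns; rewrite gcomp_linear hx // hy // scaler0 addr0.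
rewrite scaler_sumr -big_split; apply: eq_bigr => n _; exact: gcomp_linear.
Qed.

Lemma gpar_homog (V : cchain K) b n x : homog (cgr V) n x ->
  gpar (cgr V) b x = if odd `|n|%N == b then x else 0.
Proof.
move=> hx; rewrite /gpar (@gcompE _ _ [:: n]) //; first by rewrite big_mkcond big_seq1 hx.
by move=> m; rewrite inE -hx gcomp_proj => /negbTE ->.
Qed.

Lemma gsgn_linear (V : cchain K) b : linear (gsgn (cgr V) b).
Proof.
case: b => a x y //=; rewrite /gsgn !gpar_linear scalerBr opprD.
by rewrite addrACA.
Qed.

Lemma gsgn_homog (V : cchain K) b n x : homog (cgr V) n x ->
  gsgn (cgr V) b x = (-1) ^+ (odd `|n|%N && b) *: x.
Proof.
case: b => hx /=; last by rewrite andbF scale1r.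
rewrite /gsgn !(gpar_homog _ hx); case: (odd _) => /=.
  by rewrite sub0r expr1 scaleN1r.
by rewrite subr0 scale1r.
Qed.

Lemma gpar_fil (V : cchain K) b k x : cfil k x -> cfil k (gpar (cgr V) b x).
Proof.
by move=> fx; apply: sp_sum => [|n _]; [exact: cfil_sub | exact: cfil_gr].
Qed.

Lemma gsgn_fil (V : cchain K) b k x : cfil k x -> cfil k (gsgn (cgr V) b x).
Proof.
case: b => // fx; apply: sp_sub; [exact: cfil_sub | exact: gpar_fil | exact: gpar_fil].
Qed.

Lemma homogZ (V : lmodType K) (G : grading V) n a x : homog G n x -> homog G n (a *: x).
Proof. by rewrite /homog => hx; rewrite (linearZ' _ _ (gcomp_linear _ _)) hx. Qed.
Lemma homogD (V : lmodType K) (G : grading V) n x y :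
  homog G n x -> homog G n y -> homog G n (x + y).
Proof. by rewrite /homog => hx hy; rewrite (linearD' _ _ (gcomp_linear _ _)) hx hy. Qed.
Lemma homog_gcomp (V : lmodType K) (G : grading V) n x : homog G n (gcomp G n x).
Proof. by rewrite /homog gcomp_proj eqxx. Qed.

End GradedFacts.

Section Operations.
Variable K : fieldType.

Definition mop (m : nat) (V W : Type) := ('I_m -> V) -> W.

Definition upd (m : nat) (V : Type) (x : 'I_m -> V) (j : 'I_m) (v : V) :=
  fun l => if l == j then v else x l.

Definition mlinear (m : nat) (V W : lmodType K) (f : mop m V W) : Prop :=
  forall x j a u v,
    f (upd x j (a *: u + v)) = a *: f (upd x j u) + f (upd x j v).

Definition mdeg (m : nat) (V W : cchain K) (e : int) (f : mop m V W) : Prop :=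
  forall (d : 'I_m -> int) x, (forall j, homog (cgr V) (d j) (x j)) ->
    homog (cgr W) (e + \sum_j d j) (f x).

Definition mfil (m : nat) (V W : cchain K) (f : mop m V W) : Prop :=
  forall (k : 'I_m -> nat) x, (forall j, cfil (k j) (x j)) ->
    cfil (\sum_j k j)%N (f x).

Section End.
Variable V : cchain K.
Let G := cgr V.

(* For a reordering w of the inputs 0, ..., m-1: the Koszul sign of
   x_0 (x) ... (x) x_(m-1) |-> x_(w_0) (x) ... (x) x_(w_(m-1)),
   where b j is the parity of x_j. *)
Definition koszul (m : nat) (w : seq 'I_m) (b : 'I_m -> bool) : K :=
  (-1) ^+ #|[set ij : 'I_m * 'I_m |
     [&& ij.1 < ij.2, index ij.2 w < index ij.1 w, b ij.1 & b ij.2]]|%N.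

(* f, multiplied by the Koszul sign of w on homogeneous inputs *)
Definition kshuffle (m : nat) (W : lmodType K) (w : seq 'I_m) (f : mop m V W)
    : mop m V W :=
  fun x => \sum_(b : {ffun 'I_m -> bool})
    koszul w b *: f (fun j => gpar G (b j) (x j)).

(* The operad structure of End_V. The right action is
   (f^s)(x_0, ..., x_(m-1)) = +- f(x_(s 0), ..., x_(s (m-1))); recall that
   in 'S_m the product s * t is s followed by t. *)
Definition eact (m : nat) (f : mop m V V) (s : 'S_m) : mop m V V :=
  kshuffle (codom s) (fun x => f (x \o s)).

(* f o_i g; here b is the parity of g, which passes x_0, ..., x_(i-1) *)
Definition ecomp (m n i : nat) (b : bool) (f : mop m V V) (g : mop n V V)
    : mop (m + n).-1 V V :=
  fun x => let at_ k := oapp x 0 (insub k) in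
    f (fun l : 'I_m => if (l < i)%N then gsgn G b (at_ l)
             else if l == i :> nat then g (fun j : 'I_n => at_ (i + j)%N)
             else at_ (l + n).-1).

(* The differential of End_V on an operation of degree e *)
Definition ediff (m : nat) (e : int) (f : mop m V V) : mop m V V :=
  fun x => cdiff (f x) - (-1) ^+ `|e|%N *: \sum_(j < m)
    f (fun l => if (l < j)%N then gsgn G true (x l)
                else if l == j then cdiff (x l) else x l).

End End.
End Operations.

(* Arity-wise finite dimensional symmetric dg operads with P(0) = 0 and
   P(1) = K id, presented by partial compositions; slots are numbered from 0
   and opcomp i p q is only meaningful when i is smaller than the arity of p.
   Equations between elements of arities that are equal but not convertible
   are stated in {n & P n}. *)
Section Operad.
Variable K : fieldType.

(* The slot of p o_i q, for q of arity n, coming from the slot j != i of p *)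
Definition outer_slot (n i j : nat) : nat :=
  if (j < i)%N then j else (j + n).-1.

Record operad := Operad {
  opsort :> nat -> vectType K;
  opgr : forall m, grading (opsort m);
  opdiff : forall m, opsort m -> opsort m;
  opid : opsort 1;
  opact : forall m, opsort m -> 'S_m -> opsort m;
  opcomp : forall m n, nat -> opsort m -> opsort n -> opsort (m + n).-1;

  opdiff_linear : forall m, linear (@opdiff m);
  opdiff_deg : forall m e (p : opsort m),
    homog (opgr m) e p -> homog (opgr m) (e - 1) (opdiff p);
  opdiff_sq : forall m (p : opsort m), opdiff (opdiff p) = 0;

  opact_linear : forall m (s : 'S_m), linear (fun p => opact p s);
  opact_deg : forall m e (p : opsort m) s,
    homog (opgr m) e p -> homog (opgr m) e (opact p s);
  opact_diff : forall m (p : opsort m) s, opdiff (opact p s) = opact (opdiff p) s;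
  opact1 : forall m (p : opsort m), opact p 1%g = p;
  opactM : forall m (p : opsort m) s t, opact p (s * t)%g = opact (opact p s) t;

  opcomp_linearl : forall m n i (q : opsort n),
    linear (fun p : opsort m => opcomp i p q);
  opcomp_linearr : forall m n i (p : opsort m),
    linear (fun q : opsort n => opcomp i p q);
  opcomp_deg : forall m n i d e (p : opsort m) (q : opsort n), (i < m)%N ->
    homog (opgr m) d p -> homog (opgr n) e q ->
    homog (opgr _) (d + e) (opcomp i p q);
  opcomp_diff : forall m n i d (p : opsort m) (q : opsort n), (i < m)%N ->
    homog (opgr m) d p ->
    opdiff (opcomp i p q)
      = opcomp i (opdiff p) q + (-1) ^+ `|d|%N *: opcomp i p (opdiff q);
  opcomp_act : forall m n (i : 'I_m) (p : opsort m) (q : opsort n)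
      (s : 'S_m) (t : 'S_n) (u : 'S_(m + n).-1),
    (forall (j : 'I_m) (l : 'I_(m + n).-1), j != i ->
       l = outer_slot n i j :> nat -> u l = outer_slot n (s i) (s j) :> nat) ->
    (forall (j : 'I_n) (l : 'I_(m + n).-1),
       l = (i + j)%N :> nat -> u l = (s i + t j)%N :> nat) ->
    opcomp (s i) (opact p s) (opact q t) = opact (opcomp i p q) u;

  opcomp1l : forall n (q : opsort n), opcomp 0 opid q = q;
  opcomp1r : forall m i (p : opsort m), (i < m)%N ->
    existT opsort _ (opcomp i p opid) = existT opsort m p;
  opcomp_seq : forall l m n i j (p : opsort l) (q : opsort m) (r : opsort n),
    (i < l)%N -> (j < m)%N ->
    existT opsort _ (opcomp (i + j) (opcomp i p q) r)
      = existT opsort _ (opcomp i p (opcomp j q r));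
  opcomp_par : forall l m n i k d e (p : opsort l) (q : opsort m) (r : opsort n),
    (i < k)%N -> (k < l)%N ->
    homog (opgr m) d q -> homog (opgr n) e r ->
    existT opsort _ (opcomp (k + m).-1 (opcomp i p q) r)
      = existT opsort _ ((-1) ^+ `|(d * e)%R|%N *: opcomp i (opcomp k p r) q);

  op_arity0 : forall p : opsort 0, p = 0;
  op_arity1 : forall p : opsort 1, exists a, p = a *: opid;
  opid_neq0 : opid != 0 }.

Record opbasis (P : operad) := OpBasis {
  obdim : nat -> nat;
  obvec : forall m, (obdim m).-tuple (P m);
  obdeg : forall m, 'I_(obdim m) -> int;
  ob_basis : forall m, basis_of {: P m} (obvec m);
  ob_homog : forall m i, homog (opgr P m) (obdeg i) (tnth (obvec m) i) }.

(* The linear dual cooperad, arity-wise, with C(m)_n = (P(m)_(-n))^*. Its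
   decomposition map is delta_mon below. *)
Section Dual.
Variables (P : operad) (m : nat).

Definition dual := 'Hom(P m, K^o).

Definition dhomog (n : int) (c : dual) : Prop :=
  forall e p, homog (opgr P m) e p -> e != - n -> c p = 0.

Definition dact (c : dual) (s : 'S_m) : dual :=
  linfun (fun p => c (opact p s^-1%g) : K^o).

(* on elements of degree n *)
Definition ddiff (n : int) (c : dual) : dual :=
  linfun (fun p => - (-1) ^+ `|n|%N * c (opdiff p) : K^o).

Definition dbasis (e : opbasis P) (i : 'I_(obdim e m)) : dual :=
  linfun (coord (obvec e m) i : P m -> K^o).

End Dual.

(* P-algebras: morphisms of operads P -> End_A by filtered operations *)
Record palgebra (P : operad) := PAlgebra {
  pasort :> cchain K;
  paact : forall m, P m -> mop m pasort pasort;
  paact_linear : forall m x, linear (fun p => @paact m p x);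
  paact_mlinear : forall m p, mlinear (@paact m p);
  paact_deg : forall m e p, homog (opgr P m) e p -> mdeg e (@paact m p);
  paact_fil : forall m p, mfil (@paact m p);
  paact_id : forall x, paact (opid P) x = x ord0;
  paact_diff : forall m e p x, homog (opgr P m) e p ->
    @paact m (opdiff p) x = ediff e (@paact m p) x;
  paact_act : forall m p s x,
    @paact m (opact p s) x = eact (@paact m p) s x;
  paact_comp : forall m n i d (p : P m) (q : P n) x, (i < m)%N ->
    homog (opgr P n) d q ->
    paact (opcomp i p q) x = ecomp i (odd `|d|%N) (paact p) (paact q) x }.

End Operad.

(* The operad Com, with Com(m) = K mu_m for m >= 1 *)
Section Com.
Variable K : fieldType.

Definition com_sort (m : nat) : vectType K := 'rV[K]_(0 < m)%N.
Definition mu (m : nat) : com_sort m := const_mx 1.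
Definition cval (m : nat) (p : com_sort m) : K := \sum_j p ord0 j.

Lemma cvalK (m : nat) (p : com_sort m) : p = cval p *: mu m.
Proof.
apply/rowP=> j; rewrite !mxE mulr1 /cval.
case: m p j => [|m] p j; first by case: j.
by rewrite big_ord1 [j]ord1.
Qed.

Lemma cval_linear (m : nat) : linear (@cval m : _ -> K^o).
Proof.
move=> a u v; rewrite /cval scaler_sumr -big_split /=.
by apply: eq_bigr => j _; rewrite !mxE.
Qed.

Lemma cvalZ (m : nat) a (p : com_sort m) : cval (a *: p) = a * cval p.
Proof. by rewrite /cval mulr_sumr; apply: eq_bigr => j _; rewrite mxE. Qed.

Lemma cval_mu (m : nat) : (0 < m)%N -> cval (mu m) = 1.
Proof. by case: m => // m _; rewrite /cval big_ord1 mxE. Qed.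

Lemma cval_0 (m : nat) : cval (0 : com_sort m) = 0.
Proof. by rewrite /cval big1 // => j _; rewrite mxE. Qed.

Definition gr0comp (V : lmodType K) (n : int) (x : V) : V :=
  if n == 0 then x else 0.

Lemma gr0_linear (V : lmodType K) n : linear (@gr0comp V n).
Proof. by move=> a u v; rewrite /gr0comp; case: eqP => //; rewrite scaler0 addr0. Qed.

Lemma gr0_proj (V : lmodType K) m n x :
  @gr0comp V m (gr0comp n x) = if m == n then gr0comp n x else 0.
Proof.
rewrite /gr0comp; case: (m =P 0) => [->|m0]; case: (n =P 0) => [->|n0] //.
- by rewrite eq_sym; case: eqP.
- by case: eqP.
- by case: eqP.
Qed.

Lemma gr0_fin (V : lmodType K) x : exists s : seq int,
  uniq s /\ x = \sum_(n <- s) @gr0comp V n x.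
Proof. by exists [:: 0]; split; rewrite // big_seq1 /gr0comp eqxx. Qed.

Definition gr0 (V : lmodType K) : grading V :=
  Grading (@gr0_linear V) (@gr0_proj V) (@gr0_fin V).

Lemma gr0_homog (V : lmodType K) n (x : V) :
  homog (gr0 V) n x -> n = 0 \/ x = 0.
Proof. by rewrite /homog /= /gr0comp; case: eqP => [->|_ <-]; [left | right]. Qed.

Lemma gr0_homog0 (V : lmodType K) (x : V) : homog (gr0 V) 0 x.
Proof. by []. Qed.

Definition com_comp (m n i : nat) (p : com_sort m) (q : com_sort n)
    : com_sort (m + n).-1 := (cval p * cval q) *: mu (m + n).-1.

Lemma com_compE (l m : nat) a b : l = m -> a = b ->
  existT com_sort l (a *: mu l) = existT com_sort m (b *: mu m).
Proof. by move=> -> ->. Qed.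

Lemma cval0 (p : com_sort 0) : cval p = 0.
Proof. by rewrite /cval big_ord0. Qed.

Definition com_operad : operad K.
Proof.
refine (@Operad K com_sort (fun m => gr0 (com_sort m)) (fun m p => 0) (mu 1)
  (fun m p s => p) com_comp _ _ _ _ _ _ _ _ _ _ _ _ _ _ _ _ _ _ _ _).
- by move=> m a u v; rewrite scaler0 addr0.
- by move=> m e p _; exact: homog0.
- by [].
- by [].
- by [].
- by [].
- by [].
- by [].
- move=> m n i q a u v; rewrite /com_comp (cval_linear a u v).
  by rewrite mulrDl scalerDl scalerA mulrA.
- move=> m n i p a u v; rewrite /com_comp (cval_linear a u v).
  by rewrite mulrDr scalerDl scalerA mulrCA.
- move=> m n i d e p q _ /gr0_homog [->|->]; last first.
    by move=> _; rewrite /com_comp cval_0 mul0r scale0r; exact: homog0.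
  move=> /gr0_homog [->|->]; first by rewrite addr0; exact: gr0_homog0.
  by rewrite /com_comp cval_0 mulr0 scale0r; exact: homog0.
- by move=> *; rewrite /com_comp !cval_0 mul0r mulr0 !scale0r scaler0 addr0.
- by [].
- move=> n q; rewrite /com_comp cval_mu // mul1r; exact/esym/cvalK.
- move=> m i p im; rewrite /com_comp cval_mu // mulr1 {2}(cvalK p).
  by apply: com_compE => //; rewrite addn1.
- move=> l m n i j p q r il jm; apply: com_compE; first by lia.
  rewrite !cvalZ; case: n r => [|n] r; first by rewrite !cval0 !(mulr0, mul0r).
  by rewrite !cval_mu ?mulr1 ?mulrA //; lia.
- move=> l m n i k d e p q r ik kl qd re.
  have -> : (-1) ^+ `|(d * e)%R|%N *: com_comp i (com_comp k p r) q
      = com_comp i (com_comp k p r) q :> com_sort _.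
    move: qd re => /gr0_homog [->|->]; last first.
      by move=> _; rewrite /com_comp cval_0 mulr0 scale0r scaler0.
    by move=> _; rewrite mul0r expr0 scale1r.
  apply: com_compE; first by lia.
  rewrite !cvalZ; case: m q {qd} => [|m] q; first by rewrite !cval0 !(mulr0, mul0r).
  case: n r {re} => [|n] r; first by rewrite !cval0 !(mulr0, mul0r).
  rewrite !cval_mu ?mulr1; [exact: mulrAC | lia | lia].
- by move=> p; rewrite [LHS]cvalK cval0 scale0r.
- by move=> p; exists (cval p); exact: cvalK.
- apply/eqP => /(congr1 (@cval 1)); rewrite cval_mu // cval_0.
  by move/eqP; rewrite oner_eq0.
Defined.

End Com.

(* Planar representatives of rooted trees with m labelled leaves, whose vertices
   with k inputs are decorated by elements of M k. *)
Inductive tree (M : nat -> Type) (m : nat) : Type :=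
  | Leaf of 'I_m
  | Node k of M k & seq (tree M m).

Section Trees.

Fixpoint leaves (M : nat -> Type) m (t : tree M m) : seq 'I_m :=
  match t with
  | Leaf i => [:: i]
  | Node _ _ ts => flatten [seq leaves u | u <- ts]
  end.

(* the decorations, in planar prefix order *)
Fixpoint nodes (M : nat -> Type) m (t : tree M m) : seq {k & M k} :=
  match t with
  | Leaf _ => [::]
  | Node k v ts => existT M k v :: flatten [seq nodes u | u <- ts]
  end.

Fixpoint tmap (M N : nat -> Type) (f : forall k, M k -> N k) m (t : tree M m)
    : tree N m :=
  match t with
  | Leaf i => Leaf N i
  | Node k v ts => Node (f k v) [seq tmap f u | u <- ts]
  end.

Fixpoint cart (T : Type) (ss : seq (seq T)) : seq (seq T) :=
  if ss is s :: ss' then [seq x :: r | x <- s, r <- cart ss'] else [:: [::]].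

Definition shape := tree (fun=> unit).

(* One planar representative of each isomorphism class of trees with leaves
   labelled by S and all vertices of arity at least 2, provided #|S| <= n. *)
Fixpoint trees_on m (n : nat) (S : {set 'I_m}) : seq (shape m) :=
  if n isn't n'.+1 then [::] else
  [seq Leaf _ i | i <- enum S & #|S| == 1%N] ++
  flatten [seq [seq Node (k := #|Q|) tt ts
                  | ts <- cart [seq trees_on n' B | B <- enum Q]]
          | Q : {set {set 'I_m}} <-
              enum [set Q : {set {set 'I_m}} | partition Q S & (1 < #|Q|)%N]].

Definition trees m : seq (shape m) := trees_on m [set: 'I_m].

(* all ways of decorating the vertices of arity k of a shape from the list
   lab k *)
Fixpoint decorate (M : nat -> Type) (lab : forall k, seq (M k)) m (t : shape m)
    : seq (tree M m) :=
  match t with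
  | Leaf i => [:: Leaf M i]
  | Node k _ ts =>
      [seq Node v us | v <- lab k, us <- cart [seq decorate lab u | u <- ts]]
  end.

End Trees.

Section TreeComposition.
Variables (K : fieldType) (P : operad K).

(* Composition of a P-decorated tree, by partial compositions in planar prefix
   order. The state consists of the number of leaves already passed, which is
   the slot to be filled next, and the current composite. *)
Fixpoint graft m (t : tree (fun k => P k) m) (st : nat * {n & P n}) : nat * {n & P n} :=
  match t with
  | Leaf _ => (st.1.+1, st.2)
  | Node k p ts =>
      foldl (fun st' u => graft u st')
        (st.1, Tagged (fun n => P n) (opcomp st.1 (tagged st.2) p)) ts
  end.

(* the planar composite with its j-th input relabelled by the j-th leaf *)
Definition tcomp m (t : tree (fun k => P k) m) : P m :=
  opact (untag (T_ := fun n => P n) (i := m) 0 id (graft t (0%N, Tagged (fun n => P n) (opid P))).2)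
    (insubd (1%g : 'S_m) [ffun j => nth j (leaves t) j]).

Variable e : opbasis P.

Definition nodd m (t : tree (fun k => 'I_(obdim e k)) m) : nat :=
  count (fun v => odd `|obdeg (tagged v)|%N) (nodes t).

(* The total decomposition map C -> T(C) of C = P^dual, the transpose of the
   composition T(P) -> P; elements of T(C)(m) are written as formal linear
   combinations of trees decorated by homogeneous elements of C, which carry
   their parity. Since (f (x) g)(x (x) y) = (-1)^(|g||x|) f(x) g(y), the dual
   basis element of a tensor product of homogeneous basis elements, r of which
   are odd, is (-1)^(r (r-1) / 2) times the tensor product of the dual ones. *)
Definition delta_mon m (c : dual P m)
    : seq (K * tree (fun k => bool * dual P k)%type m) :=
  [seq ((-1) ^+ 'C(nodd t, 2) * c (tcomp (tmap (fun k i => tnth (obvec e k) i) t)),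
        tmap (fun k (i : 'I_(obdim e k)) => (odd `|obdeg i|%N, dbasis i)) t)
    | s <- trees m, t <- decorate (fun k => enum 'I_(obdim e k)) s].

End TreeComposition.

Section Evaluation.
Variables (K : fieldType) (V : cchain K).
Let G := cgr V.

Definition tparity m (ts : seq (tree (fun k => bool * mop k V V)%type m)) : bool :=
  odd (count (fun v => (tagged v).1) (flatten [seq nodes t | t <- ts])).

(* Composition of a tree of operations with inputs listed by leaf labels, h
   being inserted on the internal edges. A vertex is decorated by (b, f), b
   being the parity of h f. In f o (g_1 (x) ... (x) g_k) the operation g_j
   passes the inputs of g_1, ..., g_(j-1). *)
Fixpoint teval (h : V -> V) m (t : tree (fun k => bool * mop k V V)%type m)
    (x : 'I_m -> V) : V :=
  match t with
  | Leaf i => x i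
  | Node k bf ts =>
      let fix vals us := match us with
        | [::] => [::]
        | u :: us' =>
            let y := teval h u (gsgn G (tparity us') \o x) in
            (if u is Node _ _ _ then h y else y) :: vals us'
        end in
      bf.2 (fun j : 'I_k => nth 0 (vals ts) j)
  end.

(* including the Koszul sign for bringing the inputs in planar order *)
Definition tact (h : V -> V) m (t : tree (fun k => bool * mop k V V)%type m)
    : mop m V V := kshuffle (leaves t) (teval h t).

End Evaluation.

Section Transfer.
Variables (K : fieldType) (P : operad K) (e : opbasis P).

(* Underlying data of an Omega(P^dual)-algebra: the map P^dual -> End_X *)
Definition opdata (X : cchain K) := forall m, dual P m -> mop m X X.

(* phi * phi, from the part of the decomposition map on trees with two
   vertices; (phi (x) phi)(c (x) c') = (-1)^|c| phi(c) (x) phi(c') *)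
Definition opstar (X : cchain K) (phi : opdata X) m (c : dual P m) : mop m X X :=
  fun x => \sum_(at_ <- delta_mon e c | size (nodes at_.2) == 2)
    (at_.1 * (-1) ^+ (if at_.2 is Node _ bc _ then bc.1 else false)) *:
    tact id (tmap (fun k bc => (~~ bc.1, phi k bc.2)) at_.2) x.

(* Complete Omega(P^dual)-algebras, as operadic twisting morphisms *)
Record omega_alg := OmegaAlg {
  oasort :> cchain K;
  oatw :> opdata oasort;
  oatw_linear : forall m x, linear (fun c => oatw (m := m) c x);
  oatw_mlinear : forall m (c : dual P m), mlinear (oatw c);
  oatw_deg : forall m n (c : dual P m), dhomog n c -> mdeg (n - 1) (oatw c);
  oatw_fil : forall m (c : dual P m), mfil (oatw c);
  oatw_act : forall m (c : dual P m) s x, oatw (dact c s) x = eact (oatw c) s x;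
  oatw_id : forall (c : dual P 1) x, oatw c x = 0;
  oatw_mc : forall m n (c : dual P m) x, dhomog n c ->
    ediff (n - 1) (oatw c) x + oatw (ddiff n c) x + opstar oatw c x = 0 }.

Section VdL.
Variables X Y : cchain K.

(* The Van der Laan map. A vertex s f is given as (parity of s f, f), and s f
   has the same parity as h f. The trivial tree only occurs in the image of
   the coaugmentation, on which transferred structures vanish. *)
Definition vdl (i : Y -> X) (p : X -> Y) (h : X -> X) m
    (t : tree (fun k => bool * mop k X X)%type m) : mop m Y Y :=
  fun y => if t is Leaf _ then 0 else p (tact h t (i \o y)).

Definition transfer (i : Y -> X) (p : X -> Y) (h : X -> X) (phi : opdata X)
    : opdata Y :=
  fun m c y => \sum_(at_ <- delta_mon e c)
    at_.1 *: vdl i p h (tmap (fun k bc => (bc.1, phi k bc.2)) at_.2) y.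

End VdL.
End Transfer.

Section Contraction.
Variable K : fieldType.

Definition filtered_map (X Y : cchain K) (n : int) (f : X -> Y) : Prop :=
  [/\ linear f,
      forall d x, homog (cgr X) d x -> homog (cgr Y) (d + n) (f x)
    & forall k x, cfil k x -> cfil k (f x)].

Record contraction (X Y : cchain K) := Contraction {
  ci : Y -> X;
  cp : X -> Y;
  ch : X -> X;
  ci_map : filtered_map 0 ci;
  cp_map : filtered_map 0 cp;
  ch_map : filtered_map 1 ch;
  ci_diff : forall y, ci (cdiff y) = cdiff (ci y);
  cp_diff : forall x, cp (cdiff x) = cdiff (cp x);
  cpi : forall y, cp (ci y) = y;
  cip : forall x, ci (cp x) - x = cdiff (ch x) + ch (cdiff x);
  chh : forall x, ch (ch x) = 0;
  cph : forall x, cp (ch x) = 0;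
  chi : forall y, ch (ci y) = 0 }.

End Contraction.

Arguments oatw {K P e} o [m] c x.

(* The completed tensor product of A and B: in degree n it is
   lim_k (A (x) B)_n / F_k (A (x) B), F_k (A (x) B) being the sum of the
   F_i A (x) F_j B with i + j >= k. *)
Section CompletedTensor.
Local Open Scope quotient_scope.
Variables (K : fieldType) (A B : cchain K).

Section FormalSums.
Variable k : nat.

(* Bilinear maps with values in W that send all F_i A x F_j B, i + j >= k,
   to the subspace U *)
Definition tform (W : lmodType K) (U : W -> Prop) (f : A -> B -> W) : Prop :=
  [/\ subspace U, forall b, linear (f^~ b), forall a, linear (f a)
    & forall i j a b, (k <= i + j)%N -> cfil i a -> cfil j b -> U (f a b)].

Definition tsum (W : lmodType K) (f : A -> B -> W) (s : seq (A * B)) : W :=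
  \sum_(ab <- s) f ab.1 ab.2.

(* A list s stands for the sum of the a (x) b with (a, b) in s. By the universal
   property of (A (x) B) / F_k (A (x) B), the relation below says that s and s'
   are equal there. *)
Definition teq (s s' : seq (A * B)) : Prop :=
  forall W U f, @tform W U f -> U (tsum f s - tsum f s').

End FormalSums.

Definition tscale (a : K) (s : seq (A * B)) := [seq (a *: ab.1, ab.2) | ab <- s].

Definition tdiff (s : seq (A * B)) :=
  [seq (cdiff ab.1, ab.2) | ab <- s] ++
  [seq (gsgn (cgr A) true ab.1, cdiff ab.2) | ab <- s].

(* u n k represents the component of degree n in (A (x) B) / F_k (A (x) B) *)
Definition precompleted (u : int -> nat -> seq (A * B)) : Prop :=
  [/\ forall n k ab, ab \in u n k ->
        exists i j, [/\ homog (cgr A) i ab.1, homog (cgr B) j ab.2 & i + j = n],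
      forall n k, teq k (u n k.+1) (u n k)
    & exists ds : seq int, forall n k, n \notin ds -> teq k (u n k) [::]].

Record pretens := Pretens {
  ptval :> int -> nat -> seq (A * B);
  ptvalP : precompleted ptval }.

HB.instance Definition _ := gen_eqMixin pretens.
HB.instance Definition _ := gen_choiceMixin pretens.

Definition pteq (u v : pretens) : bool := `[< forall n k, teq k (u n k) (v n k) >].

Section Teq.
Variable k : nat.
Lemma teq_refl s : teq k s s.
Proof. by move=> W U f [HU _ _ _]; rewrite subrr; exact: sp_0. Qed.
Lemma teq_sym s t : teq k s t -> teq k t s.
Proof.
by move=> h W U f tf; case: (tf) => HU _ _ _; rewrite -opprB; apply: sp_opp => //; exact: h.
Qed.
Lemma teq_trans t s r : teq k s t -> teq k t r -> teq k s r.
Proof.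
move=> h1 h2 W U f tf; case: (tf) => HU _ _ _.
by rewrite -(subrKA (tsum f t)); apply: sp_add => //; [exact: h1 | exact: h2].
Qed.

Lemma tsum_cat (W : lmodType K) (f : A -> B -> W) s t :
  tsum f (s ++ t) = tsum f s + tsum f t.
Proof. exact: big_cat. Qed.
Lemma tsum_scale (W : lmodType K) U (f : A -> B -> W) a s :
  tform k U f -> tsum f (tscale a s) = a *: tsum f s.
Proof.
case=> _ fl _ _; rewrite /tsum big_map scaler_sumr; apply: eq_bigr => ab _ /=.
exact: (linearZ' _ _ (fl _)).
Qed.

Lemma teq_cat s s' t t' : teq k s s' -> teq k t t' -> teq k (s ++ t) (s' ++ t').
Proof.
move=> h1 h2 W U f tf; case: (tf) => HU _ _ _.
rewrite !tsum_cat opprD addrACA; apply: sp_add => //; [exact: h1 | exact: h2].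
Qed.
Lemma teq_scale a s s' : teq k s s' -> teq k (tscale a s) (tscale a s').
Proof.
move=> h W U f tf; case: (tf) => HU _ _ _.
by rewrite !(tsum_scale _ _ tf) -scalerBr; apply: sp_scale => //; exact: h.
Qed.
End Teq.

Lemma teqS k s t : teq k.+1 s t -> teq k s t.
Proof.
move=> h W U f [HU f1 f2 f3]; apply: h; split=> // i j a b kij; apply: f3.
exact: ltnW.
Qed.

Lemma teq0 s t : teq 0 s t.
Proof.
move=> W U f [HU _ _ f3]; have us r : U (tsum f r).
  by apply: sp_sum => // ab _; apply: (f3 0 0)%N => //; exact: cfil0.
exact: sp_sub.
Qed.

Lemma pteq_is_equiv : equiv_class_of pteq.
Proof.
split=> [u|u v|v u w].
- by apply/asboolP => n k; exact: teq_refl.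
- by apply/idP/idP => /asboolP h; apply/asboolP => n k; apply: teq_sym; exact: h.
- move=> /asboolP h1 /asboolP h2; apply/asboolP => n k.
  exact: teq_trans (h1 n k) (h2 n k).
Qed.

Canonical pteq_equiv := EquivRelPack pteq_is_equiv.

Definition ctens := {eq_quot pteq_equiv}.
HB.instance Definition _ := Choice.on ctens.
HB.instance Definition _ := EqQuotient.on ctens.

Lemma ctensP (u v : pretens) :
  (forall n k, teq k (u n k) (v n k)) <-> \pi_ctens u = \pi_ctens v.
Proof.
split=> [h|/eqmodP/asboolP //]; by apply/eqmodP/asboolP.
Qed.

Lemma repr_teq (u : pretens) n k : teq k (repr (\pi_ctens u) n k) (u n k).
Proof. by move: n k; apply/ctensP; rewrite reprK. Qed.

Lemma pt_zeroP : precompleted (fun _ _ => [::]).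
Proof.
split=> [//|n k|]; first exact: teq_refl.
by exists [::] => n k _; exact: teq_refl.
Qed.
Definition pt_zero := Pretens pt_zeroP.

Lemma pt_addP (u v : pretens) : precompleted (fun n k => u n k ++ v n k).
Proof.
case: u v => u [u1 u2 [du u3]] [v [v1 v2 [dv v3]]]; split=> /=.
- by move=> n k ab; rewrite mem_cat => /orP[/u1|/v1].
- by move=> n k; apply: teq_cat.
- exists (du ++ dv) => n k; rewrite mem_cat negb_or => /andP[/u3 h1 /v3 h2].
  by rewrite -[[::]]cats0; apply: teq_cat.
Qed.
Definition pt_add u v := Pretens (pt_addP u v).

Lemma pt_scaleP a (u : pretens) : precompleted (fun n k => tscale a (u n k)).
Proof.
case: u => u [u1 u2 [du u3]]; split=> /=.
- move=> n k ab /mapP[cd /u1 [i [j [h1 h2 <-]]] ->] /=; exists i, j; split=> //.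
  exact: homogZ.
- by move=> n k; apply: teq_scale.
- by exists du => n k /u3 h; rewrite -[[::]]/(tscale a [::]); apply: teq_scale.
Qed.
Definition pt_scale a u := Pretens (pt_scaleP a u).

Lemma pt_compP m (u : pretens) :
  precompleted (fun n k => if n == m then u n k else [::]).
Proof.
case: u => u [u1 u2 [du u3]]; split=> /=.
- by move=> n k ab; case: eqP => // _; exact: u1.
- by move=> n k; case: eqP => // _; exact: teq_refl.
- by exists du => n k /u3 h; case: eqP => // _; exact: teq_refl.
Qed.
Definition pt_comp m u := Pretens (pt_compP m u).

Lemma teq_diff k s s' : teq k s s' -> teq k (tdiff s) (tdiff s').
Proof.
move=> h W U f [HU f1 f2 f3].
pose g a b := f (cdiff a) b + f (gsgn (cgr A) true a) (cdiff b).
have gE r : tsum f (tdiff r) = tsum g r.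
  by rewrite tsum_cat /tsum !big_map -big_split.
rewrite !gE; apply: h; split=> //.
- move=> b a x y; rewrite /g cdiff_linear gsgn_linear !f1 scalerDr.
  by rewrite addrACA.
- by move=> a c x y; rewrite /g cdiff_linear !f2 scalerDr addrACA.
- move=> i j a b kij fa fb; apply: sp_add => //; apply: (f3 i j) => //.
  + exact: cfil_diff.
  + exact: gsgn_fil.
  + exact: cfil_diff.
Qed.

Lemma pt_diffP (u : pretens) : precompleted (fun n k => tdiff (u (n + 1) k)).
Proof.
case: u => u [u1 u2 [du u3]]; split=> /=.
- move=> n k ab; rewrite mem_cat => /orP[] /mapP[cd /u1 [i [j [h1 h2 ij]]] ->] /=.
  + exists (i - 1), j; split=> //; first exact: cdiff_deg.
    by rewrite addrAC ij addrK.
  + exists i, (j - 1); split=> //; [|exact: cdiff_deg|by rewrite addrA ij addrK].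
    by rewrite (gsgn_homog _ h1); exact: homogZ.
- by move=> n k; exact: teq_diff.
- exists [seq n - 1 | n <- du] => n k hn; rewrite -[[::]]/(tdiff [::]).
  apply: teq_diff; apply: u3; apply: contra hn => hn.
  by apply/mapP; exists (n + 1); rewrite ?addrK.
Qed.
Definition pt_diff u := Pretens (pt_diffP u).

Definition ct_zero : ctens := \pi_ctens pt_zero.
Definition ct_add (x y : ctens) : ctens := \pi_ctens (pt_add (repr x) (repr y)).
Definition ct_scale a (x : ctens) : ctens := \pi_ctens (pt_scale a (repr x)).
Definition ct_comp n (x : ctens) : ctens := \pi_ctens (pt_comp n (repr x)).
Definition ct_diff (x : ctens) : ctens := \pi_ctens (pt_diff (repr x)).
Definition ct_fil k (x : ctens) : Prop := forall n, teq k (repr x n k) [::].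

Lemma ct_addE u v : ct_add (\pi_ctens u) (\pi_ctens v) = \pi_ctens (pt_add u v).
Proof. by apply/ctensP => n k; apply: teq_cat; exact: repr_teq. Qed.
Lemma ct_scaleE a u : ct_scale a (\pi_ctens u) = \pi_ctens (pt_scale a u).
Proof. by apply/ctensP => n k; apply: teq_scale; exact: repr_teq. Qed.
Lemma ct_compE m u : ct_comp m (\pi_ctens u) = \pi_ctens (pt_comp m u).
Proof.
apply/ctensP => n k /=; case: eqP => _; [exact: repr_teq | exact: teq_refl].
Qed.
Lemma ct_diffE u : ct_diff (\pi_ctens u) = \pi_ctens (pt_diff u).
Proof. by apply/ctensP => n k; apply: teq_diff; exact: repr_teq. Qed.
Lemma ct_filE k (u : pretens) : ct_fil k (\pi_ctens u) <-> forall n, teq k (u n k) [::].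
Proof.
split=> h n; apply: teq_trans (h n); last exact: repr_teq.
by apply: teq_sym; exact: repr_teq.
Qed.

Lemma teqE k s s' : (forall W U f, @tform k W U f -> tsum f s = tsum f s') -> teq k s s'.
Proof.
by move=> h W U f tf; rewrite (h W U f tf) subrr; case: tf => HU _ _ _; exact: sp_0.
Qed.

Lemma ct_addA : associative ct_add.
Proof.
elim/quotW=> x; elim/quotW=> y; elim/quotW=> z.
rewrite (ct_addE y z) (ct_addE x y) (ct_addE x) (ct_addE _ z).
by apply/ctensP => n k /=; apply: teqE => *; rewrite !tsum_cat addrA.
Qed.
Lemma ct_addC : commutative ct_add.
Proof.
elim/quotW=> x; elim/quotW=> y; rewrite (ct_addE x y) (ct_addE y x).
by apply/ctensP => n k /=; apply: teqE => *; rewrite !tsum_cat addrC.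
Qed.
Lemma ct_add0 : left_id ct_zero ct_add.
Proof.
elim/quotW=> x; rewrite (ct_addE pt_zero x).
by apply/ctensP => n k /=; exact: teq_refl.
Qed.
Lemma ct_addN : left_inverse ct_zero (ct_scale (-1)) ct_add.
Proof.
elim/quotW=> x; rewrite (ct_scaleE _ x) (ct_addE _ x).
apply/ctensP => n k /=; apply: teqE => W U f tf.
by rewrite tsum_cat (tsum_scale _ _ tf) scaleN1r addNr /tsum big_nil.
Qed.

HB.instance Definition _ := GRing.isZmodule.Build ctens ct_addA ct_addC ct_add0 ct_addN.

Lemma ct_scaleA a b x : ct_scale a (ct_scale b x) = ct_scale (a * b) x.
Proof.
elim/quotW: x => x; rewrite !(ct_scaleE _ x) (ct_scaleE a).
apply/ctensP => n k /=; apply: teqE => W U f tf.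
by rewrite !(tsum_scale _ _ tf) scalerA.
Qed.
Lemma ct_scale1 : left_id 1 ct_scale.
Proof.
elim/quotW=> x; rewrite (ct_scaleE _ x); apply/ctensP => n k /=; apply: teqE => W U f tf.
by rewrite !(tsum_scale _ _ tf) scale1r.
Qed.
Lemma ct_scaleDr : right_distributive ct_scale +%R.
Proof.
move=> a; elim/quotW=> x; elim/quotW=> y.
rewrite /GRing.add /= (ct_addE x y) (ct_scaleE a x) (ct_scaleE a y) (ct_scaleE a).
rewrite ct_addE.
apply/ctensP => n k /=; apply: teqE => W U f tf.
by rewrite (tsum_scale _ _ tf) !tsum_cat !(tsum_scale _ _ tf) scalerDr.
Qed.
Lemma ct_scaleDl x : {morph ct_scale^~ x : a b / a + b}.
Proof.
elim/quotW: x => x a b; rewrite [RHS]/GRing.add /= !(ct_scaleE _ x) ct_addE.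
apply/ctensP => n k /=; apply: teqE => W U f tf.
by rewrite tsum_cat !(tsum_scale _ _ tf) scalerDl.
Qed.

HB.instance Definition _ :=
  GRing.Zmodule_isLmodule.Build K ctens ct_scaleA ct_scale1 ct_scaleDr ct_scaleDl.

Lemma ct_DE u v : \pi_ctens u + \pi_ctens v = \pi_ctens (pt_add u v).
Proof. exact: ct_addE. Qed.
Lemma ct_ZE a u : a *: \pi_ctens u = \pi_ctens (pt_scale a u).
Proof. exact: ct_scaleE. Qed.
Lemma ct_BE u v : \pi_ctens u - \pi_ctens v = \pi_ctens (pt_add u (pt_scale (-1) v)).
Proof. by rewrite -scaleN1r ct_ZE ct_DE. Qed.
Lemma ct_0E : 0 = \pi_ctens pt_zero.
Proof. by []. Qed.

Lemma tsum_diff k (W : lmodType K) U f s : @tform k W U f ->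
  tsum f (tdiff s) =
  tsum (fun a b => f (cdiff a) b + f (gsgn (cgr A) true a) (cdiff b)) s.
Proof. by move=> _; rewrite tsum_cat /tsum !big_map -big_split. Qed.

Lemma tform_diff k (W : lmodType K) U f : @tform k W U f ->
  tform k U (fun a b => f (cdiff a) b + f (gsgn (cgr A) true a) (cdiff b)).
Proof.
case=> HU f1 f2 f3; split=> //.
- by move=> b a x y; rewrite cdiff_linear gsgn_linear !f1 scalerDr addrACA.
- by move=> a c x y; rewrite cdiff_linear !f2 scalerDr addrACA.
- move=> i j a b kij fa fb; apply: (sp_add HU); apply: (f3 i j) => //.
  + exact: cfil_diff.
  + exact: gsgn_fil.
  + exact: cfil_diff.
Qed.

Lemma ct_comp_linear n : linear (ct_comp n).
Proof.
move=> a; elim/quotW=> x; elim/quotW=> y.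
rewrite (ct_ZE a x) ct_DE !ct_compE ct_ZE ct_DE; apply/ctensP => m k /=.
by case: eqP => _; exact: teq_refl.
Qed.

Lemma ct_comp_proj m n x : ct_comp m (ct_comp n x) = if m == n then ct_comp n x else 0.
Proof.
elim/quotW: x => x; rewrite (ct_compE n x) ct_compE.
case: (m =P n) => [->|mn]; rewrite ?ct_0E; apply/ctensP => l k /=.
  by case: eqP => _; exact: teq_refl.
by case: eqP => [->|_]; [case: eqP => // _|]; exact: teq_refl.
Qed.

Lemma pt_restrP (r : seq int) (u : pretens) :
  precompleted (fun n k => if n \in r then u n k else [::]).
Proof.
case: u => u [u1 u2 [du u3]]; split=> /=.
- by move=> n k ab; case: ifP => // _; exact: u1.
- by move=> n k; case: ifP => // _; exact: teq_refl.
- by exists du => n k /u3 h; case: ifP => // _; exact: teq_refl.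
Qed.

Lemma ct_comp_fin x : exists s : seq int, uniq s /\ x = \sum_(n <- s) ct_comp n x.
Proof.
elim/quotW: x => x; have [_ _ [ds xds]] := ptvalP x.
exists (undup ds); split; first exact: undup_uniq.
suff sumE r : uniq r -> \sum_(n <- r) ct_comp n (\pi_ctens x)
    = \pi_ctens (Pretens (pt_restrP r x)).
  rewrite sumE ?undup_uniq //; apply/ctensP => n k /=; rewrite mem_undup.
  by case: ifPn => [_|/xds //]; exact: teq_refl.
elim: r => [_|m r IH /= /andP[mr ur]].
  by rewrite big_nil ct_0E; apply/ctensP => n k; exact: teq_refl.
rewrite big_cons IH // ct_compE ct_DE; apply/ctensP => n k /=.
rewrite inE; case: eqP => [->|_] /=; last exact: teq_refl.
by rewrite (negbTE mr) cats0; exact: teq_refl.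
Qed.

Definition ct_grading : grading ctens := Grading ct_comp_linear ct_comp_proj ct_comp_fin.

Lemma ct_homogP n (u : pretens) : homog ct_grading n (\pi_ctens u) <->
  forall m k, m != n -> teq k (u m k) [::].
Proof.
rewrite /homog /= ct_compE; split.
  by move=> /ctensP h m k mn; have := h m k; rewrite /= (negbTE mn) => /teq_sym.
move=> h; apply/ctensP => m k /=; case: eqP => [_|/eqP mn]; first exact: teq_refl.
by apply: teq_sym; exact: h.
Qed.

Lemma ct_diff_linear : linear ct_diff.
Proof.
move=> a; elim/quotW=> x; elim/quotW=> y.
rewrite (ct_ZE a x) ct_DE !ct_diffE ct_ZE ct_DE; apply/ctensP => m k /=.
apply: teqE => W U f tf; have tg := tform_diff tf.
by rewrite !(tsum_cat, tsum_diff _ tf, tsum_scale _ _ tf, tsum_scale _ _ tg).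
Qed.

Lemma ct_diff_deg n x : homog ct_grading n x -> homog ct_grading (n - 1) (ct_diff x).
Proof.
elim/quotW: x => x /ct_homogP h; rewrite ct_diffE; apply/ct_homogP => m k mn /=.
rewrite -[[::]]/(tdiff [::]); apply: teq_diff; apply: h.
by apply: contra mn => /eqP <-; rewrite addrK.
Qed.

Lemma ct_diff_sq x : ct_diff (ct_diff x) = 0.
Proof.
elim/quotW: x => x; rewrite (ct_diffE x) ct_diffE ct_0E; apply/ctensP => n k.
have [x1 _ _] := ptvalP x; move: (x1 (n + 1 + 1) k) => /=.
move: (x _ _) => s hs; apply: teqE => W U f tf; have tg := tform_diff tf.
have [HU f1 f2 _] := tf.
rewrite (tsum_diff _ tf) (tsum_diff _ tg) /tsum big_nil big_seq big1 // => ab.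
move=> /hs [i [j [ha hb _]]]; have hda := cdiff_deg ha.
rewrite !cdiff_sq (linear0' (f1 _)) add0r (linear0' (f2 _)) addr0.
rewrite (gsgn_homog _ hda) (gsgn_homog _ ha) (linearZ' _ _ (@cdiff_linear _ A)).
rewrite !(linearZ' _ _ (f1 _)) -scalerDl !andbT.
have -> : odd `|i - 1|%N = ~~ odd `|i|%N by lia.
by case: (odd _); rewrite /= ?expr1 ?expr0 ?addrN ?addNr scale0r.
Qed.

Lemma ct_fil_sub k : subspace (ct_fil k).
Proof.
split; first by rewrite ct_0E; apply/ct_filE => n; exact: teq_refl.
move=> a; elim/quotW=> x; elim/quotW=> y /ct_filE hx /ct_filE hy.
rewrite ct_ZE ct_DE; apply/ct_filE => n /=.
rewrite -[[::]]cats0; apply: teq_cat => //.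
by rewrite -[[::]]/(tscale a [::]); exact: teq_scale.
Qed.

Lemma ct_fil_gr k n x : ct_fil k x -> ct_fil k (ct_comp n x).
Proof.
elim/quotW: x => x /ct_filE h; rewrite ct_compE; apply/ct_filE => m /=.
by case: eqP => _ //; exact: teq_refl.
Qed.

Lemma ct_fil_diff k x : ct_fil k x -> ct_fil k (ct_diff x).
Proof.
elim/quotW: x => x /ct_filE h; rewrite ct_diffE; apply/ct_filE => m /=.
by rewrite -[[::]]/(tdiff [::]); exact: teq_diff.
Qed.

Lemma ct_fil0 x : ct_fil 0 x. Proof. by move=> n; exact: teq0. Qed.

Lemma ct_filS k x : ct_fil k.+1 x -> ct_fil k x.
Proof.
elim/quotW: x => x /ct_filE h; apply/ct_filE => n.
have [_ x2 _] := ptvalP x; apply: teq_trans (teq_sym (x2 n k)) _.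
exact: teqS (h n).
Qed.

Lemma teq_sub0 k s t : teq k (s ++ tscale (-1) t) [::] -> teq k s t.
Proof.
move=> h W U f tf; have := h W U f tf.
by rewrite tsum_cat (tsum_scale _ _ tf) scaleN1r [tsum f [::]]big_nil subr0.
Qed.

Lemma sub0_teq k s t : teq k s t -> teq k (s ++ tscale (-1) t) [::].
Proof.
move=> h W U f tf; have := h W U f tf.
by rewrite tsum_cat (tsum_scale _ _ tf) scaleN1r [tsum f [::]]big_nil subr0.
Qed.

Lemma ct_complete (n : int) (x : nat -> ctens) :
  (forall k, homog ct_grading n (x k)) ->
  (forall k, ct_fil k (x k.+1 - x k)) ->
  exists! y, homog ct_grading n y /\ forall k, ct_fil k (y - x k).
Proof.
move=> hx cx.
have cx' k : teq k (repr (x k.+1) n k) (repr (x k) n k).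
  have := cx k; rewrite -[x k.+1]reprK -[x k]reprK ct_BE => /ct_filE /(_ n) /=.
  by rewrite !reprK => /teq_sub0.
have yP : precompleted (fun m k => if m == n then repr (x k) n k else [::]).
  split.
  - move=> m k ab; case: eqP => // ->; have [h _ _] := ptvalP (repr (x k)).
    exact: h.
  - move=> m k; case: eqP => _; last exact: teq_refl.
    have [_ h _] := ptvalP (repr (x k.+1)).
    exact: teq_trans (h n k) (cx' k).
  - by exists [:: n] => m k; rewrite inE => /negbTE ->; exact: teq_refl.
exists (\pi_ctens (Pretens yP)); split; first split.
- by apply/ct_homogP => m k /negbTE mn /=; rewrite mn; exact: teq_refl.
- move=> k; rewrite -[x k]reprK ct_BE; apply/ct_filE => m /=; apply: sub0_teq.
  case: eqP => [->|/eqP mn]; first exact: teq_refl.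
  apply: teq_sym; have := hx k; rewrite -{1}[x k]reprK => /ct_homogP h.
  exact: h.
- elim/quotW => z [/ct_homogP hz cz]; apply/ctensP => m k /=.
  case: eqP => [->|/eqP mn]; last by apply: teq_sym; exact: hz.
  have := cz k; rewrite -{1}[x k]reprK ct_BE => /ct_filE /(_ n) /= /teq_sub0.
  exact: teq_sym.
Qed.

Definition ctensor : cchain K :=
  CChain ct_diff_linear ct_diff_deg ct_diff_sq ct_fil_sub ct_fil_gr ct_fil_diff
    ct_fil0 ct_filS ct_complete.

Lemma pt_pureP (a : A) (b : B) : precompleted (fun n _ =>
  [seq (gcomp (cgr A) i a, gcomp (cgr B) (n - i) b) | i <- gsupp (cgr A) a]).
Proof.
split.
- move=> n k ab /mapP[i _ ->] /=; exists i, (n - i).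
  by split; [exact: homog_gcomp | exact: homog_gcomp | rewrite addrC subrK].
- by move=> n k; exact: teq_refl.
- exists [seq i + j | i <- gsupp (cgr A) a, j <- gsupp (cgr B) b] => n k hn.
  apply: teqE => W U f [_ _ f2 _]; rewrite /tsum big_nil big_map big_seq big1 //= => i ia.
  rewrite [gcomp (cgr B) _ b]gsuppP ?(linear0' (f2 _)) //; apply: contra hn => jb.
  by apply/allpairsP; exists (i, n - i); split=> //=; rewrite addrC subrK.
Qed.

(* the image of a (x) b *)
Definition pure (a : A) (b : B) : ctensor := \pi_ctens (Pretens (pt_pureP a b)).

End CompletedTensor.

Section TensorOperations.
Variables (K : fieldType) (A : cchain K).

(* p (x) f on completed tensor products, b being the parity of f: the unique
   multilinear filtered operation with
   (p (x) f)(a_0 (x) x_0, ...) = +- p(a_0, ...) (x) f(x_0, ...)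
   on homogeneous pure tensors, with the Koszul sign for moving f past all a_j
   and each x_i past the a_j with i < j. It exists as soon as p and f are
   homogeneous, multilinear and filtered, and is unique since finite sums of
   pure tensors are dense. *)
Definition op_tensor (X Y : cchain K) m (b : bool) (p : mop m A A) (f : mop m X Y)
    : mop m (ctensor A X) (ctensor A Y) :=
  classical_sets.xget (fun=> 0) (fun g : ('I_m -> ctensor A X) -> ctensor A Y =>
    [/\ mlinear g, mfil g
      & forall (d e : 'I_m -> int) a x,
          (forall j, homog (cgr A) (d j) (a j)) ->
          (forall j, homog (cgr X) (e j) (x j)) ->
          g (fun j => pure (a j) (x j)) =
          (-1) ^+ (b * \sum_(j < m) `|d j| + \sum_(j < m) \sum_(i < m | i < j) `|e i| * `|d j|)%N
            *: pure (p a) (f x)]).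

(* id (x) f for a linear map f of parity b *)
Definition id_tensor (X Y : cchain K) (b : bool) (f : X -> Y)
    : ctensor A X -> ctensor A Y :=
  fun t => op_tensor b (fun a : 'I_1 -> A => a ord0) (fun x => f (x ord0)) (fun=> t).

End TensorOperations.

Section PiAlgebra.
Variables (K : fieldType) (P : operad K) (e : opbasis P).

Lemma com_basisP m : basis_of {: com_operad K m} [tuple mu K m | i < (0 < m)%N].
Proof.
case: m => [|m]; last first.
  rewrite basisEdim; apply/andP; split; last first.
    by rewrite size_tuple dimvf /dim /= mul1n.
  apply/subvP => v _; rewrite (cvalK v); apply: memvZ; apply: memv_span.
  by apply/mapP; exists ord0; rewrite ?mem_enum.
rewrite basisEdim; apply/andP; split; last by rewrite size_tuple dimvf.
by apply/subvP => v _; rewrite (cvalK v) cval0 scale0r mem0v.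
Qed.

(* mu_m, in degree 0 *)
Definition com_basis : opbasis (com_operad K) :=
  OpBasis com_basisP (obdeg := fun _ _ => 0) (fun m i => gr0_homog0 _).

(* A (x)^pi X, for X with Omega(P^dual)-structure phi, as an algebra over
   Omega(Com^dual), the operad of shifted homotopy Lie algebras. By pullback
   along M_pi the generator dual to mu_m acts as
   \sum_i (-1)^|c_i| p_i (x) phi(c_i), where (p_i) is the basis of P(m) and (c_i)
   is its dual basis; phi(c_i) has parity |c_i| + 1. *)
Definition pi_alg (A : palgebra P) (X : cchain K) (phi : opdata P X)
    : opdata (com_operad K) (ctensor A X) :=
  fun m c t => c (mu K m) *: \sum_(i < obdim e m)
    (-1) ^+ `|obdeg i|%N *:
    op_tensor (~~ odd `|obdeg i|%N) (paact (tnth (obvec e m) i)) (phi m (dbasis i)) t.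

End PiAlgebra.

Arguments id_tensor {K} A {X Y} b f t.
Arguments pi_alg {K P} e A {X} phi m c t.

(* Main.v *)
(* Both structures are sums over trees. Expanding every vertex of a tree of
   operations of A (x)^pi X over a homogeneous basis of P writes (2) as a sum
   over trees decorated by basis elements, and so is (1), by the definition of
   the decomposition map of the dual cooperad. For one decorated tree, evaluation
   on pure tensors separates the A-factors, which compose to the action of the
   composite of the p_v in P, from the X-factors, which give the Van der Laan
   map. Moving the factors of p_1 f_1 ... p_r f_r past each other, together with
   the signs (-1)^|c_v| of M_pi and those of the maps id (x) h, produces exactly the
   sign of the decomposition map. Pure tensors suffice, since a multilinear
   filtered operation on a completed tensor product is determined by them;
   the same approximation argument, with completeness, constructs p (x) f. *)
From HB Require Import structures.
From mathcomp Require Import all_boot all_order all_fingroup all_algebra.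
From mathcomp Require Import generic_quotient zify boolp.
From mathcomp Require classical_sets.
Require Import Defs.

Set Implicit Arguments.
Unset Strict Implicit.
Unset Printing Implicit Defensive.

Import GRing.Theory.
Local Open Scope ring_scope.

(** * Complete complexes and pure tensors *)

(** Let r be the number of odd vertices of a decorated tree. In (2), a vertex followed by id (x) h
    is even, and the sign (-1)^|c_v| cancels the one from moving h past p_v. What is left is p_v (x)
    h f_v, with two factors of equal parity, so separating the factors costs r(r-1)/2
    transpositions. The root carries no h, and undoing it there costs (-1)^r more. In (1), r(r-1)/2
    is the coefficient in [delta_mon], and the extra r is the sign (-1)^|c_i| of the root: c_i pairs
    to a nonzero value with the composite of the p_v only if the degrees match. Both sides carry
    r(r+1)/2. The shape of the proof is dictated by [op_tensor] being picked by classical choice: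
    nothing can be computed from its definition. Identities are proved for operations satisfying
    [is_op_tensor] and transported by uniqueness, so existence has to be known for each summand
    beforehand. A second mismatch is that [tcomp] grafts from the root in planar order while [teval]
    evaluates from the leaves; [graft_act] reconciles them by an induction over arbitrary partial
    composites. *)

Section CompleteComplex.
Variables (K : fieldType) (V : cchain K).
Implicit Types (x y : V) (k N : nat).

Lemma cfil_le k l x : (k <= l)%N -> cfil l x -> cfil k x.
Proof.
move=> /subnK <-; elim: (l - k)%N => [//|n IH] fx.
by apply: IH; apply: cfilS.
Qed.

Lemma cfil_zero k : cfil k (0 : V).
Proof. by apply: sp_0; apply: cfil_sub. Qed.

Lemma cfilB k x y : cfil k x -> cfil k y -> cfil k (x - y).
Proof. by apply: sp_sub; apply: cfil_sub. Qed.

Lemma cfilD k x y : cfil k x -> cfil k y -> cfil k (x + y).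
Proof. by apply: sp_add; apply: cfil_sub. Qed.

Lemma cfilZ k c x : cfil k x -> cfil k (c *: x).
Proof. by apply: sp_scale; apply: cfil_sub. Qed.

Lemma cfil_trans k x y z : cfil k (x - y) -> cfil k (y - z) -> cfil k (x - z).
Proof. by move=> h1 h2; rewrite -(subrKA y); apply: cfilD. Qed.

Lemma cfil_sym k x y : cfil k (x - y) -> cfil k (y - x).
Proof. by move=> h; rewrite -opprB; apply: sp_opp => //; apply: cfil_sub. Qed.

(** Uniqueness in [cfil_complete] for the constant sequence 0, applied to each homogeneous
    component, since completeness is only given degree by degree. *)
Lemma cfil_sep x : (forall k, cfil k x) -> x = 0.
Proof.
move=> fx; rewrite (gsuppE x) big1 // => n _.
have [|k|y [_ u]] := @cfil_complete _ V n (fun=> 0).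
- by move=> _; exact: homog0.
- by rewrite subrr; apply: sp_0; exact: cfil_sub.
rewrite -(u (gcomp (cgr V) n x)) ?(u 0) //; split.
- exact: homog0.
- by move=> k; rewrite subrr; apply: sp_0; exact: cfil_sub.
- exact: homog_gcomp.
- by move=> k; rewrite subr0; exact: cfil_gr.
Qed.

(** Completeness is degreewise and elements have finitely many components, so a Cauchy sequence
    converges only if its degrees stay in a fixed range [-N, N]. *)
Definition gbounded N x := forall n : int, (N < `|n|)%N -> gcomp (cgr V) n x = 0.

Lemma gbounded_sub N : subspace (gbounded N).
Proof.
split=> [n _|a x y hx hy n Nn]; first exact: (linear0' (gcomp_linear _ _)).
by rewrite gcomp_linear hx // hy // scaler0 addr0.
Qed.

Lemma gbounded_homog N (d : int) x : (`|d| <= N)%N -> homog (cgr V) d x -> gbounded N x.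
Proof.
move=> dN hx n Nn; rewrite -hx gcomp_proj.
by case: eqP => // nd; move: dN; rewrite -nd leqNgt Nn.
Qed.

Lemma gboundedE N x : gbounded N x ->
  x = \sum_(n <- [seq i%:Z - N%:Z | i <- iota 0 (N + N).+1]) gcomp (cgr V) n x.
Proof.
move=> bx; rewrite {1}(gsuppE x).
have := @gcompE _ V x [seq i%:Z - N%:Z | i <- iota 0 (N + N).+1] _ _ predT; apply.
- by rewrite map_inj_uniq ?iota_uniq // => i j /(congr1 (+%R^~ N%:Z)); rewrite !subrK => -[].
- move=> n /mapP nn; apply: bx; rewrite ltnNge; apply/negP => nN; apply: nn.
  exists (absz (n + N%:Z)); first by rewrite mem_iota; lia.
  by lia.
Qed.

Lemma cauchy_lim N (z : nat -> V) : (forall k, gbounded N (z k)) ->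
  (forall k, cfil k (z k.+1 - z k)) -> exists y, forall k, cfil k (y - z k).
Proof.
move=> bz cz.
have limP n : exists y, forall k, cfil k (y - gcomp (cgr V) n (z k)).
  have [|k|y [[_ yP] _]] := @cfil_complete _ V n (fun k => gcomp (cgr V) n (z k)).
  - by move=> k; exact: homog_gcomp.
  - by rewrite -(linearB' _ _ (gcomp_linear _ _)); exact: cfil_gr.
  - by exists y.
have [l lP] := choice limP.
exists (\sum_(n <- [seq i%:Z - N%:Z | i <- iota 0 (N + N).+1]) l n) => k.
rewrite [in X in cfil _ X](gboundedE (bz k)) -sumrB; apply: sp_sum => //; exact: cfil_sub.
Qed.

End CompleteComplex.

(** * Density of pure tensors in the completed tensor product *)

Section PureTensors.
Local Open Scope quotient_scope.
Variables (K : fieldType) (A B : cchain K).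

Definition pure_rep (n : int) (a : A) (b : B) : seq (A * B) :=
  [seq (gcomp (cgr A) i a, gcomp (cgr B) (n - i) b) | i <- gsupp (cgr A) a].

(** The chosen support of [a] is traded for any list containing it, so that several vectors can be
    compared over one common list. *)
Lemma tsum_pure_rep k (W : lmodType K) U (f : A -> B -> W) n a b (s : seq int) :
  tform k U f -> uniq s -> (forall i, i \notin s -> gcomp (cgr A) i a = 0) ->
  tsum f (pure_rep n a b) = \sum_(i <- s) f (gcomp (cgr A) i a) (gcomp (cgr B) (n - i) b).
Proof.
move=> [_ f1 _ _] us hs; rewrite /tsum big_map /=.
pose F i := f (gcomp (cgr A) i a) (gcomp (cgr B) (n - i) b).
have F0 i : gcomp (cgr A) i a = 0 -> F i = 0.
  by move=> i0; rewrite /F i0; exact: (linear0' (f1 _)).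
rewrite -[LHS]/(\sum_(i <- _) F i) -[RHS]/(\sum_(i <- _) F i).
set g := gsupp _ _.
have gP i : i \notin g -> gcomp (cgr A) i a = 0 by exact: gsuppP.
have ug : uniq g by exact: gsupp_uniq.
transitivity (\sum_(i <- undup (g ++ s)) F i).
  rewrite [RHS](bigID (mem g)) /= [X in _ = _ + X]big1 ?addr0; last by move=> i /gP/F0.
  rewrite -[RHS]big_filter; apply: perm_big; apply: uniq_perm => //.
    by apply: filter_uniq; exact: undup_uniq.
  by move=> i; rewrite mem_filter mem_undup mem_cat; case: (i \in g).
rewrite [LHS](bigID (mem s)) /= [X in _ + X = _]big1 ?addr0; last by move=> i /hs/F0.
rewrite -[LHS]big_filter; apply: perm_big; apply: uniq_perm => //.
  by apply: filter_uniq; exact: undup_uniq.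
by move=> i; rewrite mem_filter mem_undup mem_cat orbC; case: (i \in s).
Qed.

Lemma tsum_pure_homog k (W : lmodType K) U (f : A -> B -> W) n i j a b :
  tform k U f -> homog (cgr A) i a -> homog (cgr B) j b ->
  tsum f (pure_rep n a b) = if n == i + j then f a b else 0.
Proof.
move=> tf ha hb; have [_ _ f2 _] := tf.
rewrite (@tsum_pure_rep k W U f n a b [:: i]) //; last first.
  by move=> l; rewrite inE -ha gcomp_proj => /negbTE ->.
rewrite big_seq1 ha -{1}hb gcomp_proj subr_eq addrC; case: eqP => // _.
  by rewrite hb.
exact: (linear0' (f2 _)).
Qed.

Lemma pureE (a : A) (b : B) : pure a b = \pi_(ctens A B) (Pretens (pt_pureP a b)) :> ctens A B.
Proof. by []. Qed.

Lemma pure_linearl (b : B) : linear (fun a : A => pure a b).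
Proof.
move=> c a a'; rewrite /pure [RHS]/GRing.add [in RHS]/GRing.scale /=.
rewrite (ct_scaleE c (Pretens (pt_pureP a b))) (ct_addE _ (Pretens (pt_pureP a' b))).
apply/ctensP => n k; apply: teqE => W U f tf /=.
rewrite tsum_cat (tsum_scale _ _ tf).
set s := undup (gsupp (cgr A) a ++ gsupp (cgr A) a').
have us : uniq s by exact: undup_uniq.
have hs i : i \notin s -> gcomp (cgr A) i a = 0.
  by rewrite mem_undup mem_cat negb_or => /andP[/gsuppP].
have hs' i : i \notin s -> gcomp (cgr A) i a' = 0.
  by rewrite mem_undup mem_cat negb_or => /andP[_ /gsuppP].
rewrite -!/(pure_rep _ _ _) !(tsum_pure_rep n b tf us) //; last first.
  by move=> i si; rewrite gcomp_linear hs // hs' // scaler0 addr0.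
have [_ f1 _ _] := tf.
by rewrite scaler_sumr -big_split; apply: eq_bigr => i _; rewrite gcomp_linear f1.
Qed.

Lemma pure_linearr (a : A) : linear (fun b : B => pure a b).
Proof.
move=> c b b'; rewrite /pure [RHS]/GRing.add [in RHS]/GRing.scale /=.
rewrite (ct_scaleE c (Pretens (pt_pureP a b))) (ct_addE _ (Pretens (pt_pureP a b'))).
apply/ctensP => n k; apply: teqE => W U f tf /=.
rewrite tsum_cat (tsum_scale _ _ tf) /tsum !big_map scaler_sumr -big_split /=.
have [_ _ f2 _] := tf.
by apply: eq_bigr => i _; rewrite gcomp_linear f2.
Qed.

Lemma pure_homog i j (a : A) (b : B) : homog (cgr A) i a -> homog (cgr B) j b ->
  homog (cgr (ctensor A B)) (i + j) (pure a b).
Proof.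
move=> ha hb; apply/ct_homogP => m k mn; apply: teqE => W U f tf.
by rewrite (tsum_pure_homog m tf ha hb) (negbTE mn) [RHS]big_nil.
Qed.

Lemma pure_fil i j (a : A) (b : B) : cfil i a -> cfil j b -> cfil (i + j) (pure a b).
Proof.
move=> fa fb; apply/ct_filE => n W U f [HU f1 f2 f3].
rewrite [X in _ - X]big_nil subr0 /tsum big_map; apply: sp_sum => // l _ /=.
by apply: (f3 i j) => //; exact: cfil_gr.
Qed.

Lemma pure_sumE (s : seq (A * B)) : exists u : pretens A B,
  (forall n k, u n k = flatten [seq pure_rep n ab.1 ab.2 | ab <- s])
  /\ \sum_(ab <- s) pure ab.1 ab.2 = \pi_(ctens A B) u :> ctens A B.
Proof.
elim: s => [|ab s [u [uE sE]]]; first by exists (pt_zero A B); rewrite big_nil ct_0E.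
exists (pt_add (Pretens (pt_pureP ab.1 ab.2)) u); split; first by move=> n k /=; rewrite uE.
by rewrite big_cons [LHS]/GRing.add /= sE pureE (ct_addE _ u).
Qed.

Lemma tsum_flatten (W : lmodType K) (f : A -> B -> W) T (r : seq T) g :
  tsum f (flatten [seq g i | i <- r]) = \sum_(i <- r) tsum f (g i).
Proof.
elim: r => [|i r IH]; first by rewrite /tsum !big_nil.
by rewrite /= tsum_cat IH big_cons.
Qed.

(** The universal property of the quotient by F_k, for a sum whose terms need not lie in F_k
    separately. As [ct_fil] tests one total degree at a time, [tsum f s] is regrouped by total
    degree. *)
Lemma pure_sum_kernel k (s : seq (A * B)) (W : lmodType K) U (f : A -> B -> W) :
  cfil k (\sum_(ab <- s) pure ab.1 ab.2) -> tform k U f -> U (tsum f s).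
Proof.
have [u [uE ->]] := pure_sumE s => /ct_filE hu tf.
have [HU _ f2 _] := tf.
(* All total degrees i + j in which a term of [s] can have a component. *)
pose N := undup [seq p.1 + p.2 | p <- flatten
  [seq [seq (i, j) | i <- gsupp (cgr A) ab.1, j <- gsupp (cgr B) ab.2] | ab <- s]].
have -> : tsum f s = \sum_(n <- N) (tsum f (u n k) - tsum f [::]).
  transitivity (\sum_(n <- N) \sum_(ab <- s) tsum f (pure_rep n ab.1 ab.2)); last first.
    by apply: eq_bigr => n _; rewrite uE tsum_flatten [X in _ - X]big_nil subr0.
  rewrite exchange_big /= [LHS]big_seq [RHS]big_seq; apply: eq_bigr => ab abs /=.
  under eq_bigr => n _ do rewrite /tsum big_map /=.
  rewrite exchange_big /=.
  have [_ f1 _ _] := tf.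
  rewrite [in LHS](gsuppE ab.1) (linear_sum' _ _ _ (f1 _)) [LHS]big_seq [RHS]big_seq.
  apply: eq_bigr => i ia /=; rewrite -(linear_sum' _ _ _ (f2 _)); congr (f _ _).
  rewrite -[RHS](@big_map _ _ _ _ _ (fun n => n - i) N predT (fun j => gcomp (cgr B) j ab.2)).
  rewrite [LHS](gsuppE ab.2).
  apply: (@gcompE _ B ab.2 _ _ _ predT).
    by rewrite map_inj_uniq ?undup_uniq //; exact: addIr.
  move=> j jN; apply: gsuppP; apply: contra jN => jb.
  apply/mapP; exists (i + j); last by rewrite addrAC subrr add0r.
  rewrite mem_undup; apply/mapP; exists (i, j) => //.
  apply/flattenP; exists [seq (i, j) | i <- gsupp (cgr A) ab.1, j <- gsupp (cgr B) ab.2].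
    by apply/mapP; exists ab.
  by apply/allpairsP; exists (i, j).
by apply: sp_sum => // n _; exact: hu.
Qed.

(** It depends on chosen representatives and is not linear in [t]; only its class modulo F_k is
    meaningful. *)
Definition pure_approx k (t : ctensor A B) : seq (A * B) :=
  flatten [seq repr (t : ctens A B) n k | n <- gsupp (cgr (ctensor A B)) t].

Lemma pure_approxP k (t : ctensor A B) : cfil k (t - \sum_(ab <- pure_approx k t) pure ab.1 ab.2).
Proof.
have [u [uE ->]] := pure_sumE (pure_approx k t).
rewrite -{1}[t : ctens A B]reprK; rewrite [X in cfil _ X]ct_BE; apply/ct_filE => n.
apply: sub0_teq; apply: teq_trans (_ : teq k (if n \in gsupp (cgr (ctensor A B)) t
   then repr (t : ctens A B) n k else [::]) _).
  case: ifPn => [_|ns]; first exact: teq_refl.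
  have := gsuppP ns; rewrite -{1}[t : ctens A B]reprK.
  move=> /(congr1 (fun x : ctensor A B => x : ctens A B)).
  rewrite [LHS](ct_compE n (repr (t : ctens A B))) ct_0E => /ctensP /(_ n k) /=.
  by rewrite eqxx.
rewrite uE; apply: teqE => W U f tf; rewrite tsum_flatten /pure_approx.
rewrite big_flatten big_map /=.
transitivity (\sum_(m <- gsupp (cgr (ctensor A B)) t)
   if m == n then tsum f (repr (t : ctens A B) m k) else 0).
  rewrite -big_mkcond /=; case: ifPn => ns.
    rewrite (big_rem n) //= eqxx big_seq_cond big1 ?addr0 // => m /andP[+ /eqP mn].
    by have ug := @gsupp_uniq _ (ctensor A B) t; rewrite (mem_rem_uniq n ug) inE mn eqxx.
  rewrite [LHS]big_nil big_seq_cond big1 // => m /andP[ms /eqP mn].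
  by rewrite -mn ms in ns.
apply: eq_bigr => m _.
have [u1 _ _] := ptvalP (repr (t : ctens A B)).
transitivity (\sum_(ab <- repr (t : ctens A B) m k) if m == n then f ab.1 ab.2 else 0).
  by case: eqP => // _; rewrite big1.
(* The representative in degree m consists of homogeneous pairs of total degree m, so [pure_rep n]
   keeps them for m = n and kills them otherwise. *)
rewrite [LHS]big_seq [RHS]big_seq; apply: eq_bigr => ab /u1 [i [j [ha hb ij]]].
by rewrite (tsum_pure_homog n tf ha hb) ij eq_sym.
Qed.

Lemma pure_approx_homog k t ab : ab \in pure_approx k t ->
  exists i j, [/\ homog (cgr A) i ab.1, homog (cgr B) j ab.2
    & i + j \in gsupp (cgr (ctensor A B)) t].
Proof.
move=> /flattenP[s /mapP[n nt ->]].
have [u1 _ _] := ptvalP (repr (t : ctens A B)).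
by move=> /u1 [i [j [ha hb ij]]]; exists i, j; split=> //; rewrite ij.
Qed.

End PureTensors.
Arguments pure_approxP {K A B} k t.
(** * Multilinear operations on completed tensor products *)

Section Slots.
Variables (K : fieldType) (m : nat).

Lemma upd_same (T : Type) (x : 'I_m -> T) j : upd x j (x j) = x.
Proof. by apply/funext => l; rewrite /upd; case: eqP => [->|]. Qed.

Lemma updC (T : Type) (x : 'I_m -> T) i j u v : i != j ->
  upd (upd x i u) j v = upd (upd x j v) i u.
Proof.
move=> ij; apply/funext => l; rewrite /upd; case: eqP => // ->.
by rewrite eq_sym (negbTE ij).
Qed.

Lemma upd_eq (T : Type) (x : 'I_m -> T) j u : upd x j u j = u.
Proof. by rewrite /upd eqxx. Qed.

Lemma upd_neq (T : Type) (x : 'I_m -> T) j l u : l != j -> upd x j u l = x l.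
Proof. by rewrite /upd => /negbTE ->. Qed.

Lemma comp_upd (T S : Type) (g : T -> S) (x : 'I_m -> T) j u :
  g \o upd x j u = upd (g \o x) j (g u).
Proof. by apply/funext => l; rewrite /upd /=; case: eqP. Qed.

Lemma mlinear_slot (V W : lmodType K) (f : mop m V W) (x : 'I_m -> V) j :
  mlinear f -> linear (fun u => f (upd x j u)).
Proof. by move=> lf a u v; exact: lf. Qed.

Lemma mlinear0 (V W : lmodType K) (f : mop m V W) (x : 'I_m -> V) j :
  mlinear f -> x j = 0 -> f x = 0.
Proof.
by move=> lf x0; rewrite -(upd_same x j) x0; exact: linear0' (mlinear_slot x j lf).
Qed.

Lemma mlinear_comp (V V' W W' : lmodType K) (f : mop m V W) (p : W -> W') (i : V' -> V) :
  mlinear f -> linear p -> linear i -> mlinear (fun x => p (f (i \o x))).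
Proof. by move=> lf lp li x j a u v; rewrite !comp_upd li lf lp. Qed.

Lemma mlinear_sum (V W : lmodType K) I (r : seq I) (P : pred I) (F : I -> mop m V W) :
  (forall i, P i -> mlinear (F i)) -> mlinear (fun x => \sum_(i <- r | P i) F i x).
Proof.
move=> lF x j a u v; rewrite scaler_sumr -big_split; apply: eq_bigr => i /lF; exact.
Qed.

Lemma mlinear_scale (V W : lmodType K) c (f : mop m V W) :
  mlinear f -> mlinear (fun x => c *: f x).
Proof. by move=> lf x j a u v; rewrite lf scalerDr !scalerA mulrC. Qed.

Lemma mlinearB (V W : lmodType K) (f g : mop m V W) :
  mlinear f -> mlinear g -> mlinear (fun x => f x - g x).
Proof. by move=> lf lg x j a u v; rewrite lf lg scalerBr opprD addrACA. Qed.

Lemma mlinear_slots (V V' W : lmodType K) (f : mop m V W) (i : 'I_m -> V' -> V) :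
  mlinear f -> (forall j, linear (i j)) -> mlinear (fun x => f (fun j => i j (x j))).
Proof.
move=> lf li x j a u v.
have E w : (fun l => i l (upd x j w l)) = upd (fun l => i l (x l)) j (i j w).
  by apply/funext => l; rewrite /upd; case: eqP => // ->.
by rewrite !E li lf.
Qed.

Lemma mfil_sum (V W : cchain K) I (r : seq I) (P : pred I) (F : I -> mop m V W) :
  (forall i, P i -> mfil (F i)) -> mfil (fun x => \sum_(i <- r | P i) F i x).
Proof.
by move=> fF k x hx; apply: sp_sum => [|i /fF]; [exact: cfil_sub | exact].
Qed.

Lemma mfil_scale (V W : cchain K) c (f : mop m V W) :
  mfil f -> mfil (fun x => c *: f x).
Proof. by move=> ff k x hx; apply: sp_scale; [exact: cfil_sub | exact: ff]. Qed.

Lemma mfilB (V W : cchain K) (f g : mop m V W) :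
  mfil f -> mfil g -> mfil (fun x => f x - g x).
Proof. by move=> ff fg k x hx; apply: cfilB; [exact: ff | exact: fg]. Qed.

End Slots.

(* A pair of tuples of inputs is extended to [m] completed tensors by
   expanding approximations of them into pure tensors. *)
Section Expansion.
Variables (K : fieldType) (A X Z : cchain K) (m : nat).
Variable g0 : ('I_m -> A) -> ('I_m -> X) -> Z.

Fixpoint expand (js : seq 'I_m) (s : 'I_m -> seq (A * X)) (a : 'I_m -> A) (x : 'I_m -> X) : Z :=
  if js is j :: js' then
    \sum_(ab <- s j) expand js' s (upd a j ab.1) (upd x j ab.2)
  else g0 a x.

Lemma expand_mem (U : Z -> Prop) js s a x : subspace U -> uniq js ->
  (forall a' x', (forall j, j \in js -> (a' j, x' j) \in s j) ->
     (forall j, j \notin js -> a' j = a j /\ x' j = x j) -> U (g0 a' x')) ->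
  U (expand js s a x).
Proof.
move=> HU; elim: js a x => [|j js IH] a x /=; first by move=> _; apply.
move=> /andP[jjs ujs] h; rewrite big_seq; apply: sp_sum => // ab abs.
apply: IH => // a' x' h1 h2; apply: h => l; rewrite inE.
  case/orP=> [/eqP ->|/h1 //].
  by have [-> ->] := h2 _ jjs; rewrite !upd_eq -surjective_pairing.
rewrite negb_or => /andP[lj ljs].
by have [-> ->] := h2 _ ljs; rewrite !upd_neq.
Qed.

Lemma expand_eq js s s' a x : (forall j, j \in js -> s j = s' j) ->
  expand js s a x = expand js s' a x.
Proof.
elim: js a x => //= j js IH a x h; rewrite h ?mem_head //; apply: eq_bigr => ab _.
by apply: IH => l ljs; apply: h; rewrite inE ljs orbT.
Qed.

Lemma expand_slot js s j u a x : uniq js -> j \in js ->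
  expand js (upd s j u) a x = \sum_(ab <- u) expand js (upd s j [:: ab]) a x.
Proof.
elim: js a x => //= i js IH a x /andP[ijs ujs]; rewrite inE.
case: (eqVneq j i) => [-> _|ji /= jjs].
  rewrite upd_eq; apply: eq_bigr => ab _; rewrite upd_eq big_seq1.
  apply: expand_eq => l ljs; rewrite !upd_neq //.
    by apply: contra ijs => /eqP <-.
  by apply: contra ijs => /eqP <-.
have sE v : upd s j v i = s i by rewrite upd_neq // eq_sym.
under [RHS]eq_bigr => ab _ do rewrite sE.
by rewrite sE exchange_big /=; apply: eq_bigr => ab _; rewrite IH.
Qed.

Lemma expand_single js a' x' a x : uniq js ->
  expand js (fun j => [:: (a' j, x' j)]) a x =
  g0 (fun j => if j \in js then a' j else a j) (fun j => if j \in js then x' j else x j).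
Proof.
elim: js a x => [|i js IH] a x //= /andP[ijs ujs]; rewrite big_seq1 IH //=.
congr g0; apply/funext => l; rewrite inE /upd; case: (eqVneq l i) => [->|_] //=;
  by rewrite (negbTE ijs).
Qed.

Hypothesis g0_linl : forall x, mlinear (g0^~ x).
Hypothesis g0_linr : forall a, mlinear (g0 a).

Lemma expand_linl js s a x j : j \notin js -> linear (fun u => expand js s (upd a j u) x).
Proof.
elim: js a x => [|i js IH] a x /=; first by move=> _; exact: (mlinear_slot a j (g0_linl x)).
rewrite inE negb_or => /andP[ji jjs] c u v.
rewrite scaler_sumr -big_split; apply: eq_bigr => ab _ /=.
by rewrite !(updC a _ _ ji) IH.
Qed.

Lemma expand_linr js s a x j : j \notin js -> linear (fun u => expand js s a (upd x j u)).
Proof.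
elim: js a x => [|i js IH] a x /=; first by move=> _; exact: (mlinear_slot x j (g0_linr a)).
rewrite inE negb_or => /andP[ji jjs] c u v.
rewrite scaler_sumr -big_split; apply: eq_bigr => ab _ /=.
by rewrite !(updC x _ _ ji) IH.
Qed.

(** A slot holding a single pure tensor acts like a fixed input outside the list of expanded slots.
    This reduces linearity in such a slot to [expand_linl] and [expand_linr]. *)
Lemma expand_remove js s j a1 x1 a x : uniq js -> j \in js ->
  expand js (upd s j [:: (a1, x1)]) a x = expand (rem j js) s (upd a j a1) (upd x j x1).
Proof.
elim: js a x => //= i js IH a x /andP[ijs ujs]; rewrite inE eq_sym.
case: (eqVneq i j) => [<- _|ij /= jjs].
  rewrite upd_eq big_seq1; apply: expand_eq => l ljs; rewrite upd_neq //.
  by apply: contra ijs => /eqP <-.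
rewrite upd_neq //; apply: eq_bigr => ab _; rewrite IH //.
by rewrite !(updC _ _ _ ij).
Qed.

Lemma expand_pure_linl js s j x1 a x : uniq js -> j \in js ->
  linear (fun a1 => expand js (upd s j [:: (a1, x1)]) a x).
Proof.
move=> ujs jjs c u v; rewrite !expand_remove //; apply: expand_linl.
by rewrite mem_rem_uniq // inE eqxx.
Qed.

Lemma expand_pure_linr js s j a1 a x : uniq js -> j \in js ->
  linear (fun x1 => expand js (upd s j [:: (a1, x1)]) a x).
Proof.
move=> ujs jjs c u v; rewrite !expand_remove //; apply: expand_linr.
by rewrite mem_rem_uniq // inE eqxx.
Qed.

Hypothesis g0_fil : forall (k l : 'I_m -> nat) a x,
  (forall j, cfil (k j) (a j)) -> (forall j, cfil (l j) (x j)) ->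
  cfil (\sum_j (k j + l j))%N (g0 a x).
Variable dg : int.
Hypothesis g0_deg : forall (d e : 'I_m -> int) a x,
  (forall j, homog (cgr A) (d j) (a j)) -> (forall j, homog (cgr X) (e j) (x j)) ->
  homog (cgr Z) (dg + \sum_j (d j + e j)) (g0 a x).

(** The seeds [0] are overwritten, since every slot occurs in [enum 'I_m]. *)
Definition expands (s : 'I_m -> seq (A * X)) : Z := expand (enum 'I_m) s (fun=> 0) (fun=> 0).

Let tsumT (s : seq (A * X)) : ctensor A X := \sum_(ab <- s) pure ab.1 ab.2.

Lemma expands_slot s j u : expands (upd s j u) = \sum_(ab <- u) expands (upd s j [:: ab]).
Proof. by apply: expand_slot; rewrite ?enum_uniq ?mem_enum. Qed.

Lemma expands_pure a x : expands (fun j => [:: (a j, x j)]) = g0 a x.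
Proof.
rewrite /expands expand_single ?enum_uniq //.
by congr g0; apply/funext => l; rewrite mem_enum.
Qed.

(* The slots from r on are pure; induction on r. *)
Lemma expands_fil (k : 'I_m -> nat) s : (forall j, cfil (k j) (tsumT (s j))) ->
  cfil (\sum_j k j)%N (expands s).
Proof.
move=> hs; pose pureslot s j := exists i l (a : A) (x : X),
  [/\ s j = [:: (a, x)], cfil i a, cfil l x & (k j <= i + l)%N].
suff H r : (r <= m)%N -> forall s : 'I_m -> seq (A * X),
    (forall j, cfil (k j) (tsumT (s j))) ->
    (forall j : 'I_m, (r <= j)%N -> pureslot s j) -> cfil (\sum_j k j)%N (expands s).
  by apply: (H m) => // j; rewrite leqNgt ltn_ord.
elim: r => [_|r IH rm] {hs}s hs ps.
  have [i hi] := choice (fun j => ps j (leq0n _)).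
  have [l hl] := choice hi; have [a ha] := choice hl; have [x hx] := choice ha.
  have -> : s = fun j => [:: (a j, x j)] by apply/funext => j; have [] := hx j.
  rewrite expands_pure; apply: (@cfil_le _ _ _ (\sum_j (i j + l j))%N).
    by apply: leq_sum => j _; have [] := hx j.
  by apply: g0_fil => j; have [] := hx j.
pose j0 := Ordinal rm; rewrite -(upd_same s j0) expands_slot.
have -> : \sum_(ab <- s j0) expands (upd s j0 [:: ab])
    = tsum (fun a x => expands (upd s j0 [:: (a, x)])) (s j0).
  by apply: eq_bigr => -[].
(* The sum in slot [j0] lies in F_(k j0) although its terms may not. The universal property allows
   it to be replaced by one pure tensor of filtration i + l >= k j0. *)
apply: (pure_sum_kernel (U := cfil (\sum_j k j)%N) (hs j0)).
split; first exact: cfil_sub.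
- by move=> x; apply: expand_pure_linl; rewrite ?enum_uniq ?mem_enum.
- by move=> a; apply: expand_pure_linr; rewrite ?enum_uniq ?mem_enum.
move=> i l a x kil fa fx; apply: IH; first exact: ltnW.
  move=> j; rewrite /upd; case: eqP => [->|_]; last exact: hs.
  by rewrite /tsumT big_seq1; apply: cfil_le kil _; exact: pure_fil.
move=> j rj; rewrite /pureslot; case: (eqVneq j j0) => [->|jj0].
  by exists i, l, a, x; split=> //; rewrite upd_eq.
rewrite upd_neq //; apply: ps; rewrite ltn_neqAle rj andbT.
by apply: contra jj0 => /eqP rj0; apply/eqP/val_inj.
Qed.

Lemma expands_cat s j u v :
  expands (upd s j (u ++ v)) = expands (upd s j u) + expands (upd s j v).
Proof. by rewrite expands_slot big_cat -!expands_slot. Qed.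

Lemma expands_scale s j c u :
  expands (upd s j (tscale c u)) = c *: expands (upd s j u).
Proof.
rewrite expands_slot big_map [in RHS]expands_slot scaler_sumr; apply: eq_bigr => -[a x] _ /=.
apply: (linearZ' _ _ (f := fun a => expands (upd s j [:: (a, x)]))).
by apply: expand_pure_linl; rewrite ?enum_uniq ?mem_enum.
Qed.

Lemma tsumT_cat u v : tsumT (u ++ v) = tsumT u + tsumT v.
Proof. exact: big_cat. Qed.
Lemma tsumT_scale c u : tsumT (tscale c u) = c *: tsumT u.
Proof.
rewrite /tsumT big_map scaler_sumr; apply: eq_bigr => ab _ /=.
by rewrite (linearZ' _ _ (pure_linearl _)).
Qed.

(* Changing the slots before r one at a time. *)
Lemma expands_cong k s s' : (forall j, cfil k (tsumT (s j) - tsumT (s' j))) ->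
  cfil k (expands s - expands s').
Proof.
move=> h; pose mix r := fun j : 'I_m => if (j < r)%N then s j else s' j.
suff H r : (r <= m)%N -> cfil k (expands (mix r) - expands s').
  suff -> : s = mix m by exact: H.
  by apply/funext => j; rewrite /mix ltn_ord.
elim: r => [_|r IH rm].
  rewrite (_ : mix 0 = s') ?subrr; first by apply: sp_0; exact: cfil_sub.
  by apply/funext => j; rewrite /mix.
apply: cfil_trans (IH (ltnW rm)); pose j0 := Ordinal rm.
have E1 : mix r.+1 = upd (mix r) j0 (s j0).
  apply/funext => j; rewrite /mix /upd ltnS leq_eqVlt -[r in _ == r]/(val j0) val_eqE.
  by case: (eqVneq j j0) => [->|].
have E2 : mix r = upd (mix r) j0 (s' j0).
  by rewrite -[LHS](upd_same _ j0); congr upd; rewrite /mix ltnn.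
rewrite E1 {2}E2 -scaleN1r -expands_scale -expands_cat.
(* Filtration level k is spent in slot [j0] alone and level 0 elsewhere, for a total of k. *)
apply: (@cfil_le _ _ _ (\sum_(j < m) (if j == j0 then k else 0))%N).
  by rewrite -big_mkcond big_pred1_eq.
apply: expands_fil => j; rewrite /upd; case: eqP => _; last exact: cfil0.
by rewrite tsumT_cat tsumT_scale scaleN1r; exact: h.
Qed.

(** The value at [t] is the limit of the expansions of the approximations of [t]. By [expands_cong]
    this sequence is Cauchy and its limit does not depend on the approximations; [g0_deg] keeps it
    in a bounded range of degrees. *)
Lemma extension : exists g : mop m (ctensor A X) Z,
  [/\ mlinear g, mfil g & forall a x, g (fun j => pure (a j) (x j)) = g0 a x].
Proof.
have limP (t : 'I_m -> ctensor A X) : exists y, forall k,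
    cfil k (y - expands (fun j => pure_approx k (t j))).
  pose N := (`|dg| + \sum_(j < m) \sum_(n <- gsupp (cgr (ctensor A X)) (t j)) `|n|)%N.
  apply: (@cauchy_lim _ _ N) => k.
    apply: expand_mem; [exact: gbounded_sub | exact: enum_uniq|].
    move=> a x h _.
    have {}h j : exists n : int * int, [/\ homog (cgr A) n.1 (a j), homog (cgr X) n.2 (x j)
        & (`|(n.1 + n.2)%R| <= \sum_(n <- gsupp (cgr (ctensor A X)) (t j)) `|n|)%N].
      have /pure_approx_homog [i [l [ha hx il]]] := h j (mem_enum _ _).
      by exists (i, l); split=> //; rewrite (big_rem _ il) /= leq_addr.
    have [d hd] := choice h.
    apply: gbounded_homog (g0_deg (d := fun j => (d j).1) (e := fun j => (d j).2) _ _).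
    - have : (`|(\sum_j ((d j).1 + (d j).2))%R|
        <= \sum_(j < m) \sum_(n <- gsupp (cgr (ctensor A X)) (t j)) `|n|)%N.
        elim/big_ind2: _ => [//|x1 y1 x2 y2 h1 h2|j _]; first by lia.
        by have [] := hd j.
      by rewrite /N; lia.
    - by move=> j; have [] := hd j.
    - by move=> j; have [] := hd j.
  apply: expands_cong => j.
  apply: (@cfil_trans _ _ _ _ (t j)); last exact: pure_approxP.
  by apply: cfil_sym; apply: cfilS; exact: pure_approxP.
have [g gP] := choice limP.
(* Modulo F_k, [g] may be computed from any approximation of its inputs, in particular from one
   adapted to a sum or to pure tensors. *)
have gE k t s : (forall j, cfil k (t j - tsumT (s j))) -> cfil k (g t - expands s).
  move=> h; apply: cfil_trans (gP t k) _; apply: expands_cong => j.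
  by apply: cfil_trans (h j); apply: cfil_sym; exact: pure_approxP.
exists g; split.
- move=> t j c u v; apply/eqP; rewrite -subr_eq0; apply/eqP.
  apply: cfil_sep => k.
  pose s := fun l => pure_approx k (t l).
  have su w r : cfil k (w - tsumT r) -> cfil k (g (upd t j w) - expands (upd s j r)).
    move=> h; apply: gE => l; rewrite /upd; case: eqP => // _; exact: pure_approxP.
  set su' := pure_approx k u; set sv := pure_approx k v.
  have := su (c *: u + v) (tscale c su' ++ sv).
  rewrite expands_cat expands_scale => h1.
  have h2 := su u su' (pure_approxP k u); have h3 := su v sv (pure_approxP k v).
  apply: (@cfil_trans _ _ _ _ (c *: expands (upd s j su') + expands (upd s j sv))).
    apply: h1; rewrite tsumT_cat tsumT_scale opprD addrACA -scalerBr; apply: cfilD.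
      apply: cfilZ; exact: pure_approxP.
    exact: pure_approxP.
  rewrite opprD addrACA -scalerBr; apply: cfilD; last exact: cfil_sym.
  by apply: cfilZ; exact: cfil_sym.
(* Since n is at least each [k j], approximations of order n stay in the prescribed steps of the
   filtration. *)
- move=> k t ht; set n := (\sum_j k j)%N.
  rewrite -(subrK (expands (fun j => pure_approx n (t j))) (g t)); apply: cfilD.
    by apply: gE => j; exact: pure_approxP.
  apply: expands_fil => j; rewrite -[tsumT _](subKr (t j)); apply: cfilB; first exact: ht.
  apply: (@cfil_le _ _ _ n); last exact: pure_approxP.
  by rewrite /n (bigD1 j) //= leq_addr.
- move=> a x; apply/eqP; rewrite -subr_eq0; apply/eqP; apply: cfil_sep => k.
  rewrite -(expands_pure a x); apply: gE => j; rewrite /tsumT big_seq1 subrr.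
  by apply: sp_0; exact: cfil_sub.
Qed.

End Expansion.

(** * Existence, uniqueness and linearity of tensor operations *)

Section TensorOperation.
Variables (K : fieldType) (A : cchain K).

(** Modulo a given F_k, the slots are replaced one at a time by sums of homogeneous pure tensors,
    those from r on being pure already; separatedness then removes F_k. *)
Lemma mop_ctensor_ext (X Z : cchain K) m (g g' : mop m (ctensor A X) Z) :
  mlinear g -> mlinear g' -> mfil g -> mfil g' ->
  (forall (d e : 'I_m -> int) a x,
     (forall j, homog (cgr A) (d j) (a j)) -> (forall j, homog (cgr X) (e j) (x j)) ->
     g (fun j => pure (a j) (x j)) = g' (fun j => pure (a j) (x j))) ->
  g = g'.
Proof.
move=> lg lg' fg fg' gg; apply/funext => t; apply/eqP; rewrite -subr_eq0; apply/eqP.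
apply: cfil_sep => k; pose f := fun t => g t - g' t.
have lf : mlinear f by exact: mlinearB.
have ff : mfil f by exact: mfilB.
rewrite -/(f t); pose hpure (y : ctensor A X) := exists n : (int * int) * (A * X),
  [/\ homog (cgr A) n.1.1 n.2.1, homog (cgr X) n.1.2 n.2.2 & y = pure n.2.1 n.2.2].
suff H r : (r <= m)%N -> forall t : 'I_m -> ctensor A X,
    (forall j : 'I_m, (r <= j)%N -> hpure (t j)) -> cfil k (f t).
  by apply: (H m) => // j; rewrite leqNgt ltn_ord.
elim: r => [_|r IH rm] {}t pt.
  have [n hn] := choice (fun j => pt j (leq0n _)).
  have -> : t = fun j => pure (n j).2.1 (n j).2.2 by apply/funext => j; have [] := hn j.
  rewrite /f (gg (fun j => (n j).1.1) (fun j => (n j).1.2)); last 2 first.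
  - by move=> j; have [] := hn j.
  - by move=> j; have [] := hn j.
  by rewrite subrr; apply: sp_0; exact: cfil_sub.
pose j0 := Ordinal rm.
have lj := mlinear_slot t j0 lf.
rewrite -(upd_same t j0) -(subrK (\sum_(ab <- pure_approx k (t j0)) pure ab.1 ab.2) (t j0)).
rewrite (linearD' _ _ lj); apply: cfilD.
  apply: (@cfil_le _ _ _ (\sum_(j < m) (if j == j0 then k else 0))%N).
    by rewrite -big_mkcond big_pred1_eq.
  apply: ff => j; rewrite /upd; case: eqP => _; [exact: pure_approxP | exact: cfil0].
rewrite (linear_sum' _ _ _ lj) big_seq; apply: sp_sum; first exact: cfil_sub.
move=> ab /pure_approx_homog [i [l [ha hx _]]]; apply: IH; first exact: ltnW.
move=> j rj; case: (eqVneq j j0) => [->|jj0].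
  by exists ((i, l), ab); split=> //; rewrite upd_eq.
rewrite upd_neq //; apply: pt; rewrite ltn_neqAle rj andbT.
by apply: contra jj0 => /eqP rj0; apply/eqP/val_inj.
Qed.

Definition tensor_sign m (b : bool) (d e : 'I_m -> int) : nat :=
  (b * \sum_(j < m) `|d j| + \sum_(j < m) \sum_(i < m | i < j) `|e i| * `|d j|)%N.

Definition is_op_tensor (X Y : cchain K) m (b : bool) (p : mop m A A) (f : mop m X Y)
    (g : mop m (ctensor A X) (ctensor A Y)) : Prop :=
  [/\ mlinear g, mfil g
    & forall (d e : 'I_m -> int) a x,
        (forall j, homog (cgr A) (d j) (a j)) ->
        (forall j, homog (cgr X) (e j) (x j)) ->
        g (fun j => pure (a j) (x j)) = (-1) ^+ tensor_sign b d e *: pure (p a) (f x)].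

(** Uniqueness makes the choice in [op_tensor] irrelevant. This is the only access to the value of
    [op_tensor]. *)
Lemma op_tensorE (X Y : cchain K) m b (p : mop m A A) (f : mop m X Y) g :
  is_op_tensor b p f g -> op_tensor b p f = g.
Proof.
move=> hg; rewrite /op_tensor; case: classical_sets.xgetP => [h _ [lh fh hE]|/(_ g) //].
have [lg fg gE] := hg; apply: mop_ctensor_ext => // d e a x ha hx.
by rewrite (hE d e) // (gE d e).
Qed.

Lemma gpar_slots (V : cchain K) (W : lmodType K) m (f : mop m V W) (d : 'I_m -> int) x
    (b : 'I_m -> bool) : mlinear f -> (forall j, homog (cgr V) (d j) (x j)) ->
  f (fun j => gpar (cgr V) (b j) (x j)) =
  if [forall j, b j == odd `|d j|%N] then f x else 0.
Proof.
move=> lf hx; case: forallP => [h|/forallP].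
  congr f; apply/funext => j; rewrite (gpar_homog _ (hx j)).
  by rewrite (eqP (h j)) eqxx.
rewrite negb_forall => /existsP[j bj]; apply: (mlinear0 (j := j)) => //.
by rewrite (gpar_homog _ (hx j)) eq_sym (negbTE bj).
Qed.

(** Koszul signs are extended to inhomogeneous inputs by summing over all parity patterns; on
    homogeneous inputs only the true pattern survives. *)
Lemma sum_gpar_slots (V : cchain K) (W : lmodType K) m (f : mop m V W) (d : 'I_m -> int) x
    (c : ('I_m -> bool) -> K) : mlinear f -> (forall j, homog (cgr V) (d j) (x j)) ->
  \sum_(b : {ffun 'I_m -> bool}) c b *: f (fun j => gpar (cgr V) (b j) (x j)) =
  c (fun j => odd `|d j|%N) *: f x.
Proof.
move=> lf hx; rewrite (bigD1 [ffun j => odd `|d j|%N]) //= [X in _ + X]big1 ?addr0.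
  rewrite (gpar_slots _ lf hx); case: forallP => [_|[]]; last by move=> j; rewrite ffunE.
  by congr (c _ *: _); apply/funext => j; rewrite ffunE.
move=> b bd; rewrite (gpar_slots _ lf hx); case: forallP => [h|]; last by rewrite scaler0.
by case/eqP: bd; apply/ffunP => j; rewrite ffunE; exact/eqP.
Qed.

Lemma op_tensor_exists (X Y : cchain K) m b (p : mop m A A) (f : mop m X Y) dp df :
  mlinear p -> mfil p -> mdeg dp p -> mlinear f -> mfil f -> mdeg df f ->
  exists g, is_op_tensor b p f g.
Proof.
move=> lp fp hp lf ff hf.
(* The sign of [tensor_sign] written with parities in place of degrees, so that it makes sense on
   the parity projections and [g0] is multilinear on all inputs. *)
pose sg (d e : 'I_m -> bool) : K := (-1) ^+ (b * \sum_(j < m) d j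
   + \sum_(j < m) \sum_(i < m | (i < j)%N) e i * d j)%N.
pose g0 a x : ctensor A Y := \sum_(d : {ffun 'I_m -> bool}) \sum_(e : {ffun 'I_m -> bool})
  sg d e *: pure (p (fun j => gpar (cgr A) (d j) (a j))) (f (fun j => gpar (cgr X) (e j) (x j))).
have [||||g [lg fg gE]] := @extension _ A X (ctensor A Y) m g0 _ _ _ (dp + df).
- move=> x; apply: mlinear_sum => d _; apply: mlinear_sum => e _.
  apply: mlinear_scale.
  apply: (mlinear_slots (f := fun y => pure (p y) _) (i := fun j => gpar (cgr A) (d j))).
    move=> y j c u v; rewrite lp; exact: pure_linearl.
  by move=> j; exact: gpar_linear.
- move=> a; apply: mlinear_sum => d _; apply: mlinear_sum => e _.
  apply: mlinear_scale.
  apply: (mlinear_slots (f := fun y => pure _ (f y)) (i := fun j => gpar (cgr X) (e j))).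
    move=> y j c u v; rewrite lf; exact: pure_linearr.
  by move=> j; exact: gpar_linear.
- move=> k l a x ha hx; apply: sp_sum => [|d _]; first exact: cfil_sub.
  apply: sp_sum => [|e _]; first exact: cfil_sub.
  apply: cfilZ.
  rewrite big_split; apply: pure_fil; [apply: fp | apply: ff] => j; exact: gpar_fil.
- have hgpar (V : cchain K) c n (v : V) :
      homog (cgr V) n v -> homog (cgr V) n (gpar (cgr V) c v).
    by move=> hv; rewrite (gpar_homog _ hv); case: ifP => // _; exact: homog0.
  have hsub n : subspace (homog (cgr (ctensor A Y)) n).
    split; first exact: homog0.
    by move=> c u v hu hv; apply: homogD => //; exact: homogZ.
  move=> d e a x ha hx; apply: sp_sum => [|? _]; first exact: hsub.
  apply: sp_sum => [|? _]; first exact: hsub.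
  apply: homogZ; rewrite big_split addrACA.
  by apply: pure_homog; [apply: hp | apply: hf] => j; exact: hgpar.
exists g; split=> // d e a x ha hx; rewrite gE /g0.
transitivity (\sum_(d' : {ffun 'I_m -> bool}) pure (p (fun j => gpar (cgr A) (d' j) (a j)))
   (\sum_(e' : {ffun 'I_m -> bool}) sg d' e' *: f (fun j => gpar (cgr X) (e' j) (x j)))).
  apply: eq_bigr => d' _; rewrite (linear_sum' _ _ _ (pure_linearr _)).
  by apply: eq_bigr => e' _; rewrite (linearZ' _ _ (pure_linearr _)).
transitivity (pure (\sum_(d' : {ffun 'I_m -> bool}) sg d' (fun j => odd `|e j|%N) *:
   p (fun j => gpar (cgr A) (d' j) (a j))) (f x)).
  rewrite (linear_sum' _ _ _ (pure_linearl _)); apply: eq_bigr => d' _.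
  rewrite (sum_gpar_slots (sg d') lf hx).
  by rewrite (linearZ' _ _ (pure_linearl _)) (linearZ' _ _ (pure_linearr _)).
rewrite (sum_gpar_slots (sg^~ _) lp ha) (linearZ' _ _ (pure_linearl _)); congr (_ *: _).
rewrite /sg /tensor_sign -[LHS]signr_odd -[RHS]signr_odd; congr ((-1) ^+ nat_of_bool _).
have oddS (I : finType) (P : pred I) (F G : I -> nat) : (forall i, odd (F i) = odd (G i)) ->
    odd (\sum_(i | P i) F i) = odd (\sum_(i | P i) G i).
  by move=> h; elim/big_ind2: _ => // ? ? ? ? h1 h2; rewrite !oddD h1 h2.
rewrite !oddD !oddM; congr (_ && _ (+) _); first by apply: oddS => j; rewrite oddb.
apply: (oddS) => j; apply: (oddS) => i; by rewrite !oddM !oddb.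
Qed.

(** The hypothesis is restricted to members of [r] because it will be known only for the trees of a
    given list. *)
Lemma op_tensor_lin_r (X Y : cchain K) m b (p : mop m A A) (I : eqType) (r : seq I)
    (c : I -> K) (f : I -> mop m X Y) (g : I -> mop m (ctensor A X) (ctensor A Y)) :
  {in r, forall i, is_op_tensor b p (f i) (g i)} ->
  is_op_tensor b p (fun x => \sum_(i <- r) c i *: f i x)
    (fun t => \sum_(i <- r) c i *: g i t).
Proof.
move=> h; split.
- rewrite (_ : (fun t => _) = fun t => \sum_(i <- r | i \in r) c i *: g i t).
    by apply: mlinear_sum => i /h[lg _ _]; exact: mlinear_scale.
  by apply/funext => t; rewrite big_seq.
- rewrite (_ : (fun t => _) = fun t => \sum_(i <- r | i \in r) c i *: g i t).
    by apply: mfil_sum => i /h[_ fg _]; exact: mfil_scale.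
  by apply/funext => t; rewrite big_seq.
move=> d e a x ha hx; rewrite (linear_sum' _ _ _ (pure_linearr _)) scaler_sumr.
rewrite [LHS]big_seq [RHS]big_seq; apply: eq_bigr => i /h[_ _ gE].
by rewrite (gE d e) // (linearZ' _ _ (pure_linearr _)) !scalerA mulrC.
Qed.

Lemma op_tensor_lin_l (X Y : cchain K) m b I (r : seq I) (p : I -> mop m A A)
    (c : I -> K) (f : mop m X Y) (g : I -> mop m (ctensor A X) (ctensor A Y)) :
  (forall i, is_op_tensor b (p i) f (g i)) ->
  is_op_tensor b (fun a => \sum_(i <- r) c i *: p i a) f
    (fun t => \sum_(i <- r) c i *: g i t).
Proof.
move=> h; split.
- by apply: mlinear_sum => i _; apply: mlinear_scale; have [] := h i.
- by apply: mfil_sum => i _; apply: mfil_scale; have [] := h i.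
move=> d e a x ha hx; rewrite (linear_sum' _ _ _ (pure_linearl _)) scaler_sumr.
apply: eq_bigr => i _; have [_ _ gE] := h i; rewrite (gE d e) //.
by rewrite (linearZ' _ _ (pure_linearl _)) !scalerA mulrC.
Qed.

Lemma id_tensorP (X Y : cchain K) n (b : bool) (f : X -> Y) : filtered_map n f ->
  [/\ linear (id_tensor A b f), forall k t, cfil k t -> cfil k (id_tensor A b f t)
    & forall d e a x, homog (cgr A) d a -> homog (cgr X) e x ->
        id_tensor A b f (pure a x) = (-1) ^+ (b * `|d|)%N *: pure a (f x)].
Proof.
case=> lf df ff.
have [|||||| g hg] := @op_tensor_exists X Y 1 b (fun a => a ord0) (fun x => f (x ord0)) 0 n.
- by move=> x j a u v; rewrite /upd [j]ord1 eqxx.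
- by move=> k x hx; rewrite big_ord1.
- by move=> d x hx; rewrite big_ord1 add0r.
- by move=> x j a u v; rewrite /upd [j]ord1 eqxx; exact: lf.
- by move=> k x hx; rewrite big_ord1; exact: ff.
- by move=> d x hx; rewrite big_ord1 addrC; exact: df.
have gE := op_tensorE hg; rewrite /id_tensor gE; have [lg fg g1] := hg.
have updE (t u : ctensor A X) : (fun=> u) = upd (fun _ : 'I_1 => t) ord0 u.
  by apply/funext => j; rewrite [j]ord1 upd_eq.
split.
- by move=> c u v; rewrite (updE u (c *: u + v)) lg -!updE.
- by move=> k t ht; have := fg (fun=> k) (fun=> t) (fun=> ht); rewrite big_ord1.
- move=> d e a x ha hx; rewrite (g1 (fun=> d) (fun=> e) (fun=> a) (fun=> x)) //.
  congr ((-1) ^+ _ *: _); rewrite /tensor_sign !big_ord1.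
  (* In arity one no input passes another, so the second sum of [tensor_sign] is empty. *)
  by rewrite [X in (_ + X)%N]big_pred0 ?addn0 // => i; rewrite [i]ord1.
Qed.

Lemma id_tensor_pure (X Y : cchain K) n (f : X -> Y) a x : filtered_map n f ->
  id_tensor A false f (pure a x) = pure a (f x).
Proof.
move=> ff; have [lf _ _] := ff; have [lid _ idE] := id_tensorP false ff.
rewrite (gsuppE a) (linear_sum' _ _ _ (pure_linearl _)) (linear_sum' _ _ _ lid).
rewrite (linear_sum' _ _ _ (pure_linearl _)); apply: eq_bigr => i _.
rewrite (gsuppE x) (linear_sum' _ _ _ (pure_linearr _)) (linear_sum' _ _ _ lid).
rewrite (linear_sum' _ _ _ lf) (linear_sum' _ _ _ (pure_linearr _)); apply: eq_bigr => j _.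
by rewrite (idE i j) ?mul0n ?expr0 ?scale1r //; exact: homog_gcomp.
Qed.

Lemma op_tensor_comp (X Y : cchain K) m b (p : mop m A A) (f : mop m X X) g
    (u : Y -> X) (v : X -> Y) : filtered_map 0 u -> filtered_map 0 v ->
  is_op_tensor b p f g ->
  is_op_tensor b p (fun y => v (f (u \o y)))
    (fun t => id_tensor A false v (g (id_tensor A false u \o t))).
Proof.
move=> fu fv [lg fg gE].
have [lu fiu _] := id_tensorP false fu; have [lv fiv _] := id_tensorP false fv.
split; first exact: mlinear_comp.
  by move=> k t ht; apply: fiv; apply: fg => j; exact: fiu.
move=> d e a y ha hy.
have -> : id_tensor A false u \o (fun j => pure (a j) (y j)) = fun j => pure (a j) (u (y j)).
  by apply/funext => j /=; rewrite (id_tensor_pure _ _ fu).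
have [_ du _] := fu.
rewrite (gE d e) //; last by move=> j; rewrite -[e j]addr0; exact: du.
by rewrite (linearZ' _ _ lv) (id_tensor_pure _ _ fv).
Qed.

End TensorOperation.
(** * Trees and their decorations *)

Section Forests.
Variables (M : nat -> Type) (m : nat).

(** The generated principle gives no hypothesis on the subtrees inside a list, hence a joint
    induction on trees and forests. *)
Lemma tree_forest_ind (P : tree M m -> Prop) (Q : seq (tree M m) -> Prop) :
  (forall i, P (Leaf M i)) -> (forall k (v : M k) ts, Q ts -> P (Node v ts)) ->
  Q [::] -> (forall t ts, P t -> Q ts -> Q (t :: ts)) ->
  (forall t, P t) /\ (forall ts, Q ts).
Proof.
move=> PL PN Q0 QS; pose fix F t : P t := match t with
  | Leaf i => PL i
  | Node k v ts => PN k v ts ((fix G us : Q us :=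
      if us is u :: us' then QS u us' (F u) (G us') else Q0) ts) end.
by split=> //; elim=> // t ts; exact: (QS t ts (F t)).
Qed.

(** The datatype does not tie the arity of a vertex to its number of children. Positive arity
    matters since Com(0) = 0: only for k > 0 is mu_k a nonzero element and the unique label. *)
Fixpoint wft (t : tree M m) : bool :=
  if t is Node k _ ts then [&& size ts == k, (0 < k)%N & all wft ts] else true.

Definition forest_leaves (ts : seq (tree M m)) := flatten [seq leaves t | t <- ts].
Definition forest_nodes (ts : seq (tree M m)) := flatten [seq nodes t | t <- ts].

Definition is_node (t : tree M m) : bool := if t is Node _ _ _ then true else false.

End Forests.

HB.instance Definition _ (M : nat -> Type) m := gen_eqMixin (tree M m).

Section Decorations.
Variables (m : nat).

Lemma tmap_comp (M N L : nat -> Type) (f : forall k, M k -> N k) (g : forall k, N k -> L k)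
    (t : tree M m) :
  tmap g (tmap f t) = tmap (fun k v => g k (f k v)) t.
Proof.
move: t; suff [] : (forall t : tree M m,
    tmap g (tmap f t) = tmap (fun k v => g k (f k v)) t) /\
  (forall ts : seq (tree M m),
    [seq tmap g t | t <- [seq tmap f t | t <- ts]] = [seq tmap (fun k v => g k (f k v)) t | t <- ts]) by [].
by apply: tree_forest_ind => //= [k v ts ->|t ts -> ->].
Qed.

Lemma leaves_tmap (M N : nat -> Type) (f : forall k, M k -> N k) (t : tree M m) :
  leaves (tmap f t) = leaves t.
Proof.
move: t; suff [] : (forall t : tree M m, leaves (tmap f t) = leaves t) /\
  (forall ts : seq (tree M m),
    [seq leaves t | t <- [seq tmap f t | t <- ts]] = [seq leaves t | t <- ts]) by [].
by apply: tree_forest_ind => //= [k v ts ->|t ts -> ->].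
Qed.

Lemma count_nodes_tmap (M N : nat -> Type) (f : forall k, M k -> N k)
    (a : {k & N k} -> bool) (t : tree M m) :
  count a (nodes (tmap f t)) = count (fun v => a (existT N (tag v) (f _ (tagged v)))) (nodes t).
Proof.
move: t; suff [] : (forall t : tree M m, count a (nodes (tmap f t))
    = count (fun v => a (existT N (tag v) (f _ (tagged v)))) (nodes t)) /\
  (forall ts : seq (tree M m), count a (forest_nodes [seq tmap f t | t <- ts])
    = count (fun v => a (existT N (tag v) (f _ (tagged v)))) (forest_nodes ts)) by [].
apply: tree_forest_ind => //= [k v ts IH|t ts h IH].
  by rewrite -/(forest_nodes _) IH.
by rewrite /forest_nodes /= !count_cat h; congr (_ + _)%N; exact: IH.
Qed.

Lemma mem_cart (T : eqType) (ss : seq (seq T)) (c : seq T) :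
  c \in cart ss -> size c = size ss /\ forall x0 j, (j < size ss)%N -> nth x0 c j \in nth [::] ss j.
Proof.
elim: ss c => [|s ss IH] c /=; first by rewrite inE => /eqP ->.
move=> /allpairsP [[x r] /= [xs /IH [sr hr] ->]] /=; split; first by rewrite sr.
by move=> x0 [|j] //= js; exact: hr.
Qed.

Lemma cart_map (T S : Type) (g : T -> S) (ss : seq (seq T)) :
  cart [seq [seq g x | x <- s] | s <- ss] = [seq [seq g x | x <- c] | c <- cart ss].
Proof.
elim: ss => //= s ss ->; rewrite allpairs_mapl allpairs_mapr map_allpairs.
by [].
Qed.

Lemma decorate_shape (M : nat -> eqType) (lab : forall k, seq (M k)) (s : shape m) t :
  t \in decorate lab s -> [/\ leaves t = leaves s, wft t = wft s & is_node t = is_node s].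
Proof.
move: s t; suff [] : (forall (s : shape m) t, t \in decorate lab s ->
     [/\ leaves t = leaves s, wft t = wft s & is_node t = is_node s]) /\
  (forall (ss : seq (shape m)) ts, ts \in cart [seq decorate lab s | s <- ss] ->
     [/\ size ts = size ss, forest_leaves ts = forest_leaves ss
       & all (@wft M m) ts = all (@wft _ m) ss]) by [].
apply: tree_forest_ind => [i t|k [] ss IH t|ts|s ss h IH ts] /=.
- by rewrite inE => /eqP ->.
- by move=> /allpairsPdep [v [ts [_ /IH [h1 h2 h3] ->]]] /=; rewrite h1 h3.
- by rewrite inE => /eqP ->.
- move=> /allpairsP [[t us] /= [/h [h1 h2 _] /IH [h3 h4 h5] ->]] /=.
  by rewrite h3 h2 h5; split=> //; rewrite /forest_leaves /= h1; congr (_ ++ _); exact: h4.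
Qed.

Lemma trees_onP n (S : {set 'I_m}) s : s \in trees_on n S ->
  wft s /\ perm_eq (leaves s) (enum S).
Proof.
elim: n S s => //= n IH S s; rewrite mem_cat => /orP[].
  move=> /mapP[i]; rewrite mem_filter => /andP[/cards1P [j ->]].
  by rewrite enum_set1 inE => /eqP -> ->.
move=> /flattenP [us /mapP[Q + ->]]; rewrite mem_enum inE => /andP[pQ Q1].
move=> /mapP [ts /mem_cart [sts hts] ->] /=.
rewrite size_map -cardE in sts.
have [cov triv _] := and3P pQ.
pose B0 : {set 'I_m} := set0.
have hB j : (j < #|Q|)%N -> nth s ts j \in trees_on n (nth B0 (enum Q) j).
  by move=> jQ; have := hts s j; rewrite size_map -cardE (nth_map B0) -?cardE //; apply.
split; first rewrite sts eqxx (ltnW Q1) /=.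
  by apply/(all_nthP s) => j; rewrite sts => /hB /IH [].
apply/allP => i _ /=; rewrite count_flatten -map_comp sumnE big_map.
have -> : (\sum_(t <- ts) count_mem i (leaves t) = \sum_(B in Q) (i \in B))%N.
  rewrite -[RHS]big_enum /= (big_nth s) [RHS](big_nth B0) sts -cardE.
  rewrite [LHS]big_nat [RHS]big_nat; apply: eq_bigr => j /andP[_ /hB /IH [_ pj]].
  by rewrite (seq.permP pj) count_uniq_mem ?enum_uniq // mem_enum.
rewrite count_uniq_mem ?enum_uniq // mem_enum -(eqP cov).
(* Membership is written as a sum over the block so that [big_trivIset] can merge the disjoint
   blocks. *)
have iE (B : {set 'I_m}) : nat_of_bool (i \in B) = (\sum_(x in B) (x == i))%N.
  have [iB|iB] := boolP (i \in B).
    rewrite (big_rem i) ?mem_index_enum //=.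
    rewrite iB eqxx big1_seq ?addn0 // => x /andP[_].
    rewrite mem_rem_uniq ?index_enum_uniq // inE => /andP[/negbTE -> _] //.
  by rewrite big1 // => x xB; case: eqP => // xi; rewrite -xi xB in iB.
rewrite iE (big_trivIset _ triv) /=.
by apply/eqP; apply: eq_bigr => B _; exact: iE.
Qed.

Lemma treesP s : s \in trees m -> wft s /\ perm_eq (leaves s) (enum 'I_m).
Proof.
move=> /trees_onP[h1 h2]; split=> //.
rewrite (perm_trans h2) //; apply: uniq_perm; rewrite ?enum_uniq // => i.
by rewrite !mem_enum inE.
Qed.

End Decorations.
(** * Evaluation of trees of operations *)

Section Evaluation.
Variables (K : fieldType) (V : cchain K) (h : V -> V) (m : nat).
Implicit Types (t : tree (fun k => bool * mop k V V)%type m) (x : 'I_m -> V).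

(** What a subtree passes to its parent: the edge above it carries [h] unless it is a leaf. *)
Definition inner_val t x : V := if is_node t then h (teval h t x) else teval h t x.

(** The local fixpoint of [teval], made accessible to induction on forests. *)
Fixpoint tvals (ts : seq (tree (fun k => bool * mop k V V)%type m)) x : seq V :=
  if ts is t :: ts' then
    inner_val t (gsgn (cgr V) (tparity ts') \o x) :: tvals ts' x
  else [::].

Lemma tevalN k (bf : bool * mop k V V) ts x :
  teval h (Node bf ts) x = bf.2 (fun j : 'I_k => nth 0 (tvals ts x) j).
Proof.
rewrite /=; congr (bf.2 _); apply/funext => j; congr nth.
by elim: ts => //= t ts ->; congr (_ :: _); case: t.
Qed.

End Evaluation.

Section NthInputs.
Variables (K : fieldType).

Lemma set_nthE (T : Type) k (x0 : T) (vs : seq T) (l : 'I_k) u :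
  (fun j : 'I_k => nth x0 (set_nth x0 vs l u) j) = upd (fun j : 'I_k => nth x0 vs j) l u.
Proof. by apply/funext => j; rewrite nth_set_nth /upd -(inj_eq val_inj). Qed.

Lemma mlinear_prod k (V W : lmodType K) (f : mop k V W) (c : 'I_k -> K) y :
  mlinear f -> f (fun j => c j *: y j) = (\prod_j c j) *: f y.
Proof.
move=> lf; pose mix r := fun j : 'I_k => if (j < r)%N then c j *: y j else y j.
suff H r : (r <= k)%N -> f (mix r) = (\prod_(j < k | (j < r)%N) c j) *: f y.
  have -> : (fun j => c j *: y j) = mix k by apply/funext => j; rewrite /mix ltn_ord.
  by rewrite H //; congr (_ *: _); apply: eq_bigl => j; rewrite ltn_ord.
elim: r => [_|r IH rk]; first by rewrite big_pred0 // scale1r.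
pose j0 := Ordinal rk.
have -> : mix r.+1 = upd (mix r) j0 (c j0 *: mix r j0).
  apply/funext => j; rewrite /mix /upd ltnS leq_eqVlt -[r in _ == r]/(val j0) val_eqE.
  by case: (eqVneq j j0) => [->|] //=; rewrite ltnn.
rewrite (linearZ' _ _ (mlinear_slot _ _ lf)) upd_same IH 1?ltnW // scalerA.
rewrite [in RHS](bigD1 j0) //=; congr (_ * _ *: _); apply: eq_bigl => j.
by rewrite -(inj_eq val_inj) /= ltnS andbC -ltn_neqAle.
Qed.

Lemma mlinear_cart k (V W : lmodType K) (f : mop k V W) (ls : seq (seq V)) :
  mlinear f -> size ls = k ->
  f (fun j => nth 0 [seq \sum_(y <- l) y | l <- ls] j) =
  \sum_(c <- cart ls) f (fun j => nth 0 c j).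
Proof.
move=> lf; suff H pre : (size pre + size ls)%N = k ->
    (* [pre] holds the slots in which a summand has already been selected. *)
    f (fun j => nth 0 (pre ++ [seq \sum_(y <- l) y | l <- ls]) j) =
    \sum_(c <- cart ls) f (fun j => nth 0 (pre ++ c) j) by move/(H [::]).
elim: ls pre => [|l ls IH] pre /=; first by rewrite big_seq1.
rewrite addnS => sk.
have pk : (size pre < k)%N by rewrite -sk ltnS leq_addr.
pose j0 := Ordinal pk.
have updE y r : (fun j : 'I_k => nth 0 (pre ++ y :: r) j)
    = upd (fun j : 'I_k => nth 0 (pre ++ 0 :: r) j) j0 y.
  apply/funext => j; rewrite /upd -(inj_eq val_inj) /= !nth_cat.
  by case: ltngtP => //= [jp|->]; rewrite ?subnn // -(subnSK jp).
rewrite updE (linear_sum' _ _ _ (mlinear_slot _ _ lf)) big_allpairs_dep /=.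
apply: eq_bigr => y _; rewrite -updE -cat_rcons IH ?size_rcons ?addSn //.
by apply: eq_bigr => c _; rewrite cat_rcons.
Qed.

Lemma sum_nth_ord (R : nmodType) (s : seq R) k : size s = k ->
  \sum_(j < k) s`_j = \sum_(x <- s) x.
Proof. by move=> <-; rewrite [RHS](big_nth 0) big_mkord. Qed.

End NthInputs.

Section Shuffle.
Variables (K : fieldType) (V : cchain K) (m : nat).

Lemma kshuffle_homog (W : lmodType K) (w : seq 'I_m) (f : mop m V W) (d : 'I_m -> int) x :
  mlinear f -> (forall j, homog (cgr V) (d j) (x j)) ->
  kshuffle w f x = koszul K w (fun j => odd `|d j|%N) *: f x.
Proof. by move=> lf hx; exact: (sum_gpar_slots (koszul K w) lf hx). Qed.

Lemma kshuffle_mlinear (W : lmodType K) (w : seq 'I_m) (f : mop m V W) :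
  mlinear f -> mlinear (kshuffle w f).
Proof.
move=> lf; apply: mlinear_sum => b _; apply: mlinear_scale.
by apply: (mlinear_slots (i := fun j => gpar (cgr V) (b j)) lf) => j; exact: gpar_linear.
Qed.

Lemma kshuffle_mfil (W : cchain K) (w : seq 'I_m) (f : mop m V W) :
  mfil f -> mfil (kshuffle w f).
Proof.
move=> ff; apply: mfil_sum => b _; apply: mfil_scale => k x hx; apply: ff => j.
exact: gpar_fil.
Qed.

Lemma kshuffle_mdeg (W : cchain K) n (w : seq 'I_m) (f : mop m V W) :
  mlinear f -> mdeg n f -> mdeg n (kshuffle w f).
Proof.
by move=> lf df d x hx; rewrite (kshuffle_homog _ lf hx); apply: homogZ; exact: df.
Qed.

End Shuffle.

Section Operations.
Variables (K : fieldType) (V : cchain K) (h : V -> V) (m : nat).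
Variables (M : nat -> Type) (op : forall k, M k -> bool * mop k V V).
Implicit Types (t : tree M m) (ts : seq (tree M m)) (x : 'I_m -> V).

Let ev t x := teval h (tmap op t) x.
Let iv t x := inner_val h (tmap op t) x.
Let evs ts x := tvals h [seq tmap op t | t <- ts] x.

Lemma inner_valE t x : iv t x = if is_node t then h (ev t x) else ev t x.
Proof. by rewrite /iv /inner_val; case: t. Qed.

Lemma teval_node k (v : M k) ts x :
  ev (Node v ts) x = (op v).2 (fun j : 'I_k => nth 0 (evs ts x) j).
Proof. exact: tevalN. Qed.

Lemma teval_congr_forest : (forall t x y, {in leaves t, x =1 y} -> ev t x = ev t y) /\
  (forall ts x y, {in forest_leaves ts, x =1 y} -> evs ts x = evs ts y).
Proof.
apply: tree_forest_ind => [i|k v ts IH|//|t ts IHt IH] x y xy.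
- by apply: xy; rewrite mem_head.
- by rewrite !teval_node (IH x y).
rewrite /evs /= -/(evs ts x) -/(evs ts y) (IH x y) => [|i it]; last first.
  by apply: xy; rewrite mem_cat it orbT.
rewrite -!/(iv _ _) !inner_valE (IHt _ (gsgn (cgr V) (tparity [seq tmap op t | t <- ts]) \o y)) //.
by move=> i it /=; rewrite xy // mem_cat it.
Qed.

Hypothesis op_linear : forall k (v : M k), mlinear (op v).2.
Hypothesis h_linear : linear h.

Lemma inner_val_linear t x j : linear (fun u => ev t (upd x j u)) ->
  linear (fun u => iv t (upd x j u)).
Proof. by move=> le a u v; rewrite !inner_valE; case: is_node; rewrite le // h_linear. Qed.

(** Leaf labels are distinct, so an input reaches only one child of each vertex. For forests this
    says that exactly one entry of [tvals] varies, whence the form with [set_nth]. *)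
Lemma teval_slot t x j : wft t -> uniq (leaves t) -> j \in leaves t ->
  linear (fun u => ev t (upd x j u)).
Proof.
move: t x j; suff [] : (forall t x j, wft t -> uniq (leaves t) -> j \in leaves t ->
    linear (fun u => ev t (upd x j u))) /\
  (forall ts x j, all (@wft M m) ts -> uniq (forest_leaves ts) -> j \in forest_leaves ts ->
    exists l vs g, [/\ (l < size ts)%N, linear g
      & forall u, evs ts (upd x j u) = set_nth 0 vs l (g u)]) by [].
have [econgr fcongr] := teval_congr_forest.
apply: tree_forest_ind => [i|k v ts IH|//|t ts IHt IH] x j.
- by rewrite inE => _ _ /eqP -> c u v; rewrite /ev /= !upd_eq.
- move=> /and3P[/eqP st _ wts] uts jts; have [l [vs [g [ls lg E]]]] := IH x j wts uts jts.
  rewrite st in ls => c a b; rewrite !teval_node !E.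
  have -> : l = Ordinal ls by [].
  by rewrite !set_nthE lg op_linear.
move=> /andP[wt wts]; rewrite /forest_leaves /= cat_uniq => /and3P[ut /hasPn dis uts].
set b := tparity [seq tmap op t | t <- ts].
have evsE y : evs (t :: ts) y = iv t (gsgn (cgr V) b \o y) :: evs ts y by [].
rewrite mem_cat; case: (boolP (j \in leaves t)) => [jt _|jt /= jts].
  exists 0%N, (0 :: evs ts x), (fun u => iv t (upd (gsgn (cgr V) b \o x) j (gsgn (cgr V) b u))).
  split=> // [c u v|u]; first by rewrite gsgn_linear inner_val_linear //; exact: IHt.
  rewrite evsE comp_upd /=; congr (_ :: _); apply: fcongr => i its.
  by rewrite upd_neq //; apply: contraTneq jt => <-; exact: dis.
have [l [vs [g [ls lg E]]]] := IH x j wts uts jts.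
exists l.+1, (iv t (gsgn (cgr V) b \o x) :: vs), g; split=> // u.
rewrite evsE E /=; congr (_ :: _); rewrite !inner_valE.
suff -> : ev t (gsgn (cgr V) b \o upd x j u) = ev t (gsgn (cgr V) b \o x) by [].
by apply: econgr => i it /=; rewrite upd_neq //; apply: contraNneq jt => <-.
Qed.

Lemma teval_mlinear t : wft t -> perm_eq (leaves t) (enum 'I_m) -> mlinear (ev t).
Proof.
move=> wt pt x j; apply: teval_slot => //; first by rewrite (perm_uniq pt) enum_uniq.
by rewrite (perm_mem pt) mem_enum.
Qed.

Lemma teval_scale t x (c : 'I_m -> K) : wft t ->
  ev t (fun i => c i *: x i) = (\prod_(i <- leaves t) c i) *: ev t x.
Proof.
move: t x; suff [] : (forall t x, wft t ->
    ev t (fun i => c i *: x i) = (\prod_(i <- leaves t) c i) *: ev t x) /\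
  (forall ts x, all (@wft M m) ts -> forall l, (l < size ts)%N ->
    nth 0 (evs ts (fun i => c i *: x i)) l =
    nth 1 [seq \prod_(i <- leaves t) c i | t <- ts] l *: nth 0 (evs ts x) l) by [].
apply: tree_forest_ind => [i|k v ts IH|//|t ts IHt IH] x.
- by rewrite big_seq1.
- move=> /and3P[/eqP st _ wts]; rewrite !teval_node.
  transitivity ((op v).2 (fun j : 'I_k =>
      nth 1 [seq \prod_(i <- leaves t) c i | t <- ts] j *: nth 0 (evs ts x) j)).
    by congr (op v).2; apply/funext => j; apply: IH; rewrite // st.
  rewrite mlinear_prod // big_flatten big_map /=; congr (_ *: _).
  rewrite -(big_map (fun t : tree M m => \prod_(i <- leaves t) c i) predT id).
  by rewrite [RHS](big_nth 1) size_map st big_mkord.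
move=> /andP[wt wts] [_|l ls] /=; last exact: IH.
rewrite -!/(iv _ _) !inner_valE.
set b := tparity _; have -> : gsgn (cgr V) b \o (fun i => c i *: x i)
    = (fun i => c i *: (gsgn (cgr V) b \o x) i).
  by apply/funext => i /=; rewrite (linearZ' _ _ (@gsgn_linear _ V _)).
by rewrite IHt //; case: is_node => //; rewrite (linearZ' _ _ h_linear).
Qed.

Hypothesis op_fil : forall k (v : M k), mfil (op v).2.
Hypothesis h_fil : forall k (x : V), cfil k x -> cfil k (h x).

Lemma teval_fil t x (k : 'I_m -> nat) : wft t -> (forall i, cfil (k i) (x i)) ->
  cfil (\sum_(i <- leaves t) k i)%N (ev t x).
Proof.
move: t x; suff [] : (forall t x, wft t -> (forall i, cfil (k i) (x i)) ->
    cfil (\sum_(i <- leaves t) k i)%N (ev t x)) /\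
  (forall ts x, all (@wft M m) ts -> (forall i, cfil (k i) (x i)) ->
    forall l, cfil (nth 0 [seq (\sum_(i <- leaves t) k i) | t <- ts] l)%N
      (nth 0 (evs ts x) l)) by [].
apply: tree_forest_ind => [i x _ hx|n v ts IH x|x _ _ l|t ts IHt IH x].
- by rewrite big_seq1; exact: hx.
- move=> /and3P[/eqP st _ wts] hx; rewrite teval_node.
  rewrite big_flatten big_map -(big_map (fun t : tree M m => (\sum_(i <- leaves t) k i)%N) predT id).
  rewrite -(sum_nth_ord (k := n)) ?size_map //; apply: op_fil => j; exact: IH.
- by rewrite !nth_nil; exact: cfil0.
move=> /andP[wt wts] hx [|l] /=; last exact: IH.
rewrite -!/(iv _ _) !inner_valE; set b := tparity _.
have hs i : cfil (k i) ((gsgn (cgr V) b \o x) i) by apply: gsgn_fil.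
by case: is_node; [apply: h_fil |]; exact: IHt.
Qed.

Lemma teval_mfil t : wft t -> perm_eq (leaves t) (enum 'I_m) -> mfil (ev t).
Proof.
move=> wt pt k x hx; rewrite -big_enum -(perm_big _ pt); exact: teval_fil.
Qed.

Variables (wt : forall k, M k -> int) (z : int).
Hypothesis op_deg : forall k (v : M k), mdeg (wt v - z) (op v).2.
Hypothesis h_deg : forall d (x : V), homog (cgr V) d x -> homog (cgr V) (d + z) (h x).

(** The weight of a vertex is the degree of [h] composed with its operation, [z] being the degree of
    [h]. Weights thus add up over subtrees, and only a root without its [h] needs the correction -
    z. *)
Definition node_weight t : int := \sum_(v <- nodes t) wt (tagged v).

Lemma teval_deg t x (d : 'I_m -> int) : wft t -> (forall i, homog (cgr V) (d i) (x i)) ->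
  homog (cgr V) (node_weight t + \sum_(i <- leaves t) d i - (if is_node t then z else 0)) (ev t x) /\
  homog (cgr V) (node_weight t + \sum_(i <- leaves t) d i) (iv t x).
Proof.
move: t x; suff [] : (forall t x, wft t -> (forall i, homog (cgr V) (d i) (x i)) ->
    homog (cgr V) (node_weight t + \sum_(i <- leaves t) d i - (if is_node t then z else 0)) (ev t x) /\
    homog (cgr V) (node_weight t + \sum_(i <- leaves t) d i) (iv t x)) /\
  (forall ts x, all (@wft M m) ts -> (forall i, homog (cgr V) (d i) (x i)) ->
    forall l, homog (cgr V) [seq node_weight t + \sum_(i <- leaves t) d i | t <- ts]`_l
      (nth 0 (evs ts x) l)) by [].
apply: tree_forest_ind => [i x _ hx|n v ts IH x|x _ _ l|t ts IHt IH x].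
- by rewrite /node_weight /= big_nil big_seq1 add0r subr0.
- move=> /and3P[/eqP st _ wts] hx.
  set e := node_weight _ + \sum_(i <- _) d i; suff H : homog (cgr V) (e - z) (ev (Node v ts) x).
    by split=> //; rewrite inner_valE /= -(subrK z e); exact: h_deg.
  rewrite teval_node.
  suff -> : e - z = wt v - z
      + \sum_(j < n) [seq node_weight t + \sum_(i <- leaves t) d i | t <- ts]`_j.
    by apply: op_deg => j; exact: IH.
  rewrite sum_nth_ord ?size_map // big_map big_split /=.
  rewrite /e /node_weight /= big_cons /= !big_flatten !big_map /=.
  by rewrite [RHS]addrAC !addrA.
- by rewrite !nth_nil; exact: homog0.
move=> /andP[wt' wts] hx [|l] /=; last exact: IH.
rewrite -!/(iv _ _); set b := tparity _.
have hs i : homog (cgr V) (d i) ((gsgn (cgr V) b \o x) i).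
  by rewrite /= (gsgn_homog _ (hx i)); exact: homogZ.
by case: (IHt _ wt' hs).
Qed.

End Operations.
(** * Composites of decorated trees in an operad *)

Section SignMaps.
Variables (K : fieldType) (V : cchain K).

Lemma gsgn_comp b c (x : V) : gsgn (cgr V) b (gsgn (cgr V) c x) = gsgn (cgr V) (b (+) c) x.
Proof.
rewrite (gsuppE x) !(linear_sum' _ _ _ (@gsgn_linear _ V _)); apply: eq_bigr => n _.
have hn := homog_gcomp (cgr V) n x.
rewrite !(gsgn_homog _ hn) (linearZ' _ _ (@gsgn_linear _ V _)) (gsgn_homog _ hn) scalerA.
by congr (_ *: _); rewrite -signr_addb; congr ((-1) ^+ nat_of_bool _); case: odd; case: b; case: c.
Qed.

Lemma tparity_cons m (t : tree (fun k => bool * mop k V V)%type m) ts :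
  tparity (t :: ts) = tparity [:: t] (+) tparity ts.
Proof. by rewrite /tparity /= cats0 count_cat oddD. Qed.

Lemma tparity_node m k (v : bool * mop k V V) (ts : seq (tree (fun k => bool * mop k V V)%type m)) :
  tparity [:: Node v ts] = v.1 (+) tparity ts.
Proof. by rewrite /tparity /= cats0 oddD oddb. Qed.

End SignMaps.

(** Not an axiom of [operad]. As P(1) is a line, the identity is homogeneous of some degree d; since
    id o id = id it also has degree d + d, so d = 0. *)
Lemma opid_homog (K : fieldType) (P : operad K) : homog (opgr P 1) 0 (opid P).
Proof.
have idE n : exists a, gcomp (opgr P 1) n (opid P) = a *: opid P by exact: op_arity1.
have id0 : opid P <> 0 by apply/eqP; exact: opid_neq0.
have [d hd] : exists d, homog (opgr P 1) d (opid P).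
  apply: contrapT => nh; case: id0.
  have [s [us ->]] := gcomp_fin (opgr P 1) (opid P); rewrite big1 // => n _.
  have [a an] := idE n; have [a0|a0] := eqVneq a 0; first by rewrite an a0 scale0r.
  case: nh; exists n; have := gcomp_proj (opgr P 1) n n (opid P); rewrite eqxx.
  rewrite an (linearZ' _ _ (gcomp_linear _ _)) an => /(congr1 ( *:%R a^-1)).
  by rewrite /homog an !scalerA mulVf // mul1r scale1r.
have hdd : homog (opgr P 1) (d + d) (opid P).
  by have := @opcomp_deg _ P 1 1 0 d d (opid P) (opid P) isT hd hd; rewrite (opcomp1l (opid P)).
have [d0|d0] := eqVneq d 0; first by rewrite -d0.
have := gcomp_proj (opgr P 1) (d + d) d (opid P).
rewrite hd hdd; case: eqP => [/eqP|_ //].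
by rewrite -subr_eq0 addrK (negbTE d0).
Qed.

Section Grafting.
Variables (K : fieldType) (P : operad K) (M : nat -> Type) (m : nat).
Variables (dec : forall k, M k -> P k) (wt : forall k, M k -> int).
Hypothesis dec_homog : forall k (v : M k), homog (opgr P k) (wt v) (dec v).
Implicit Types (t : tree M m) (ts : seq (tree M m)) (st : {n & P n}).

Definition homog_tagged n st := homog (opgr P _) n (tagged st).

Let gr t q st := graft (tmap dec t) (q, st).
Let grs ts q st := foldl (fun r u => graft u r) (q, st) [seq tmap dec t | t <- ts].

(** Slot bookkeeping: grafting fills the slot [q] and moves on by the number of leaves, while the
    arity grows by that number minus one. *)
Lemma graft_shape t q st e : wft t -> (q < tag st)%N -> homog_tagged e st ->
  [/\ (gr t q st).1 = (q + size (leaves t))%N,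
      tag (gr t q st).2 = (tag st + size (leaves t)).-1
    & homog_tagged (e + node_weight wt t) (gr t q st).2].
Proof.
move: t q st e; suff [] : (forall t q st e, wft t -> (q < tag st)%N ->
     homog_tagged e st ->
   [/\ (gr t q st).1 = (q + size (leaves t))%N,
      tag (gr t q st).2 = (tag st + size (leaves t)).-1
    & homog_tagged (e + node_weight wt t) (gr t q st).2]) /\
  (forall ts q st e, all (@wft M m) ts -> (q + size ts <= tag st)%N ->
     homog_tagged e st ->
   [/\ (grs ts q st).1 = (q + size (forest_leaves ts))%N,
      tag (grs ts q st).2 = (tag st + size (forest_leaves ts) - size ts)%N
    & homog_tagged (e + \sum_(t <- ts) node_weight wt t) (grs ts q st).2]) by [].
apply: tree_forest_ind => [i|k v ts IH||t ts IHt IH] q st e.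
- by move=> _ qs he; rewrite /= addn1 addn1 /node_weight big_nil addr0.
- move=> /and3P[/eqP sts k0 wts] qs he.
  have [|h1 h2 h3] := IH q (Tagged (fun n => P n) (opcomp q (tagged st) (dec v)))
     (e + wt v) wts _ (opcomp_deg qs he (dec_homog v)).
    by rewrite sts /=; lia.
  split=> //; first by rewrite h2 sts /= -/(forest_leaves ts); lia.
  by rewrite /node_weight /= big_cons big_flatten big_map /= addrA.
- by move=> _ _ he; rewrite /= !addn0 subn0 big_nil addr0.
move=> /= /andP[wt' wts] qs he.
have [|h1 h2 h3] := IHt q st e wt' _ he; first by lia.
have [|h4 h5 h6] := IH (gr t q st).1 (gr t q st).2 _ wts _ h3; first by rewrite h1 h2; lia.
have grsE : grs ts (gr t q st).1 (gr t q st).2 = grs (t :: ts) q st.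
  by rewrite /grs /= -surjective_pairing.
rewrite grsE in h4 h5 h6; rewrite -/(forest_leaves _).
have -> : forest_leaves (t :: ts) = leaves t ++ forest_leaves ts by [].
rewrite size_cat big_cons addrA; split; [rewrite h4 h1 | rewrite h5 h2 | by []]; lia.
Qed.

Variable A : palgebra P.

(** Inputs are indexed by all natural numbers, so the changing arity of the partial composite
    requires no transport. *)
Definition act_tagged st (x : nat -> A) : A := paact (tagged st) (fun j : 'I_(tag st) => x j).

Let op k (v : M k) : bool * mop k A A := (odd `|wt v|%N, paact (dec v)).
Arguments op : clear implicits.
Let T t := tmap op t.

Lemma act_opcomp q st k (v : M k) (x : nat -> A) : (q < tag st)%N ->
  act_tagged (Tagged (fun n => P n) (opcomp q (tagged st) (dec v))) x =
  act_tagged st (fun l => if (l < q)%N then gsgn (cgr A) (odd `|wt v|%N) (x l)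
    else if l == q then paact (dec v) (fun j : 'I_k => x (q + j)%N) else x (l + k).-1).
Proof.
move=> qs; rewrite /act_tagged /= (@paact_comp _ _ A _ _ _ (wt v)) // /ecomp.
have atE n l : (l < n)%N -> oapp (fun j : 'I_n => x j) 0 (insub l) = x l.
  by move=> ln; rewrite insubT.
congr (paact _); apply/funext => l; have ls := ltn_ord l.
case: ltngtP => lq.
- by rewrite atE //; lia.
- by rewrite atE //; lia.
- congr (paact _); apply/funext => j; have jk := ltn_ord j; rewrite atE //; lia.
Qed.

(** Grafting at slot [q] means feeding that slot with the value of the tree, while the tree passes
    all inputs to the left of [q]. Here [x] is indexed by slots and [y] by leaf labels. *)
Lemma graft_act t q st e (x : nat -> A) (y : 'I_m -> A) : wft t -> (q < tag st)%N ->
  homog_tagged e st -> map x (iota q (size (leaves t))) = map y (leaves t) ->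
  act_tagged (gr t q st).2 x =
  act_tagged st (fun l => if (l < q)%N then gsgn (cgr A) (tparity [:: T t]) (x l)
    else if l == q then teval id (T t) y else x (l + size (leaves t)).-1).
Proof.
move: t q st e x y; suff [] :
 (forall t q st e (x : nat -> A) (y : 'I_m -> A), wft t -> (q < tag st)%N ->
  homog_tagged e st -> map x (iota q (size (leaves t))) = map y (leaves t) ->
  act_tagged (gr t q st).2 x =
  act_tagged st (fun l => if (l < q)%N then gsgn (cgr A) (tparity [:: T t]) (x l)
    else if l == q then teval id (T t) y else x (l + size (leaves t)).-1)) /\
 (forall ts q st e (x : nat -> A) (y : 'I_m -> A), all (@wft M m) ts ->
  (q + size ts <= tag st)%N -> homog_tagged e st ->
  map x (iota q (size (forest_leaves ts))) = map y (forest_leaves ts) ->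
  act_tagged (grs ts q st).2 x =
  act_tagged st (fun l => if (l < q)%N then gsgn (cgr A) (tparity (map T ts)) (x l)
    else if (l < q + size ts)%N then nth 0 (tvals id (map T ts) y) (l - q)
    else x (l + size (forest_leaves ts) - size ts)%N)) by [].
apply: tree_forest_ind => [i|k v ts IH||t ts IHt IH] q st e x y.
- move=> _ qs he [xy] /=; congr (act_tagged _); apply/funext => l.
  by rewrite addn1; case: ltngtP => // ->.
- move=> /and3P[/eqP sts k0 wts] qs he xy.
  rewrite [LHS](IH q (Tagged (fun n => P n) (opcomp q (tagged st) (dec v)))
     (e + wt v) x y wts _ (opcomp_deg qs he (dec_homog v)) xy); last by rewrite sts /=; lia.
  rewrite act_opcomp //; congr (act_tagged _); apply/funext => l.
  have -> : leaves (Node v ts) = forest_leaves ts by [].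
  case: ltngtP => lq.
  + by rewrite tparity_node gsgn_comp.
  + have -> : ((l + k).-1 < q)%N = false by lia.
    have -> : ((l + k).-1 < q + size ts)%N = false by lia.
    by congr x; lia.
  + rewrite tevalN /=; congr (paact _); apply/funext => j.
    by rewrite ltnNge leq_addr /= ltn_add2l sts ltn_ord addKn.
- move=> _ qs he _; rewrite /=; congr (act_tagged _); apply/funext => l.
  by rewrite !addn0 subn0; case: ltngtP.
move=> /= /andP[wt' wts] qs he; have -> : forest_leaves (t :: ts) = leaves t ++ forest_leaves ts by [].
rewrite size_cat iotaD !map_cat => /eqP; rewrite eqseq_cat ?size_map ?size_iota //.
move=> /andP[/eqP xy1 /eqP xy2].
have qs1 : (q < tag st)%N by lia.
have [h1 h2 h3] := graft_shape wt' qs1 he.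
have grsE : grs ts (gr t q st).1 (gr t q st).2 = grs (t :: ts) q st.
  by rewrite /grs /= -surjective_pairing.
rewrite -grsE (IH _ _ _ x y wts _ h3) ?h1 //; last by rewrite h2; lia.
(* The trees [ts] are grafted to the right of [t] and pass its leaves; this is the same twist that
   [tvals] applies to the inputs of [t]. *)
rewrite (IHt q st e _ (gsgn (cgr A) (tparity (map T ts)) \o y) wt' qs1 he); last first.
  rewrite map_comp -xy1 -map_comp; apply/eq_in_map => l; rewrite mem_iota => /andP[_ ->].
  by [].
congr (act_tagged _); apply/funext => l; case: (ltngtP l q) => lq.
- by rewrite ltn_addr // (tparity_cons _ (map T ts)) gsgn_comp.
- have -> : ((l + size (leaves t)).-1 < q + size (leaves t))%N = false by lia.
  have -> : ((l + size (leaves t)).-1 < q + size (leaves t) + size ts)%N = (l < q + (size ts).+1)%N by lia.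
  case: ifP => ls.
    by rewrite (_ : (l - q)%N = ((l + size (leaves t)).-1 - (q + size (leaves t))).+1) //; lia.
  by congr x; lia.
- rewrite lq subnn ifT; last by lia.
  by rewrite /inner_val; case: is_node.
Qed.

(** Compatibility of a P-algebra with total composition of trees, obtained from [graft_act] with the
    operadic identity as initial composite. *)
Lemma tcomp_spec t : wft t -> perm_eq (leaves t) (enum 'I_m) ->
  homog (opgr P m) (node_weight wt t) (tcomp (tmap dec t)) /\
  forall x : 'I_m -> A, paact (tcomp (tmap dec t)) x = tact id (T t) x.
Proof.
move=> wt' pt.
have st : size (leaves t) = m by rewrite (perm_size pt) size_enum_ord.
have ut : uniq (leaves t) by rewrite (perm_uniq pt) enum_uniq.
pose s0 := Tagged (fun n => P n) (opid P).
have h0 : homog_tagged 0 s0 by exact: opid_homog.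
have [] := graft_shape wt' (q := 0) (st := s0) isT h0.
rewrite /= st !add0r => _.
have := @graft_act t 0 s0 0 _ _ wt' isT h0; rewrite st.
rewrite /tcomp leaves_tmap -/s0 -/(gr t 0 s0).
(* The default of [insubd] is never reached: the leaves are distinct, so reading off labels is
   injective. *)
set s := insubd _ _; have sE j : s j = nth j (leaves t) j.
  rewrite -pvalE /s val_insubd ifT ?ffunE //.
  apply/injectiveP => i1 i2; rewrite !ffunE => i12; apply/val_inj.
  apply/eqP; rewrite -(nth_uniq i1 _ _ ut) ?st ?ltn_ord //.
  by rewrite i12 (set_nth_default i1) // st.
case: (gr t 0 s0).2 => n p /= hact nm; rewrite add0n in nm; subst n => hp.
rewrite (@untagE _ (fun n => P n) _ 0 m id (existT _ m p) (erefl m)) /=; split; first exact: opact_deg.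
move=> x; rewrite paact_act /eact /tact leaves_tmap.
(* Hence the Koszul sign in the action of [s] is the one in [tact]. *)
have -> : codom s = leaves t.
  rewrite codomE; apply: (inj_map val_inj); apply: (@eq_from_nth _ 0%N) => [|i].
    by rewrite !size_map -enumT size_enum_ord st.
  rewrite !size_map -enumT size_enum_ord => im; pose oi := Ordinal im.
  rewrite !(nth_map oi) ?size_map -?enumT ?size_enum_ord ?st //.
  by rewrite -[i]/(val oi) nth_ord_enum sE.
congr kshuffle; apply/funext => {}x.
pose x' i := oapp (x \o s) 0 (insub i).
have x'E (i : 'I_m) : x' i = x (s i) by rewrite /x' valK.
have -> : paact p (x \o s) = act_tagged (existT _ m p) x'.
  by rewrite /act_tagged /=; congr (paact p _); apply/funext => i; rewrite x'E.
rewrite (hact x' x) ?/act_tagged /= ?paact_id //.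
have x'nth i : (i < m)%N -> exists2 j : 'I_m, i = j & x' i = x (nth j (leaves t) j).
  move=> im; exists (Ordinal im) => //.
  by rewrite -[i in x' i]/(val (Ordinal im)) x'E sE.
apply: (@eq_from_nth _ 0); rewrite ?size_map ?size_iota // => i im.
have [j ij xj] := x'nth i im.
by rewrite (nth_map 0%N) ?size_iota // nth_iota // (nth_map j) ?st // ij add0n -ij xj ij.
Qed.

End Grafting.

(** * Composites of trees in Com *)

Section ComGrafting.
Variables (K : fieldType) (M : nat -> Type) (m : nat).
Implicit Types (t : tree M m) (ts : seq (tree M m)).

Let dec k (v : M k) : com_operad K k := mu K k.
Arguments dec : clear implicits.
Let gr t q st := graft (P := com_operad K) (tmap dec t) (q, st).
Let grs ts q st := foldl (fun r u => graft (P := com_operad K) u r) (q, st) [seq tmap dec t | t <- ts].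

Let dec_homog k (v : M k) : homog (opgr (com_operad K) k) 0 (dec k v).
Proof. exact: gr0_homog0. Qed.

Lemma graft_mu t q (st : {n & com_operad K n}) : wft t -> (q < tag st)%N ->
  tagged st = mu K (tag st) -> tagged (gr t q st).2 = mu K (tag (gr t q st).2).
Proof.
move: t q st; suff [] : (forall t q (st : {n & com_operad K n}), wft t -> (q < tag st)%N ->
    tagged st = mu K (tag st) -> tagged (gr t q st).2 = mu K (tag (gr t q st).2)) /\
  (forall ts q (st : {n & com_operad K n}), all (@wft M m) ts -> (q + size ts <= tag st)%N ->
    tagged st = mu K (tag st) -> tagged (grs ts q st).2 = mu K (tag (grs ts q st).2)) by [].
apply: tree_forest_ind => [i|k v ts IH||t ts IHt IH] q st //.
  move=> /and3P[/eqP sts k0 wts] qs stmu; apply: IH => //.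
    have leq_slots n : (q < n -> q + k <= (n + k).-1)%N by lia.
    by rewrite sts; exact: leq_slots.
  by rewrite /= /com_comp stmu /dec !cval_mu ?mulr1 ?scale1r // (leq_ltn_trans _ qs).
move=> /= /andP[wt wts] qs stmu.
have leq_slots n L : (q + (size ts).+1 <= n -> q < n /\ q + L + size ts <= (n + L).-1)%N by lia.
have [qs1 _] := leq_slots _ 0%N qs.
have [] := graft_shape dec_homog wt qs1 (gr0_homog0 (tagged st)).
rewrite -/(gr t q st) => h1 h2 _.
have -> : grs (t :: ts) q st = grs ts (gr t q st).1 (gr t q st).2.
  by rewrite /grs /= -surjective_pairing.
by apply: IH; [by [] | rewrite h1 h2; have [_] := leq_slots _ (size (leaves t)) qs | exact: IHt].
Qed.

Lemma tcomp_mu t : wft t -> size (leaves t) = m -> tcomp (tmap dec t) = mu K m.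
Proof.
move=> wt st; rewrite /tcomp /= -/dec.
pose s0 := Tagged (fun n => com_operad K n) (mu K 1).
have := graft_mu wt (isT : (0 < tag s0)%N) erefl.
have [] := graft_shape dec_homog wt (isT : (0 < tag s0)%N) (gr0_homog0 (tagged s0)).
rewrite -/(gr t 0 s0) st => _ + _.
case: (gr t 0 s0).2 => n p /= nm pE; subst n; rewrite pE.
by rewrite (@untagE _ (fun n => com_sort K n) _ 0 m id (existT _ m (mu K m)) (erefl m)).
Qed.

End ComGrafting.
(** * Koszul signs *)

Section Parities.
Variable T : eqType.
Implicit Types (d e : T -> bool) (w : seq T).

Definition parity d w : bool := odd (count d w).

(** With d and e the parities of the a_i and x_i, this is the sign of separating a_1 x_1 a_2 x_2 ...
    into all a's followed by all x's: each x_i passes the later a_j. *)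
Fixpoint crossings d e w : bool :=
  if w is i :: w' then (e i && parity d w') (+) crossings d e w' else false.

Lemma parity_cons d i w : parity d (i :: w) = d i (+) parity d w.
Proof. by rewrite /parity /= oddD oddb. Qed.

Lemma parity_cat d w1 w2 : parity d (w1 ++ w2) = parity d w1 (+) parity d w2.
Proof. by rewrite /parity count_cat oddD. Qed.

Lemma crossings_cat d e w1 w2 : crossings d e (w1 ++ w2) =
  crossings d e w1 (+) crossings d e w2 (+) (parity e w1 && parity d w2).
Proof.
elim: w1 => [|i w1 IH] /=; first by rewrite addbF.
rewrite IH parity_cat parity_cons.
by case: (e i) (parity d w1) (parity d w2) (crossings d e w1) (crossings d e w2) (parity e w1)
  => [] [] [] [] [] [].
Qed.

Lemma odd_sum I (r : seq I) (P : pred I) (F : I -> nat) :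
  odd (\sum_(i <- r | P i) F i) = \big[addb/false]_(i <- r | P i) odd (F i).
Proof. by elim/big_rec2: _ => // i b n _ <-; rewrite oddD. Qed.

Lemma parityE d w : parity d w = \big[addb/false]_(i <- w) d i.
Proof. by elim: w => [|i w IH]; rewrite ?big_nil // parity_cons IH big_cons. Qed.

Lemma parity_sum (f : T -> nat) w : odd (\sum_(i <- w) f i) = parity (fun i => odd (f i)) w.
Proof. by rewrite odd_sum parityE. Qed.

Lemma andb_addb_suml (b : bool) I (r : seq I) (P : pred I) (F : I -> bool) :
  b && \big[addb/false]_(i <- r | P i) F i = \big[addb/false]_(i <- r | P i) (b && F i).
Proof. by rewrite big_distrr. Qed.

Lemma crossings_nth (f g : T -> nat) w x0 :
  odd (\sum_(j < size w) \sum_(i < size w | (i < j)%N) g (nth x0 w i) * f (nth x0 w j)) =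
  crossings (fun i => odd (f i)) (fun i => odd (g i)) w.
Proof.
elim: w => [|i0 w IH] /=; first by rewrite big_ord0.
rewrite big_ord_recl /= big_pred0 ?add0n // -IH.
under eq_bigr => j _ do rewrite big_mkcond big_ord_recl /= -big_mkcond /=.
rewrite big_split /= oddD; congr (_ (+) _).
  rewrite -big_distrr /= oddM; congr (_ && _).
  by rewrite -parity_sum (big_nth x0) big_mkord.
Qed.

(** As a sum over pairs ordered by position, it can be compared with the same expression for another
    ordering of the letters. *)
Lemma crossings_index d e w : uniq w -> crossings d e w =
  \big[addb/false]_(i <- w) \big[addb/false]_(j <- w | (index i w < index j w)%N) (e i && d j).
Proof.
elim: w => [|i0 w IH]; first by rewrite big_nil.
move=> /andP[i0w uw]; rewrite big_cons.
have idx j : j \in w -> index j (i0 :: w) = (index j w).+1.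
  by move=> jw /=; case: eqP => // ij; rewrite ij jw in i0w.
have idx0 : index i0 (i0 :: w) = 0%N by rewrite /= eqxx.
rewrite [LHS]/=; congr (_ (+) _).
  rewrite [RHS]big_mkcond big_cons idx0 ltnn [X in _ = addb X _]/= addFb parityE andb_addb_suml.
  rewrite [LHS]big_seq [RHS]big_seq; apply: eq_bigr => j jw.
  by rewrite idx.
rewrite IH // [LHS]big_seq [RHS]big_seq; apply: eq_bigr => i iw.
rewrite idx // [RHS]big_mkcond big_cons idx0 ltn0 [X in _ = addb X _]/= addFb.
rewrite [LHS]big_mkcond [LHS]big_seq [RHS]big_seq; apply: eq_bigr => j jw.
by rewrite idx.
Qed.

End Parities.

Lemma odd_abszD (a b : int) : odd `|(a + b)%R|%N = odd `|a|%N (+) odd `|b|%N.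
Proof. by lia. Qed.

Lemma odd_absz_sum (T : eqType) (w : seq T) (F : T -> int) :
  odd `|(\sum_(i <- w) F i)%R|%N = parity (fun i => odd `|F i|%N) w.
Proof.
by elim: w => [|i w IH]; rewrite ?big_nil // big_cons odd_abszD IH parity_cons.
Qed.

Lemma odd_binS n : odd 'C(n.+1, 2) = odd n (+) odd 'C(n, 2).
Proof. by rewrite binS bin1 oddD addbC. Qed.

(** The cross term is the sign of moving n1 odd elements past n2 odd ones; it appears when the
    factors of two forests are separated together. *)
Lemma odd_binD n1 n2 : odd 'C(n1 + n2, 2) = odd 'C(n1, 2) (+) odd 'C(n2, 2) (+) (odd n1 && odd n2).
Proof.
elim: n1 => [|n IH]; first by rewrite addbF.
rewrite addSn !odd_binS IH oddD /=.
by case: (odd n) (odd n2) (odd 'C(n, 2)) (odd 'C(n2, 2)) => [] [] [] [].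
Qed.

Section KoszulSign.
Variables (K : fieldType) (m : nat).

Lemma koszulE (w : seq 'I_m) (b : 'I_m -> bool) : koszul K w b = (-1) ^+
  (\big[addb/false]_(i < m) \big[addb/false]_(j < m)
    [&& (i < j)%N, (index j w < index i w)%N, b i & b j]).
Proof.
rewrite /koszul -signr_odd -sum1_card; congr ((-1) ^+ nat_of_bool _).
rewrite big_mkcond odd_sum pair_bigA /=; apply: eq_bigr => -[i j] _.
by rewrite inE /=; case: ifP.
Qed.

(* Permuting the tensors a_j (x) x_j and separating the a_j from the x_j can be
   done in either order. *)
Lemma koszul_crossings (w : seq 'I_m) (d e : 'I_m -> bool) : perm_eq w (enum 'I_m) ->
  koszul K w (fun j => d j (+) e j) * (-1) ^+ crossings d e w =
  koszul K w d * koszul K w e * (-1) ^+ crossings d e (enum 'I_m).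
Proof.
move=> pw; have uw : uniq w by rewrite (perm_uniq pw) enum_uniq.
rewrite !koszulE -!signr_addb; congr ((-1) ^+ nat_of_bool _).
rewrite !crossings_index ?enum_uniq // (perm_big _ pw) /= !big_enum /=.
have E1 i : \big[addb/false]_(j <- w | (index i w < index j w)%N) (e i && d j)
    = \big[addb/false]_(j < m) [&& (index i w < index j w)%N, e i & d j].
  by rewrite (perm_big _ pw) /= big_mkcond big_enum /=; apply: eq_bigr => j _; case: ifP.
have E2 (i : 'I_m) : \big[addb/false]_(j <- enum 'I_m | (index i (enum 'I_m) < index j (enum 'I_m))%N)
     (e i && d j) = \big[addb/false]_(j < m) [&& (i < j)%N, e i & d j].
  rewrite big_mkcond big_enum /=; apply: eq_bigr => j _.
  by rewrite !index_enum_ord; case: ifP.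
rewrite (eq_bigr _ (fun i _ => E1 i)) (eq_bigr _ (fun i _ => E2 i)).
(* Expanding (d_i + e_i)(d_j + e_j) over the inverted pairs leaves two mixed terms, e_i d_j and d_i
   e_j; the second is reindexed to have the form of the first. *)
pose inv (i j : 'I_m) := (i < j)%N && (index j w < index i w)%N.
have -> : \big[addb/false]_(i < m) \big[addb/false]_(j < m)
    [&& (i < j)%N, (index j w < index i w)%N, d i (+) e i & d j (+) e j] =
  (\big[addb/false]_(i < m) \big[addb/false]_(j < m) [&& (i < j)%N, (index j w < index i w)%N, d i & d j]
   (+) \big[addb/false]_(i < m) \big[addb/false]_(j < m) [&& (i < j)%N, (index j w < index i w)%N, e i & e j])
  (+) (\big[addb/false]_(i < m) \big[addb/false]_(j < m) [&& inv i j, e i & d j]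
   (+) \big[addb/false]_(i < m) \big[addb/false]_(j < m) [&& inv j i, e i & d j]).
  rewrite [X in _ = _ (+) (_ (+) X)]exchange_big /= -!big_split; apply: eq_bigr => i _ /=.
  rewrite -!big_split; apply: eq_bigr => j _ /=; rewrite /inv.
  by case: (i < j)%N (index j w < index i w)%N (d i) (d j) (e i) (e j) => [] [] [] [] [] [].
(* The remaining identity holds pair by pair: e_i d_j counts differently in [w] and in the standard
   order exactly when [w] inverts the pair. *)
rewrite -!addbA; congr (_ (+) (_ (+) _)).
rewrite -!big_split; apply: eq_bigr => i _ /=.
rewrite -!big_split; apply: eq_bigr => j _ /=; rewrite /inv.
have wi (l : 'I_m) : l \in w by rewrite (perm_mem pw) mem_enum.
have eij : (index i w == index j w) = (i == j).
  by apply/eqP/eqP => [|-> //]; exact: index_inj.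
move: eij; rewrite -(inj_eq val_inj) /=.
case: (e i) (d j) => [] []; rewrite ?andbF //.
case: (ltngtP (index i w)) => _; case: (ltngtP i j) => _ //.
Qed.

End KoszulSign.

Lemma prod_signs (K : fieldType) (T : eqType) (f : T -> bool) (L : seq T) x0 k : size L = k ->
  \prod_(j < k) (-1) ^+ f (nth x0 L j) = (-1) ^+ parity f L :> K.
Proof.
move=> <-; rewrite -(big_mkord predT (fun j => (-1) ^+ f (nth x0 L j))) -(big_nth x0 predT (fun p => (-1) ^+ f p)).
by elim: L => [|p L IH]; rewrite ?big_nil // big_cons IH -signr_addb parity_cons.
Qed.

Lemma odd_tensor_sign (T : eqType) (f g : T -> int) (L : seq T) x0 k b : size L = k ->
  odd (tensor_sign b (fun j : 'I_k => f (nth x0 L j)) (fun j : 'I_k => g (nth x0 L j))) =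
  (b && parity (fun p => odd `|f p|%N) L)
    (+) crossings (fun p => odd `|f p|%N) (fun p => odd `|g p|%N) L.
Proof.
move=> <-; rewrite /tensor_sign oddD oddM oddb.
rewrite -(crossings_nth (fun p => `|f p|%N) (fun p => `|g p|%N) L x0).
by rewrite -parity_sum (big_nth x0) big_mkord.
Qed.

Lemma crossings_map (T S : eqType) (f : S -> T) d e (w : seq S) :
  crossings d e [seq f i | i <- w] = crossings (fun i => d (f i)) (fun i => e (f i)) w.
Proof. by elim: w => //= i w ->; rewrite /parity count_map. Qed.

Lemma odd_tensor_sign_ord m b (d e : 'I_m -> int) : odd (tensor_sign b d e) =
  (b && parity (fun j => odd `|d j|%N) (enum 'I_m))
    (+) crossings (fun j => odd `|d j|%N) (fun j => odd `|e j|%N) (enum 'I_m).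
Proof.
pose L := [seq (d j, e j) | j <- enum 'I_m].
have LE (j : 'I_m) : nth (0, 0) L j = (d j, e j).
  by rewrite (nth_map j) ?size_enum_ord // nth_ord_enum.
have Ed : (fun j : 'I_m => (nth (0, 0) L j).1) = d by apply/funext => j; rewrite LE.
have Ee : (fun j : 'I_m => (nth (0, 0) L j).2) = e by apply/funext => j; rewrite LE.
have szL : size L = m by rewrite size_map size_enum_ord.
have := odd_tensor_sign fst snd (0, 0) b szL; rewrite Ed Ee => ->.
by rewrite crossings_map /parity count_map.
Qed.

(** * Separating the two factors of a tree of tensor operations *)

Section TensorTrees.
Variables (K : fieldType) (A X : cchain K) (m : nat) (M : nat -> Type).
Let T := ctensor A X.
Variables (wt : forall k, M k -> int).
Variables (opA : forall k, M k -> mop k A A) (opX : forall k, M k -> mop k X X)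
  (opT : forall k, M k -> mop k T T).
Variables (h : X -> X) (H : T -> T).
Implicit Types (t : tree M m) (ts : seq (tree M m)).

Let odd_wt k (v : M k) := odd `|wt v|%N.
Hypothesis opA_linear : forall k (v : M k), mlinear (opA v).
Hypothesis opA_deg : forall k (v : M k), mdeg (wt v) (opA v).
Hypothesis opX_linear : forall k (v : M k), mlinear (opX v).
Hypothesis opX_deg : forall k (v : M k), mdeg (- wt v - 1) (opX v).
Hypothesis opT_linear : forall k (v : M k), mlinear (opT v).
(* [opT v] stands for (-1)^|c_v| p_v (x) f_v, where |p_v| = -|c_v| is [wt v]. *)
Hypothesis opT_pure : forall k (v : M k) (d e : 'I_k -> int) a x,
  (forall j, homog (cgr A) (d j) (a j)) -> (forall j, homog (cgr X) (e j) (x j)) ->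
  opT v (fun j => pure (a j) (x j)) =
  (-1) ^+ (odd_wt v + tensor_sign (~~ odd_wt v) d e)%N *: pure (opA v a) (opX v x).
Hypothesis h_linear : linear h.
Hypothesis h_deg : forall d (x : X), homog (cgr X) d x -> homog (cgr X) (d + 1) (h x).
Hypothesis H_linear : linear H.
Hypothesis H_pure : forall d e (a : A) (x : X), homog (cgr A) d a -> homog (cgr X) e x ->
  H (pure a x) = (-1) ^+ `|d|%N *: pure a (h x).

Let tA t := tmap (fun k (v : M k) => (odd_wt v, opA v)) t.
Let tX t := tmap (fun k (v : M k) => (odd_wt v, opX v)) t.
Let tT t := tmap (fun k (v : M k) => (false, opT v)) t.

Let odd_node (v : {k & M k}) := odd_wt (tagged v).
Definition node_count t := count odd_node (nodes t).
Definition forest_count ts := count odd_node (forest_nodes ts).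

Lemma tparity_tmap (V : cchain K) (op : forall k, M k -> bool * mop k V V) ts :
  tparity [seq tmap op t | t <- ts] =
  odd (count (fun v => (op _ (tagged v)).1) (forest_nodes ts)).
Proof.
elim: ts => //= t ts IH; rewrite tparity_cons IH /forest_nodes /= count_cat oddD.
by rewrite /tparity /= cats0 count_nodes_tmap.
Qed.

(** The sign when every vertex, the root included, is followed by [H]. With r odd vertices, the
    terms come from the h f_v passing the inputs a_i, from the x_i passing later a_j, and from
    separating the p_v from the h f_v. *)
Definition tree_sign (d e : 'I_m -> int) t :=
  (odd (node_count t) && parity (fun i => odd `|d i|%N) (leaves t))
    (+) crossings (fun i => odd `|d i|%N) (fun i => odd `|e i|%N) (leaves t)
    (+) odd 'C(node_count t, 2).

Definition forest_sign (d e : 'I_m -> int) ts :=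
  (odd (forest_count ts) && parity (fun i => odd `|d i|%N) (forest_leaves ts))
    (+) crossings (fun i => odd `|d i|%N) (fun i => odd `|e i|%N) (forest_leaves ts)
    (+) odd 'C(forest_count ts, 2).

Lemma odd_node_weight t : odd `|node_weight wt t|%N = odd (node_count t).
Proof.
rewrite /node_weight /node_count; elim: (nodes t) => [|v s IH]; first by rewrite big_nil.
by rewrite big_cons odd_abszD IH /= oddD oddb.
Qed.

(** The flag [c] selects between the A-side and the X-side, whose weights are opposite and so have
    the same parity. *)
Lemma odd_tree_degree (f : 'I_m -> int) (c : bool) t :
  odd `|((if c then - node_weight wt t else node_weight wt t) + \sum_(i <- leaves t) f i)%R|%N =
  odd (node_count t) (+) parity (fun i => odd `|f i|%N) (leaves t).
Proof.
rewrite odd_abszD odd_absz_sum; congr (_ (+) _).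
by rewrite -odd_node_weight; case: c => //; lia.
Qed.

Let pures (a : 'I_m -> A) (x : 'I_m -> X) : 'I_m -> T := fun i => pure (a i) (x i).

Lemma teval_gsgn (V : cchain K) (f : V -> V) (op : forall k, M k -> bool * mop k V V) t b
    (d : 'I_m -> int) (x : 'I_m -> V) :
  (forall k (v : M k), mlinear (op k v).2) -> linear f -> wft t ->
  (forall i, homog (cgr V) (d i) (x i)) ->
  inner_val f (tmap op t) (gsgn (cgr V) b \o x) =
  (-1) ^+ (b && parity (fun i => odd `|d i|%N) (leaves t)) *: inner_val f (tmap op t) x.
Proof.
move=> lop lf wt' hx.
have -> : gsgn (cgr V) b \o x = fun i => (-1) ^+ (b && odd `|d i|%N) *: x i.
  by apply/funext => i /=; rewrite (gsgn_homog _ (hx i)) andbC.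
have -> : (-1) ^+ (b && parity (fun i => odd `|d i|%N) (leaves t))
    = \prod_(i <- leaves t) (-1) ^+ (b && odd `|d i|%N) :> K.
  elim: (leaves t) => [|i w IH]; first by rewrite big_nil andbF.
  by rewrite big_cons -IH -signr_addb parity_cons; case: (b).
rewrite !inner_valE teval_scale //; case: is_node => //.
exact: linearZ'.
Qed.

(** The induction runs on the value including [H], whose sign is uniform. Dropping [H] at the root
    removes its Koszul sign with the A-factor, of parity r plus that of the inputs. *)
Lemma inner_val_pure t (d e : 'I_m -> int) a x : wft t ->
  (forall j, homog (cgr A) (d j) (a j)) -> (forall j, homog (cgr X) (e j) (x j)) ->
  inner_val H (tT t) (pures a x) =
    (-1) ^+ tree_sign d e t *: pure (inner_val id (tA t) a) (inner_val h (tX t) x) /\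
  (is_node t -> teval H (tT t) (pures a x) =
    (-1) ^+ (tree_sign d e t (+) odd (node_count t) (+)
      parity (fun i => odd `|d i|%N) (leaves t)) *: pure (teval id (tA t) a) (teval h (tX t) x)).
Proof.
move: t d e a x; suff [] : (forall t (d e : 'I_m -> int) a x, wft t ->
  (forall j, homog (cgr A) (d j) (a j)) -> (forall j, homog (cgr X) (e j) (x j)) ->
  inner_val H (tT t) (pures a x) =
    (-1) ^+ tree_sign d e t *: pure (inner_val id (tA t) a) (inner_val h (tX t) x) /\
  (is_node t -> teval H (tT t) (pures a x) =
    (-1) ^+ (tree_sign d e t (+) odd (node_count t) (+)
      parity (fun i => odd `|d i|%N) (leaves t)) *: pure (teval id (tA t) a) (teval h (tX t) x)))
 /\ (forall ts (d e : 'I_m -> int) a x, all (@wft M m) ts ->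
  (forall j, homog (cgr A) (d j) (a j)) -> (forall j, homog (cgr X) (e j) (x j)) ->
  (* For each subtree, [L] records its sign and the degrees of its two factors. The last clause says
     that these signs, with those for separating the factors of the different subtrees, amount to
     [forest_sign]. *)
  exists L : seq (bool * (int * int)),
   let od p := odd `|p.2.1|%N in let oe p := odd `|p.2.2|%N in
   [/\ size L = size ts,
    forall l, (l < size ts)%N -> let p := nth (false, (0, 0)) L l in
      [/\ homog (cgr A) p.2.1 (nth 0 (tvals id (map tA ts) a) l),
         homog (cgr X) p.2.2 (nth 0 (tvals h (map tX ts) x) l)
       & nth 0 (tvals H (map tT ts) (pures a x)) l = (-1) ^+ p.1 *:
           pure (nth 0 (tvals id (map tA ts) a) l) (nth 0 (tvals h (map tX ts) x) l)],
    parity od L = odd (forest_count ts) (+) parity (fun i => odd `|d i|%N) (forest_leaves ts),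
    parity oe L = odd (forest_count ts) (+) parity (fun i => odd `|e i|%N) (forest_leaves ts)
  & parity fst L (+) crossings od oe L = forest_sign d e ts]) by [].
have degA t a (d : 'I_m -> int) : wft t -> (forall j, homog (cgr A) (d j) (a j)) ->
    homog (cgr A) (node_weight wt t + \sum_(i <- leaves t) d i) (teval id (tA t) a).
  move=> wt' ha; rewrite -[X in homog _ X _]subr0.
  have := @teval_deg _ _ id _ _ (fun k v => (odd_wt v, opA v)) wt 0 _ _ t a d wt' ha.
  rewrite if_same => -[] //.
  - by move=> k v; rewrite subr0; exact: opA_deg.
  - by move=> n y hy; rewrite addr0.
have degX t x (e : 'I_m -> int) : wft t -> (forall j, homog (cgr X) (e j) (x j)) ->
    homog (cgr X) (- node_weight wt t + \sum_(i <- leaves t) e i) (inner_val h (tX t) x).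
  move=> wt' hx.
  have [] := @teval_deg _ _ h _ _ (fun k v => (odd_wt v, opX v)) (fun k v => - wt v) 1
     opX_deg h_deg t x e wt' hx.
  by rewrite {2}/node_weight sumrN.
have nodeval t (e : 'I_m -> int) x : wft t -> is_node t ->
    (forall j, homog (cgr X) (e j) (x j)) ->
    homog (cgr X) (- node_weight wt t + \sum_(i <- leaves t) e i - 1) (teval h (tX t) x).
  move=> wt' nt hx.
  have [] := @teval_deg _ _ h _ _ (fun k v => (odd_wt v, opX v)) (fun k v => - wt v) 1
     opX_deg h_deg t x e wt' hx.
  by rewrite {1}/node_weight sumrN nt.
apply: tree_forest_ind => [i|k v ts IH||t ts IHt IH] d e a x.
- by move=> _ ha hx; split=> //; rewrite /tree_sign /= andbF addbF expr0 scale1r.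
- move=> wtt ha hx; have /and3P[/eqP st k0 wts] := wtt.
  have [L [sL hL pA pX cL]] := IH d e a x wts ha hx.
  set S := tree_sign _ _ _; set R := odd (node_count _); set D := parity _ _.
  suff E : teval H (tT (Node v ts)) (pures a x) = (-1) ^+ (S (+) R (+) D) *:
      pure (teval id (tA (Node v ts)) a) (teval h (tX (Node v ts)) x).
    split=> //.
    rewrite -[LHS]/(H (teval H (tT (Node v ts)) (pures a x))) E (linearZ' _ _ H_linear).
    rewrite -[inner_val h _ x]/(h (teval h (tX (Node v ts)) x)).
    rewrite -[inner_val id _ a]/(teval id (tA (Node v ts)) a).
    rewrite (H_pure (degA _ _ _ wtt ha) (nodeval _ e _ wtt isT hx)) scalerA.
    rewrite -[(-1) ^+ `|_|%N]signr_odd (odd_tree_degree d false) -signr_addb.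
    congr ((-1) ^+ nat_of_bool _ *: _); rewrite -/R -/D.
    by case: (S); case: (R); case: (D).
  rewrite !teval_node /=.
  pose y j := nth 0 (tvals id (map tA ts) a) j; pose z j := nth 0 (tvals h (map tX ts) x) j.
  have -> : (fun j : 'I_k => nth 0 (tvals H (map tT ts) (pures a x)) j) =
      (fun j : 'I_k => (-1) ^+ (nth (false, (0, 0)) L j).1 *: pure (y j) (z j)).
    by apply/funext => j; have [|_ _] := hL j; rewrite // st.
  rewrite mlinear_prod // (@opT_pure _ v (fun j => (nth (false, (0, 0)) L j).2.1)
    (fun j => (nth (false, (0, 0)) L j).2.2)); last 2 first.
  + by move=> j; have [|] := hL j; rewrite // st.
  + by move=> j; have [|] := hL j; rewrite // st.
  rewrite scalerA; congr (_ *: _).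
  rewrite (prod_signs K fst (false, (0, 0)) (etrans sL st)) -[X in _ * X]signr_odd -signr_addb.
  rewrite oddD oddb (odd_tensor_sign (fun p => p.2.1) (fun p => p.2.2) _ _ (etrans sL st)).
  congr ((-1) ^+ nat_of_bool _).
  have {cL} -> : parity fst L = crossings (fun p => odd `|p.2.1|%N) (fun p => odd `|p.2.2|%N) L
      (+) forest_sign d e ts by rewrite -cL addbC addbK.
  rewrite pA /S /R /D /forest_sign /tree_sign.
  have -> : node_count (Node v ts) = (odd_wt v + forest_count ts)%N by [].
  have -> : leaves (Node v ts) = forest_leaves ts by [].
  rewrite odd_binD oddD oddb; have -> : odd 'C(odd_wt v, 2) = false by case: odd_wt.
  case: (crossings _ _ L) (crossings _ _ (forest_leaves ts)) (parity _ _) (odd_wt v)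
    (odd (forest_count ts)) (odd 'C(forest_count ts, 2)) => [] [] [] [] [] [] //.
- by move=> _ ha hx; exists [::].
move=> /andP[wtt wts] ha hx.
have [L [sL hL pA pX cL]] := IH d e a x wts ha hx.
have [hT _] := IHt d e a x wtt ha hx.
set b := odd (forest_count ts).
pose D := parity (fun i => odd `|d i|%N) (leaves t).
pose E := parity (fun i => odd `|e i|%N) (leaves t).
(* The terms with [b] compensate the twists that the later subtrees impose on the inputs of [t] in
   the A-tree and in the X-tree. *)
exists ((tree_sign d e t (+) (b && D) (+) (b && E),
   (node_weight wt t + \sum_(i <- leaves t) d i, - node_weight wt t + \sum_(i <- leaves t) e i)) :: L).
have lvE : forest_leaves (t :: ts) = leaves t ++ forest_leaves ts by [].
have fcE : forest_count (t :: ts) = (node_count t + forest_count ts)%N.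
  by rewrite /forest_count /forest_nodes /= count_cat.
have oa := odd_tree_degree d false t; have ox := odd_tree_degree e true t.
rewrite -/D in oa; rewrite -/E in ox.
split.
- by rewrite /= sL.
- case=> [_|l ls]; last exact: hL.
  rewrite /= -!/(tA _) -!/(tX _) -!/(tT _) !tparity_tmap -/(forest_count ts) -/b.
  (* The tree of tensor operations has no such twist, as [H] composed with [opT] is even. *)
  have -> : odd (count (fun v : {k : nat & M k} => false) (forest_nodes ts)) = false.
    by rewrite count_pred0.
  have [opA' opX'] : (forall k (v : M k), mlinear (odd_wt v, opA v).2) /\
    (forall k (v : M k), mlinear (odd_wt v, opX v).2) by [].
  rewrite (teval_gsgn b opA' (f := id) _ wtt ha) // (teval_gsgn b opX' h_linear wtt hx).
  split.
  + by apply: homogZ; have := degA t a d wtt ha; rewrite /inner_val if_same.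
  + by apply: homogZ; exact: degX.
  rewrite -[LHS]/(inner_val H (tT t) (pures a x)) hT.
  rewrite (linearZ' _ _ (pure_linearl _)) (linearZ' _ _ (pure_linearr _)) !scalerA.
  congr (_ *: _); rewrite -!signr_addb; congr ((-1) ^+ nat_of_bool _).
  by rewrite -/D -/E; case: (tree_sign d e t); case: (b); case: (D); case: (E).
- by rewrite parity_cons /= oa pA lvE fcE parity_cat oddD -/D addbACA.
- by rewrite parity_cons /= ox pX lvE fcE parity_cat oddD -/E addbACA.
rewrite parity_cons /= ox pA /forest_sign lvE fcE parity_cat crossings_cat oddD odd_binD -/D -/E -/b.
have {cL} -> : parity fst L = crossings (fun p => odd `|p.2.1|%N) (fun p => odd `|p.2.2|%N) L
      (+) forest_sign d e ts by rewrite -cL addbC addbK.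
rewrite /forest_sign /tree_sign -/b -/D.
move: (crossings _ _ L) (crossings _ _ (leaves t)) (crossings _ _ (forest_leaves ts))
  (parity _ (forest_leaves ts)) (odd 'C(node_count t, 2)) (odd 'C(forest_count ts, 2))
  (odd (node_count t)).
by case: (b); case: (D); case: (E) => [] [] [] [] [] [] [] [].
Qed.

Hypothesis opT_fil : forall k (v : M k), mfil (opT v).
Hypothesis H_fil : forall k (y : T), cfil k y -> cfil k (H y).

(** The root lacks [h], so the X-factor has parity r + 1. Removing the [H] of the root turns r|a| +
    r(r-1)/2 into (r+1)|a| + r(r+1)/2; [koszul_crossings] absorbs the reordering of the inputs. *)
Lemma tact_op_tensor t : wft t -> is_node t -> perm_eq (leaves t) (enum 'I_m) ->
  is_op_tensor (~~ odd (node_count t)) (tact id (tA t)) (tact h (tX t))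
    (fun y => (-1) ^+ odd 'C((node_count t).+1, 2) *: tact H (tT t) y).
Proof.
move=> wtt nt pt.
have lA : mlinear (teval id (tA t)) by apply: teval_mlinear.
have lX : mlinear (teval h (tX t)) by apply: teval_mlinear.
have lT : mlinear (teval H (tT t)) by apply: teval_mlinear.
have fT : mfil (teval H (tT t)) by apply: teval_mfil.
split.
- by apply: mlinear_scale; exact: kshuffle_mlinear.
- by apply: mfil_scale; exact: kshuffle_mfil.
move=> d e a x ha hx.
have hp j : homog (cgr T) (d j + e j) (pure (a j) (x j)) by exact: pure_homog.
rewrite /tact (kshuffle_homog _ lT hp) (kshuffle_homog _ lA ha) (kshuffle_homog _ lX hx).
rewrite !leaves_tmap; have [_ /(_ nt)] := inner_val_pure wtt ha hx; rewrite /pures => ->.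
rewrite (linearZ' _ _ (pure_linearl _)) (linearZ' _ _ (pure_linearr _)) !scalerA.
congr (_ *: _).
have -> : koszul K (leaves t) (fun j => odd `|(d j + e j)%R|%N)
    = koszul K (leaves t) (fun j => odd `|d j|%N (+) odd `|e j|%N).
  by congr koszul; apply/funext => j; exact: odd_abszD.
have kc := koszul_crossings K (fun j => odd `|d j|%N) (fun j => odd `|e j|%N) pt.
set R := odd (node_count t); set D := parity _ _.
have -> : (-1) ^+ (tree_sign d e t (+) R (+) D) =
    (-1) ^+ crossings (fun j => odd `|d j|%N) (fun j => odd `|e j|%N) (leaves t) *
    (-1) ^+ ((~~ R && D) (+) odd 'C((node_count t).+1, 2)) :> K.
  rewrite -signr_addb odd_binS /tree_sign -/R -/D; congr ((-1) ^+ nat_of_bool _).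
  by case: crossings; case: (R); case: (D); case: (odd 'C(_, 2)).
rewrite -mulrA [X in _ * X]mulrA kc -[(-1) ^+ tensor_sign _ _ _]signr_odd.
rewrite odd_tensor_sign_ord.
have -> : parity (fun j => odd `|d j|%N) (enum 'I_m) = D.
  by rewrite /D /parity (seq.permP pt).
rewrite !signr_addb; set c1 := (-1) ^+ _; set c2 := (-1) ^+ _; set c3 := (-1) ^+ _.
have c11 : c1 * c1 = 1 by rewrite -signr_addb addbb.
by rewrite mulrC [RHS]mulrC -!mulrA c11 mulr1 [c2 * c3]mulrC.
Qed.

End TensorTrees.
(** * Comparison of the two structures *)

Section DecorationSums.
Variables (K : fieldType) (V : cchain K) (h : V -> V) (m : nat) (M : nat -> eqType).
Variables (lab : forall k, seq (M k)) (op : forall k, M k -> mop k V V).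
Hypothesis h_linear : linear h.
Hypothesis op_linear : forall k (v : M k), mlinear (op v).

Let ev (t : tree M m) := tmap (fun k (v : M k) => (false, op v)) t.
Let total k : mop k V V := fun x => \sum_(v <- lab k) op v x.
Let evs (s : shape m) := tmap (fun k _ => (false, @total k)) s.

Lemma tvals_even (N : nat -> Type) (f : forall k, N k -> mop k V V) (ts : seq (tree N m)) x :
  tvals h [seq tmap (fun k v => (false, f k v)) t | t <- ts] x =
  [seq inner_val h (tmap (fun k v => (false, f k v)) t) x | t <- ts].
Proof.
elim: ts => //= t ts ->; congr (_ :: _).
by rewrite tparity_tmap count_pred0.
Qed.

(** All vertices are even, so no child is twisted by its siblings and multilinearity at each vertex
    distributes the sums independently. *)
Lemma teval_decorate s x : wft s ->
  teval h (evs s) x = \sum_(t <- decorate lab s) teval h (ev t) x.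
Proof.
suff [H _] : (forall s x, wft s ->
    teval h (evs s) x = \sum_(t <- decorate lab s) teval h (ev t) x /\
    inner_val h (evs s) x = \sum_(t <- decorate lab s) inner_val h (ev t) x) /\
  (forall ss x, all (@wft _ m) ss ->
    [seq inner_val h (evs s) x | s <- ss] =
    [seq \sum_(y <- l) y | l <- [seq [seq inner_val h (ev t) x | t <- decorate lab s] | s <- ss]]).
  by move=> wts; have [] := H s x wts.
apply: tree_forest_ind => [i|k v ss IH||{}s ss IHs IH] {}x.
- by rewrite /= !big_seq1.
- move=> /and3P[/eqP sk k0 wts].
  suff E : teval h (evs (Node (k := k) v ss)) x = \sum_(t <- decorate lab (Node (k := k) v ss)) teval h (ev t) x.
    split=> //; rewrite -[LHS]/(h (teval h (evs (Node (k := k) v ss)) x)) E linear_sum' //.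
    by rewrite !big_allpairs_dep.
  rewrite [LHS]tevalN tvals_even IH // /total big_allpairs_dep.
  apply: eq_bigr => u _; rewrite mlinear_cart ?size_map //.
  rewrite (_ : [seq [seq inner_val h (ev t) x | t <- decorate lab s] | s <- ss] = [seq [seq inner_val h (ev t) x | t <- l]
     | l <- [seq decorate lab s | s <- ss]]); last by rewrite -map_comp.
  rewrite cart_map big_map; apply: eq_bigr => ts _.
  by rewrite [RHS]tevalN tvals_even.
- by [].
by move=> /= /andP[wts wss]; rewrite IH // (IHs x wts).2 big_map.
Qed.

Lemma tact_decorate s x : wft s ->
  tact h (evs s) x = \sum_(t <- decorate lab s) tact h (ev t) x.
Proof.
move=> wts; rewrite /tact leaves_tmap /kshuffle.
under eq_bigr => b _ do rewrite (teval_decorate _ wts) scaler_sumr.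
rewrite exchange_big /= [LHS]big_seq [RHS]big_seq; apply: eq_bigr => t ts.
by have [lt _ _] := decorate_shape ts; rewrite leaves_tmap lt.
Qed.

Lemma tmap_const (N : nat -> Type) (f : forall k, N k) (s : shape m) (t : tree M m) :
  t \in decorate lab s -> tmap (fun k _ => f k) t = tmap (fun k _ => f k) s.
Proof.
move: s t; suff [] : (forall (s : shape m) (t : tree M m),
    t \in decorate lab s -> tmap (fun k _ => f k) t = tmap (fun k _ => f k) s) /\
  (forall (ss : seq (shape m)) (ts : seq (tree M m)), ts \in cart [seq decorate lab s | s <- ss] ->
    [seq tmap (fun k _ => f k) t | t <- ts] = [seq tmap (fun k _ => f k) s | s <- ss]) by [].
apply: tree_forest_ind => [i t|k v ss IH t|ts|s ss h' IH ts] /=.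
- by rewrite inE => /eqP ->.
- by move=> /allpairsPdep [u [ts [_ /IH E ->]]] /=; rewrite E.
- by rewrite inE => /eqP ->.
- by move=> /allpairsP [[t us] /= [/h' E /IH E' ->]] /=; rewrite E E'.
Qed.

Lemma size_decorate (s : shape m) : (forall k, (0 < k)%N -> size (lab k) = 1%N) -> wft s ->
  size (decorate lab s) = 1%N.
Proof.
move=> lab1; move: s; suff [] : (forall s : shape m, wft s -> size (decorate lab s) = 1%N) /\
  (forall ss : seq (shape m), all (@wft _ m) ss ->
     size (cart [seq decorate lab s | s <- ss]) = 1%N) by [].
apply: tree_forest_ind => // [k v ss IH|s ss IHs IH] /=.
  by move=> /and3P[_ k0 /IH E]; rewrite size_allpairs lab1 // E.
by move=> /andP[/IHs E /IH E']; rewrite size_allpairs E E'.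
Qed.

End DecorationSums.

Section Bases.
Variables (K : fieldType) (P : operad K) (e : opbasis P) (m : nat).
Implicit Types (p : P m).

Lemma dbasisE (i : 'I_(obdim e m)) p : dbasis i p = coord (obvec e m) i p.
Proof. by rewrite /dbasis lfunE. Qed.

Lemma basis_expand p : p = \sum_i dbasis i p *: tnth (obvec e m) i.
Proof.
rewrite {1}(coord_basis (ob_basis e m) (memvf p)); apply: eq_bigr => i _.
by rewrite dbasisE (tnth_nth 0).
Qed.

(** This converts the sign (-1)^|c_i| of the root into (-1)^r for each tree that contributes. *)
Lemma dbasis_homog n p (i : 'I_(obdim e m)) : homog (opgr P m) n p -> dbasis i p != 0 -> obdeg i = n.
Proof.
move=> hp; apply: contraNeq => ni; rewrite dbasisE -hp {1}(basis_expand p).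
rewrite (linear_sum' _ _ _ (gcomp_linear _ _)).
under eq_bigr => j _.
  rewrite (linearZ' _ _ (gcomp_linear _ _)) -(ob_homog j) gcomp_proj.
  rewrite (_ : (if _ then _ else 0) = (n == obdeg j)%:R *: (obvec e m)`_j); last first.
    by rewrite ob_homog -tnth_nth; case: eqP; rewrite ?scale1r ?scale0r.
  rewrite scalerA; over.
rewrite (coord_sum_free _ _ (basis_free (ob_basis e m))).
have -> : (n == obdeg i) = false by rewrite eq_sym; exact: negbTE.
by rewrite mulr0.
Qed.

Lemma dbasis_dhomog (i : 'I_(obdim e m)) : dhomog (- obdeg i) (dbasis i).
Proof.
move=> n p hp; rewrite opprK => ni; apply/eqP; apply: contraNT ni => /(dbasis_homog hp) ->.
by [].
Qed.

End Bases.

Lemma com_basis_mu (K : fieldType) k (j : 'I_(0 < k)%N) :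
  tnth (obvec (com_basis K) k) j = mu K k.
Proof. exact: tnth_mktuple. Qed.

Lemma com_dbasis_mu (K : fieldType) k (j : 'I_(obdim (com_basis K) k)) :
  dbasis j (mu K k) = 1 :> K.
Proof.
rewrite dbasisE -(com_basis_mu K j) (tnth_nth 0) coord_free ?eqxx //.
exact: basis_free (ob_basis (com_basis K) k).
Qed.

(** * Both structures as sums over the same decorated trees *)

Section Transfer.
Variables (K : fieldType) (P : operad K) (e : opbasis P) (X : omega_alg e) (Y : cchain K).
Variables (c : contraction X Y) (A : palgebra P) (m : nat).

Let I := id_tensor A false (ci c).
Let Pr := id_tensor A false (cp c).
Let H := id_tensor A true (ch c).
Let lab k := enum 'I_(obdim e k).
Let T := ctensor A X.

Let opA k (i : 'I_(obdim e k)) : mop k A A := paact (tnth (obvec e k) i).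
Let opX k (i : 'I_(obdim e k)) : mop k X X := oatw X (dbasis i).
Let opT k (i : 'I_(obdim e k)) : mop k T T := fun t =>
  (-1) ^+ odd `|obdeg i|%N *: op_tensor (~~ odd `|obdeg i|%N) (opA i) (opX i) t.

Definition labelled_trees : seq (tree (fun k => 'I_(obdim e k)) m) :=
  [seq t | s <- trees m, t <- decorate lab s].
Implicit Types t : tree (fun k => 'I_(obdim e k)) m.

Let tX t := tmap (fun k (i : 'I_(obdim e k)) => (odd `|obdeg i|%N, opX i)) t.
Let tT t := tmap (fun k (i : 'I_(obdim e k)) => (false, opT i)) t.
Let comp t := tcomp (tmap (fun k i => tnth (obvec e k) i) t).
Let fX t : mop m Y Y := vdl (ci c) (cp c) (ch c) (tX t).
Let fT t : mop m (ctensor A Y) (ctensor A Y) := vdl I Pr H (tT t).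

Lemma labelled_treesP t : t \in labelled_trees -> wft t /\ perm_eq (leaves t) (enum 'I_m).
Proof.
move=> /allpairsPdep [s [u [/treesP [wts ps] /decorate_shape [h1 h2 _] ->]]].
by rewrite h1 h2.
Qed.

Lemma opA_deg k (i : 'I_(obdim e k)) : mdeg (obdeg i) (opA i).
Proof. exact: paact_deg (ob_homog i). Qed.

Lemma opX_deg k (i : 'I_(obdim e k)) : mdeg (- obdeg i - 1) (opX i).
Proof. by apply: oatw_deg; exact: dbasis_dhomog. Qed.

Lemma opT_spec k (i : 'I_(obdim e k)) : is_op_tensor (~~ odd `|obdeg i|%N) (opA i) (opX i)
  (op_tensor (~~ odd `|obdeg i|%N) (opA i) (opX i)).
Proof.
have [g hg] := op_tensor_exists (~~ odd `|obdeg i|%N) (paact_mlinear (p0 := A) (tnth (obvec e k) i))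
  (paact_fil (tnth (obvec e k) i)) (opA_deg i)
  (oatw_mlinear (o := X) (dbasis i)) (oatw_fil (o := X) (dbasis i)) (opX_deg i).
by rewrite (op_tensorE hg).
Qed.

Let opT_linear k (i : 'I_(obdim e k)) : mlinear (opT i).
Proof. by have [lg _ _] := opT_spec i; exact: mlinear_scale. Qed.

Let opT_fil k (i : 'I_(obdim e k)) : mfil (opT i).
Proof. by have [_ fg _] := opT_spec i; exact: mfil_scale. Qed.

Let H_linear : linear H. Proof. by have [] := id_tensorP A true (ch_map c). Qed.
Let Pr_linear : linear Pr. Proof. by have [] := id_tensorP A false (cp_map c). Qed.

Let odd_nodd t : odd (nodd t) = odd `|node_weight (fun k (i : 'I_(obdim e k)) => obdeg i) t|%N.
Proof. by rewrite odd_node_weight. Qed.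

(** These are the requirements of [op_tensor_exists]; the tree reduced to a leaf gives the zero
    operation. *)
Lemma fX_good t : t \in labelled_trees ->
  [/\ mlinear (fX t), mfil (fX t) & exists n, mdeg n (fX t)].
Proof.
move=> /labelled_treesP[wtt pt].
have [li di fi] := ci_map c; have [lp dp fp] := cp_map c; have [lh dh fh] := ch_map c.
case: t wtt pt => [i|k v ts] wtt pt.
  split.
  - by move=> x j a u w; rewrite /fX /= scaler0 addr0.
  - by move=> k x _; exact: cfil_zero.
  - by exists 0 => d x _; exact: homog0.
set t := Node v ts in wtt pt *.
have lt : mlinear (teval (ch c) (tX t)).
  by apply: teval_mlinear => // n i; exact: oatw_mlinear.
split.
- by apply: mlinear_comp => //; exact: kshuffle_mlinear.
- move=> l y hy; apply: fp; apply: kshuffle_mfil => [|j]; last exact: fi.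
  by apply: teval_mfil => // n i; exact: oatw_fil.
exists (- node_weight (fun k (i : 'I_(obdim e k)) => obdeg i) t - 1) => d y hy.
rewrite -[X in homog _ X _]addr0; apply: dp; apply: kshuffle_mdeg => [//||j]; last first.
  by rewrite -[d j]addr0; exact: di.
move=> d' x hx; have [+ _] := @teval_deg _ _ (ch c) _ _
  (fun k i => (odd `|obdeg i|%N, opX i)) (fun k i => - obdeg i) 1 opX_deg dh t x d' wtt hx.
rewrite {1}/node_weight sumrN (perm_big _ pt) big_enum /=.
by rewrite [in X in X -> _]addrAC.
Qed.

Lemma fT_op_tensor t : t \in labelled_trees ->
  is_op_tensor (~~ odd (nodd t)) (paact (comp t)) (fX t)
    (fun y => (-1) ^+ odd 'C((nodd t).+1, 2) *: fT t y).
Proof.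
move=> tl; have [wtt pt] := labelled_treesP tl.
have [_ compE] := tcomp_spec (wt := fun k (i : 'I_(obdim e k)) => obdeg i)
  (fun k i => ob_homog i) A wtt pt.
have {}compE : paact (comp t) = tact id (tmap (fun k i => (odd `|obdeg i|%N, opA i)) t).
  by apply/funext.
have [lh dh fh] := ch_map c.
case: (boolP (is_node t)) => nt; last first.
  case: t nt {tl wtt pt compE} => // i _; split.
  - by move=> x j a u w; rewrite /fT /= !scaler0 addr0.
  - by move=> k x _; rewrite /fT /= scaler0; exact: (@cfil_zero _ (ctensor A Y)).
  - by move=> d f a x _ _; rewrite /fT /fX /= (linear0' (pure_linearr _)) !scaler0.
have -> : fX t = fun y => cp c (tact (ch c) (tX t) (ci c \o y)).
  by case: t nt {tl wtt pt compE}.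
have -> : (fun y => (-1) ^+ odd 'C((nodd t).+1, 2) *: fT t y) =
    (fun y => Pr ((-1) ^+ odd 'C((nodd t).+1, 2) *: tact H (tT t) (I \o y))).
  apply/funext => y; rewrite (linearZ' _ _ Pr_linear); congr (_ *: _).
  by case: t nt {tl wtt pt compE}.
have [_ fH HE] := id_tensorP A true (ch_map c).
apply: (op_tensor_comp (g := fun y => _ *: tact H (tT t) y) (ci_map c) (cp_map c)).
rewrite compE; apply: (tact_op_tensor (wt := fun k (i : 'I_(obdim e k)) => obdeg i)) => //.
- by move=> k i; exact: paact_mlinear.
- exact: opA_deg.
- by move=> k i; exact: oatw_mlinear.
- exact: opX_deg.
- move=> k i d f a x ha hx; have [_ _ gE] := opT_spec i.
  rewrite /opT (gE d f) // scalerA; congr (_ *: _).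
  by rewrite exprD.
- by move=> d f a x ha hx; rewrite /H (HE d f) // mul1n.
Qed.

Let pi_op k : mop k T T := fun y => \sum_(i <- lab k) opT i y.

Lemma pi_alg_gen k (j : 'I_(obdim (com_basis K) k)) :
  pi_alg e A (oatw X) k (dbasis j) = @pi_op k.
Proof.
apply/funext => y; rewrite /pi_alg com_dbasis_mu scale1r /pi_op /lab big_enum /=.
by apply: eq_bigr => i _; rewrite /opT signr_odd.
Qed.

Lemma transfer_pi_alg (f : dual (com_operad K) m) (y : 'I_m -> ctensor A Y) :
  transfer (com_basis K) I Pr H (pi_alg e A (oatw X)) f y =
  f (mu K m) *: \sum_(t <- labelled_trees) fT t y.
Proof.
rewrite /transfer /delta_mon !big_allpairs_dep scaler_sumr.
rewrite [LHS]big_seq [RHS]big_seq; apply: eq_bigr => s /treesP [wts ps].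
pose v := vdl I Pr H (tmap (fun k _ => (false, @pi_op k)) s) y.
transitivity (\sum_(t <- decorate (fun k => enum 'I_(obdim (com_basis K) k)) s) f (mu K m) *: v).
  rewrite [LHS]big_seq [RHS]big_seq; apply: eq_bigr => t ts.
  have [lt wt nt] := decorate_shape ts.
  (* Com is concentrated in degree 0, so its decomposition map has no signs. *)
  have -> : nodd t = 0%N by rewrite /nodd; elim: (nodes t).
  rewrite mul1r /v !tmap_comp.
  have -> : (fun k i => tnth (obvec (com_basis K) k) i) = (fun k _ => mu K k).
    by apply: functional_extensionality_dep => k; apply/funext => i; exact: com_basis_mu.
  rewrite tcomp_mu ?wt ?lt ?(perm_size ps) ?size_enum_ord //.
  congr (_ *: vdl _ _ _ _ _); rewrite -(tmap_const (fun k => (false, @pi_op k)) ts).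
  congr (tmap _ t); apply: functional_extensionality_dep => k; apply/funext => i.
  by congr (_, _); exact: pi_alg_gen.
(* A shape has a single decoration over Com, so only the sum over shapes is left. *)
have : size (decorate (fun k => enum 'I_(obdim (com_basis K) k)) s) = 1%N.
  by apply: size_decorate => // k k0; rewrite size_enum_ord /= k0.
case: (decorate (fun k => enum 'I_(obdim (com_basis K) k)) s) => [//|t0 [|//] _].
rewrite big_seq1; congr (_ *: _).
case: s wts ps @v {t0} => [i|k u ss] wts ps v.
  by rewrite /v /= big_seq1.
have E : tact H (tmap (fun k _ => (false, @pi_op k)) (Node (k := k) u ss)) (I \o y) =
    \sum_(t <- decorate lab (Node (k := k) u ss)) tact H (tT t) (I \o y).
  exact: (tact_decorate lab H_linear opT_linear).
rewrite /v -[LHS]/(Pr (tact H (tmap (fun k _ => (false, @pi_op k)) (Node (k := k) u ss)) (I \o y))) E.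
rewrite linear_sum' // [LHS]big_seq [RHS]big_seq; apply: eq_bigr => t.
by move=> /decorate_shape [_ _]; case: t.
Qed.

Lemma opA_fX_spec b (i : 'I_(obdim e m)) t : t \in labelled_trees ->
  is_op_tensor b (opA i) (fX t) (op_tensor b (opA i) (fX t)).
Proof.
move=> /fX_good [lf ff [n df]].
have [g hg] := op_tensor_exists b (paact_mlinear (p0 := A) (tnth (obvec e m) i))
  (paact_fil (tnth (obvec e m) i)) (opA_deg i) lf ff df.
by rewrite (op_tensorE hg).
Qed.

(** The composite of the decorations is expanded over the basis of P(m), which is where the
    operations p_i of the root of (1) come from. *)
Lemma fT_expand t y : t \in labelled_trees ->
  \sum_i dbasis i (comp t) *: op_tensor (~~ odd (nodd t)) (opA i) (fX t) y
  = (-1) ^+ odd 'C((nodd t).+1, 2) *: fT t y.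
Proof.
move=> tl; have compE : paact (comp t) = fun a : 'I_m -> A => \sum_i dbasis i (comp t) *: opA i a.
  apply/funext => a; rewrite {1}(basis_expand e (comp t)).
  rewrite (linear_sum' _ _ _ (paact_linear (p0 := A) a)).
  by apply: eq_bigr => i _; rewrite (linearZ' _ _ (paact_linear (p0 := A) a)).
have /op_tensorE E := fT_op_tensor tl.
rewrite -[RHS]/((fun y => (-1) ^+ odd 'C((nodd t).+1, 2) *: fT t y) y) -E compE.
rewrite (op_tensorE (op_tensor_lin_l (K := K) (index_enum _) (fun i => dbasis i (comp t))
  (fun i => opA_fX_spec (~~ odd (nodd t)) i tl))).
by [].
Qed.

Lemma pi_alg_transfer (f : dual (com_operad K) m) (y : 'I_m -> ctensor A Y) :
  pi_alg e A (transfer e (ci c) (cp c) (ch c) (oatw X)) m f y =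
  f (mu K m) *: \sum_(t <- labelled_trees) fT t y.
Proof.
(* The coefficient of [t] in the total decomposition of the dual basis element c_i. *)
pose w (i : 'I_(obdim e m)) t : K := (-1) ^+ 'C(nodd t, 2) * dbasis i (comp t).
have trE (i : 'I_(obdim e m)) : transfer e (ci c) (cp c) (ch c) (oatw X) (dbasis i)
    = fun x => \sum_(t <- labelled_trees) w i t *: fX t x.
  apply/funext => x; rewrite /transfer /delta_mon /labelled_trees !big_allpairs_dep.
  by apply: eq_bigr => s _; apply: eq_bigr => t _; rewrite tmap_comp.
rewrite /pi_alg; congr (_ *: _).
transitivity (\sum_(i < obdim e m) \sum_(t <- labelled_trees) (-1) ^+ `|obdeg i|%N *:
    (w i t *: op_tensor (~~ odd `|obdeg i|%N) (opA i) (fX t) y)).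
  apply: eq_bigr => i _; rewrite -scaler_sumr trE; congr (_ *: _).
  by rewrite (op_tensorE (op_tensor_lin_r (w i)
    (fun t tl => opA_fX_spec (~~ odd `|obdeg i|%N) i tl))).
rewrite exchange_big [LHS]big_seq [RHS]big_seq; apply: eq_bigr => t tl.
transitivity ((-1) ^+ odd 'C((nodd t).+1, 2) *:
    \sum_i dbasis i (comp t) *: op_tensor (~~ odd (nodd t)) (opA i) (fX t) y); last first.
  by rewrite fT_expand // scalerA -signr_addb addbb scale1r.
rewrite scaler_sumr; apply: eq_bigr => i _.
have [wtt pt] := labelled_treesP tl.
have [hcomp _] := tcomp_spec (wt := fun k (i : 'I_(obdim e k)) => obdeg i)
  (fun k i => ob_homog i) A wtt pt.
(* Either the coefficient vanishes or the degree of p_i is the weight of [t]. In the latter case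
   both the sign and the parity of the X-factor are determined by r, and r(r-1)/2 + r = r(r+1)/2. *)
rewrite /w; have [->|/(dbasis_homog hcomp) ->] := eqVneq (dbasis i (comp t)) 0.
  by rewrite mulr0 !scale0r !scaler0.
rewrite -odd_nodd !scalerA; congr (_ *: _).
rewrite -[(-1) ^+ `|_|%N]signr_odd -[(-1) ^+ 'C(_, _)]signr_odd -odd_nodd odd_binS.
by rewrite signr_addb mulrA.
Qed.

End Transfer.

Theorem proposition1p38 (K : fieldType) (charK : [pchar K] =i pred0)
    (P : operad K) (e : opbasis P) (X : omega_alg e) (Y : cchain K)
    (c : contraction X Y) (A : palgebra P) :
  pi_alg e A (transfer e (ci c) (cp c) (ch c) (oatw X))
  = transfer (com_basis K)
      (id_tensor A false (ci c)) (id_tensor A false (cp c))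
      (id_tensor A true (ch c))
      (pi_alg e A (oatw X))
  :> opdata (com_operad K) (ctensor A Y).
Proof.
apply: functional_extensionality_dep => m.
apply/funext => f; apply/funext => y.
by rewrite pi_alg_transfer transfer_pi_alg.
Qed.
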